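(* Let $n\ge3$ and $0<\alpha\le2$. Let $F\subset\mathbb R^n$ be a closed set with $c_\alpha(F)>0$ (possibly $F=\mathbb R^n$), and let $\sigma\in\mathfrak M^+(F)$ satisfy $1<\sigma(F)<\infty$. Assume that $\kappa_\alpha(\cdot,\sigma)$ is (finitely) continuous and upper bounded on $F$. Let $\lambda$ be the (existing and unique) measure in $\mathcal E^\sigma_\alpha(F,1)$ with $\|\lambda\|_\alpha^2=\inf_{\mu\in\mathcal E^\sigma_\alpha(F,1)}\|\mu\|^2_\alpha$, and let $q:=1/(\sigma(F)-1)$. Then the measure $\theta:=q(\sigma-\lambda)$ is the solution to the unconstrained weighted minimum energy problem with the external field $f:=-q\kappa_\alpha(\cdot,\sigma)$, i.e. $\theta\in\mathcal E^+_{\alpha,f}(F,1)$ and $$G_{\alpha,f}(\theta)=\inf_{\mu\in\mathcal E^+_{\alpha,f}(F,1)}G_{\alpha,f}(\mu).$$ Moreover, there exists $\eta\in(0,\infty)$ such that $$W^\theta_{\alpha,f}=-\eta\ \text{ on }S(\theta),\qquad W^\theta_{\alpha,f}\ge-\eta\ \text{ on }\mathbb R^n,$$ and these two relations determine uniquely the solution to the unconstrained problem among the measures of the class $\mathcal E^+_{\alpha,f}(F,1)$; that is, if $\nu\in\mathcal E^+_{\alpha,f}(F,1)$ satisfies these two relations with $\nu$ in place of $\theta$ for some $\eta\in(0,\infty)$, then $\nu=\theta$.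
   Context: $\kappa_\alpha(x,y)=|x-y|^{\alpha-n}$; $\kappa_\alpha(x,\mu)=\int|x-y|^{\alpha-n}d\mu(y)$, $\kappa_\alpha(\mu,\mu)=\iint|x-y|^{\alpha-n}d\mu(x)d\mu(y)=\|\mu\|^2_\alpha$. $c_\alpha(Q)=[\inf\kappa_\alpha(\mu,\mu)]^{-1}$ over positive Radon measures $\mu$ of finite energy carried by $Q$ with $\mu(Q)=1$. $\mathfrak M^+(F)$: positive Radon measures on $\mathbb R^n$ supported by $F$. $S(\mu)$: support of $\mu$. $\mathcal E^\sigma_\alpha(F,1)$: all $\mu\in\mathfrak M^+(F)$ with $\mu\le\sigma$, $\mu(F)=1$, $\kappa_\alpha(\mu,\mu)<\infty$. For the external field $f$: $G_{\alpha,f}(\mu)=\kappa_\alpha(\mu,\mu)+2\int f\,d\mu$, $W^\mu_{\alpha,f}=\kappa_\alpha(\cdot,\mu)+f$, and $\mathcal E^+_{\alpha,f}(F,1)$ is the set of $\mu\in\mathfrak M^+(F)$ with $\mu(F)=1$, $\kappa_\alpha(\mu,\mu)<\infty$ and $\int f\,d\mu$ finite. *)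

(* Defs.v *)
From HB Require Import structures.
From mathcomp Require Import all_boot all_order all_algebra.
From mathcomp Require Import all_classical all_reals all_analysis.

Set Implicit Arguments.
Unset Strict Implicit.
Unset Printing Implicit Defensive.

Import Order.TTheory GRing.Theory Num.Theory.
Import numFieldNormedType.Exports.

Local Open Scope classical_set_scope.
Local Open Scope ring_scope.
Local Open Scope ereal_scope.

(* R^n with its Borel sigma-algebra.  The carrier is 'rV[R]_n, so a borelRn R n
   and a 'rV[R]_n are interchangeable; its topology is the usual one of R^n. *)
Definition borelRn (R : realType) (n : nat) : measurableType _ :=
  g_sigma_algebraType (@open 'rV[R]_n).

Notation borel_measure R n := {measure set (borelRn R n) -> \bar R}.

(* The library norm on 'rV[R]_n is the sup norm. *)
Definition enorm (R : realType) (n : nat) (x : 'rV[R]_n) : R :=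
  Num.sqrt (\sum_(i < n) (x ord0 i) ^+ 2)%R.

(* The value on the diagonal is given separately because powR sends 0 to 0 for
   every nonzero exponent, whereas |x - x|^(alpha - n) is +oo for alpha < n. *)
Definition riesz_kernel (R : realType) (n : nat) (alpha : R)
    (x y : 'rV[R]_n) : \bar R :=
  if x == y then +oo else ((enorm (x - y)) `^ (alpha - n%:R))%:E.

Definition potential (R : realType) (n : nat) (alpha : R)
    (mu : borel_measure R n) (x : 'rV[R]_n) : \bar R :=
  \int[mu]_y riesz_kernel alpha x y.

Definition energy (R : realType) (n : nat) (alpha : R)
    (mu : borel_measure R n) : \bar R :=
  \int[mu]_x potential alpha mu x.

(* On R^n a Borel measure finite on compact sets is automatically regular. *)
Definition radon (R : realType) (n : nat) (mu : borel_measure R n) : Prop :=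
  forall K : set 'rV[R]_n, compact K -> mu K < +oo.

Definition carried_by (R : realType) (n : nat) (Q : set 'rV[R]_n)
    (mu : borel_measure R n) : Prop :=
  mu (~` Q) = 0.

Definition support (R : realType) (n : nat) (mu : borel_measure R n) :
    set 'rV[R]_n :=
  [set x | forall U : set 'rV[R]_n, open U -> U x -> 0 < mu U].

Definition radon_on (R : realType) (n : nat) (F : set 'rV[R]_n) :
    set (borel_measure R n) :=
  [set mu | radon mu /\ support mu `<=` F].

(* In \bar R, the inverse of 0 is +oo and the inverse of +oo is 0. *)
Definition capacity (R : realType) (n : nat) (alpha : R)
    (Q : set 'rV[R]_n) : \bar R :=
  (ereal_inf [set energy alpha mu | mu in
     [set mu : borel_measure R n |
       [/\ radon mu, energy alpha mu < +oo, carried_by Q mu & mu Q = 1]]])^-1.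

(* Measures are functions on all sets, with arbitrary values on non-measurable
   ones: they are compared on Borel sets only. *)
Definition measure_le (R : realType) (n : nat)
    (mu sigma : borel_measure R n) : Prop :=
  forall A : set (borelRn R n), measurable A -> mu A <= sigma A.

Definition measure_eq (R : realType) (n : nat)
    (mu nu : borel_measure R n) : Prop :=
  forall A : set (borelRn R n), measurable A -> mu A = nu A.

Definition constrained_class (R : realType) (n : nat) (alpha : R)
    (sigma : borel_measure R n) (F : set 'rV[R]_n) : set (borel_measure R n) :=
  [set mu | [/\ radon_on F mu, measure_le mu sigma, mu F = 1 &
                energy alpha mu < +oo]].

Definition weighted_class (R : realType) (n : nat) (alpha : R)
    (f : 'rV[R]_n -> \bar R) (F : set 'rV[R]_n) : set (borel_measure R n) :=
  [set mu | [/\ radon_on F mu, mu F = 1, energy alpha mu < +oo &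
                mu.-integrable setT (f : borelRn R n -> \bar R)]].

Definition weighted_energy (R : realType) (n : nat) (alpha : R)
    (f : 'rV[R]_n -> \bar R) (mu : borel_measure R n) : \bar R :=
  energy alpha mu + 2%:E * \int[mu]_x f x.

Definition weighted_potential (R : realType) (n : nat) (alpha : R)
    (f : 'rV[R]_n -> \bar R) (mu : borel_measure R n) (x : 'rV[R]_n) : \bar R :=
  potential alpha mu x + f x.

Definition equilibrium_relations (R : realType) (n : nat) (alpha : R)
    (f : 'rV[R]_n -> \bar R) (mu : borel_measure R n) (eta : R) : Prop :=
  (forall x, support mu x -> weighted_potential alpha f mu x = (- eta)%:E) /\
  (forall x, (- eta)%:E <= weighted_potential alpha f mu x).

(* Main.v *)
(* With a = (n - alpha) / 2, the kernel |x - y|^(alpha - n) is, up to a constant,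
   the integral over tau of e^(a tau) exp (- e^tau |x - y|^2), and a Gaussian is a
   mixture of products g(x) g(y).  Hence mutual energies satisfy
   2 E(mu, nu) <= E(mu, mu) + E(nu, nu).  In case of equality all Gaussian
   potentials of mu and nu agree, and since products of Gaussians are Gaussians
   and powers of them approximate indicators of balls, mu = nu.

   Moving mass from lambda to tau = sigma - lambda shows that U^lambda on
   S(lambda) is at most U^lambda on S(tau).  As U^lambda = U^sigma - U^tau is
   continuous on F, the maximum principle for alpha <= 2 bounds U^lambda
   everywhere by each of its values on S(tau); so U^lambda is a constant w on
   S(tau) and at most w elsewhere.  Since W^theta = - q U^lambda, these are the
   relations with eta = q w, and integrating them turns minimality and uniqueness
   into the energy inequality and its equality case.  The maximum principle comes
   from the subharmonicity of the kernel off the diagonal, expressed by second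
   differences along the axes. *)

Require Import Defs.
From HB Require Import structures.
From mathcomp Require Import all_boot all_order all_algebra.
From mathcomp Require Import all_classical all_reals all_analysis.
From mathcomp Require Import measurable_realfun ring lra.

Set Implicit Arguments.
Unset Strict Implicit.
Unset Printing Implicit Defensive.

Import Order.TTheory GRing.Theory Num.Theory.
Import numFieldNormedType.Exports.

Local Open Scope classical_set_scope.
Local Open Scope ring_scope.
Local Open Scope ereal_scope.

(* Otherwise shadowed by the MathComp notation for the support of a function. *)
Local Notation support := Defs.support.

(** * Positivity of the Riesz energy *)

(** The maximum principle looks at U^lambda from all sides of S(lambda), whereas the hypothesis
    controls U^sigma along F only. The bridge is a continuity principle: upper semicontinuity
    relative to F spreads to full neighbourhoods, because the potential of a small piece of mass is
    at most a constant times its value at an almost nearest point of F. Moreover S(lambda) may be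
    unbounded, while the argument by a maximum needs compactness; hence the detour through the parts
    of lambda in cubes and Fatou. Second differences replace derivatives because they are
    inequalities between finitely many values of the kernel: they integrate against a measure as
    they stand, with an error of order h^4 that is uniform at a given distance from the support, and
    nothing is differentiated under an integral. Signed measures never occur. Energies live in
    [0, +oo], measures are subtracted only below a finite measure, and the relations for W are
    rearranged into relations between nonnegative functions before being integrated. *)

Section positive_semidefinite_kernels.
Context d (T : measurableType d) (R : realType).
Implicit Types (p q : {finite_measure set T -> \bar R}) (K : T * T -> \bar R).

Definition weighted_pairing p q (u v : T -> \bar R) K : \bar R :=
  \int[p]_x \int[q]_y (u x * v y * K (x, y)).

(* Stating positivity through products of two weighted measures, rather than
   through a signed measure, keeps every integral in [0, +oo]. *)
Definition psd K :=
  [/\ measurable_fun [set: T * T] K, (forall z, 0 <= K z) &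
  forall p q (u v : T -> \bar R),
    measurable_fun setT u -> measurable_fun setT v ->
    (forall x, 0 <= u x) -> (forall x, 0 <= v x) ->
    2%:E * weighted_pairing p q u v K <=
    weighted_pairing p p u u K + weighted_pairing q q v v K].

Lemma mule2_le_sqr (a b : \bar R) : 0 <= a -> 0 <= b ->
  2%:E * (a * b) <= a * a + b * b.
Proof.
case: a => [a| |] a0; case: b => [b| |] b0 //.
- by rewrite -!EFinM -EFinD lee_fin; have := sqr_ge0 (a - b)%R; nra.
- by rewrite [+oo * +oo]mulyy addey ?leey // -EFinM.
- by rewrite [+oo * +oo]mulyy addye ?leey // -EFinM.
- by rewrite !mulyy leey.
Qed.

Lemma measurable_weight (u v : T -> \bar R) K :
  measurable_fun setT u -> measurable_fun setT v -> measurable_fun setT K ->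
  measurable_fun setT (fun z : T * T => u z.1 * v z.2 * K z).
Proof.
move=> mu mv mK; apply: emeasurable_funM => //; apply: emeasurable_funM.
  exact: (measurableT_comp mu measurable_fst).
exact: (measurableT_comp mv measurable_snd).
Qed.

(** Here a pairing is the product of the integrals of its two weights, so the inequality is
    [mule2_le_sqr]. *)
Lemma psd_cst1 : psd (fun=> 1).
Proof.
split => //.
move=> p q u v mu mv u0 v0.
have E p' q' (u' v' : T -> \bar R) : measurable_fun setT u' ->
    measurable_fun setT v' -> (forall x, 0 <= u' x) -> (forall x, 0 <= v' x) ->
    weighted_pairing p' q' u' v' (fun=> 1) = (\int[p']_x u' x) * (\int[q']_x v' x).
  move=> mu' mv' u'0 v'0; rewrite /weighted_pairing.
  under eq_integral => x _ do under eq_integral => y _ do rewrite mule1.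
  under eq_integral => x _ do rewrite ge0_integralZl //.
  by rewrite ge0_integralZr // integral_ge0.
by rewrite !E //; apply: mule2_le_sqr; apply: integral_ge0.
Qed.

(** The factor [g] is absorbed into the weights; this is what the weights [u] and [v] in [psd] are
    for. *)
Lemma psd_rank_one K (g : T -> \bar R) : psd K -> measurable_fun setT g ->
  (forall x, 0 <= g x) -> psd (fun z => g z.1 * g z.2 * K z).
Proof.
move=> [mK K0 HK] mg g0; split.
- exact: measurable_weight.
- by move=> z; rewrite !mule_ge0.
move=> p q u v mu mv u0 v0.
have E p' q' (u' v' : T -> \bar R) :
   weighted_pairing p' q' u' v' (fun z => g z.1 * g z.2 * K z) =
   weighted_pairing p' q' (fun x => u' x * g x) (fun x => v' x * g x) K.
  apply: eq_integral => x _; apply: eq_integral => y _ /=.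
  rewrite !muleA; congr (_ * _).
  by rewrite -!muleA; congr (_ * _); rewrite muleCA.
rewrite !E; apply: HK => //; try exact: emeasurable_funM.
- by move=> x; rewrite mule_ge0.
- by move=> x; rewrite mule_ge0.
Qed.

(** By Tonelli the mixing integral moves outside the two integrals of a pairing, and the inequality
    is then integrated in [z]. *)
Lemma psd_mixture dZ (Z : measurableType dZ)
    (m : {sigma_finite_measure set Z -> \bar R}) (K : Z * (T * T) -> \bar R) :
  measurable_fun setT K -> (forall z, psd (fun w => K (z, w))) ->
  psd (fun w => \int[m]_z K (z, w)).
Proof.
move=> mK HK.
have K0 z : 0 <= K z by case: z => z w; case: (HK z) => _ + _; exact.
split.
- exact: (measurable_fun_fubini_tonelli_G K).
- by move=> w; apply: integral_ge0.
move=> p q u v mu mv u0 v0.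
pose G (u' v' : T -> \bar R) (w : Z * (T * T)) := u' w.2.1 * v' w.2.2 * K w.
have mG (u' v' : T -> \bar R) : measurable_fun setT u' ->
    measurable_fun setT v' -> measurable_fun setT (G u' v').
  move=> mu' mv'; apply: emeasurable_funM => //.
  apply: (measurableT_comp (f := fun w : T * T => u' w.1 * v' w.2)) => //.
  apply: emeasurable_funM.
    exact: (measurableT_comp mu' measurable_fst).
  exact: (measurableT_comp mv' measurable_snd).
have G0 (u' v' : T -> \bar R) : (forall x, 0 <= u' x) -> (forall x, 0 <= v' x) ->
    forall w, 0 <= G u' v' w.
  by move=> u'0 v'0 w; rewrite !mule_ge0.
have mGi (u' v' : T -> \bar R) q' : measurable_fun setT u' ->
    measurable_fun setT v' -> (forall x, 0 <= u' x) -> (forall x, 0 <= v' x) ->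
    measurable_fun setT (fun w : Z * T => \int[q']_y G u' v' (w.1, (w.2, y))).
  move=> mu' mv' u'0 v'0.
  apply: (measurable_fun_fubini_tonelli_F
    (fun w : (Z * T) * T => G u' v' (w.1.1, (w.1.2, w.2)))).
    apply: (measurableT_comp (mG _ _ mu' mv')).
    apply/measurable_fun_pairP; split => /=.
      exact: (measurableT_comp measurable_fst measurable_fst).
    apply/measurable_fun_pairP; split => /=; last exact: measurable_snd.
    exact: (measurableT_comp measurable_snd measurable_fst).
  by move=> w; exact: (G0 _ _ u'0 v'0 _).
have Gi0 (u' v' : T -> \bar R) q' : (forall x, 0 <= u' x) -> (forall x, 0 <= v' x) ->
    forall w : Z * T, 0 <= \int[q']_y G u' v' (w.1, (w.2, y)).
  by move=> u'0 v'0 w; apply: integral_ge0 => y _; exact: (G0 _ _ u'0 v'0 _).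
have E p' q' (u' v' : T -> \bar R) : measurable_fun setT u' ->
    measurable_fun setT v' -> (forall x, 0 <= u' x) -> (forall x, 0 <= v' x) ->
    weighted_pairing p' q' u' v' (fun w => \int[m]_z K (z, w)) =
    \int[m]_z weighted_pairing p' q' u' v' (fun w => K (z, w)).
  move=> mu' mv' u'0 v'0.
  have F := @fubini_tonelli _ _ _ _ _ m p' _ (mGi _ _ q' mu' mv' u'0 v'0)
    (Gi0 _ _ q' u'0 v'0).
  rewrite /weighted_pairing [RHS]F; apply: eq_integral => x _ /=.
  have mGx : measurable_fun setT (fun w : Z * T => G u' v' (w.1, (x, w.2))).
    apply: (measurableT_comp (mG _ _ mu' mv')).
    exact: (measurable_fun_pair measurable_fst
      (measurable_fun_pair (measurable_cst x) measurable_snd)).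
  have F2 := @fubini_tonelli _ _ _ _ _ m q' _ mGx (fun=> G0 _ _ u'0 v'0 _).
  rewrite [RHS]F2; apply: eq_integral => y _ /=.
  rewrite /G /= ge0_integralZl //.
  - exact: (measurableT_comp mK (measurable_pair2 (x, y))).
  - by rewrite mule_ge0.
have W0 p' q' (u' v' : T -> \bar R) z : (forall x, 0 <= u' x) ->
    (forall x, 0 <= v' x) -> 0 <= weighted_pairing p' q' u' v' (fun w => K (z, w)).
  by move=> u'0 v'0; apply: integral_ge0 => x _; exact: (Gi0 _ _ q' u'0 v'0 (z, x)).
have mP p' q' (u' v' : T -> \bar R) : measurable_fun setT u' ->
    measurable_fun setT v' -> (forall x, 0 <= u' x) -> (forall x, 0 <= v' x) ->
    measurable_fun setT (fun z => weighted_pairing p' q' u' v' (fun w => K (z, w))).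
  move=> mu' mv' u'0 v'0.
  exact: (measurable_fun_fubini_tonelli_F _ (mGi _ _ q' mu' mv' u'0 v'0)
    (Gi0 _ _ q' u'0 v'0)).
rewrite !E //.
rewrite -ge0_integralD //; [|by move=> z _; exact: W0|exact: mP|by move=> z _; exact: W0|exact: mP].
rewrite -ge0_integralZl //; [|exact: mP|by move=> z _; exact: W0].
apply: ge0_le_integral => //.
- by move=> z _; rewrite mule_ge0 // W0.
- by apply: measurable_funeM; exact: mP.
- by apply: emeasurable_funD; exact: mP.
by move=> z _; case: (HK z) => _ _; exact.
Qed.

(** Serves to drop the normalizing constant of [gaussian_mixture]. *)
Lemma psd_scale K (c : R) : (0 < c)%R -> psd (fun z => c%:E * K z) -> psd K.
Proof.
move=> c0 [mK K0 HK].
have KE : K = fun z => c^-1%:E * (c%:E * K z).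
  by apply/funext => z; rewrite muleA -EFinM mulVf ?mul1e // gt_eqF.
have mK' : measurable_fun setT K by rewrite KE; apply: measurable_funeM.
have K0' z : 0 <= K z by rewrite KE mule_ge0 // lee_fin invr_ge0 ltW.
split; [exact: mK'|exact: K0'|move=> p q u v mu mv u0 v0].
have E p' q' (u' v' : T -> \bar R) : measurable_fun setT u' ->
    measurable_fun setT v' -> (forall x, 0 <= u' x) -> (forall x, 0 <= v' x) ->
    weighted_pairing p' q' u' v' (fun z => c%:E * K z) =
    c%:E * weighted_pairing p' q' u' v' K.
  move=> mu' mv' u'0 v'0.
  have mW := measurable_weight mu' mv' mK'.
  have W0 z : 0 <= u' z.1 * v' z.2 * K z by rewrite !mule_ge0.
  rewrite /weighted_pairing -ge0_integralZl //.
  - apply: eq_integral => x _; rewrite -ge0_integralZl //.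
    + by apply: eq_integral => y _; rewrite muleCA.
    + exact: (measurableT_comp mW (measurable_pair1 x)).
    + by move=> y _; exact: (W0 (x, y)).
    + by rewrite lee_fin ltW.
  - exact: (measurable_fun_fubini_tonelli_F _ mW W0).
  - by move=> x _; apply: integral_ge0 => y _; exact: (W0 (x, y)).
  - by rewrite lee_fin ltW.
have := HK p q u v mu mv u0 v0; rewrite !E // muleCA -ge0_muleDr; last 2 first.
- by apply: integral_ge0 => x _; apply: integral_ge0 => y _; rewrite !mule_ge0.
- by apply: integral_ge0 => x _; apply: integral_ge0 => y _; rewrite !mule_ge0.
by rewrite lee_pmul2l // lte_fin.
Qed.

End positive_semidefinite_kernels.

(** * Gaussian and Gamma integrals on the line *)

Section gaussian_and_gamma_integrals.
Variable R : realType.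
Implicit Types a t s c x y N tau : R.
Local Notation leb := (@lebesgue_measure R).

Lemma integral_affine s c (G : R -> R) : (0 < s)%R -> continuous G ->
  (forall x, 0 <= G x)%R ->
  \int[leb]_x (G x)%:E = \int[leb]_x (G (s * x + c) * s)%:E.
Proof.
move=> s0 cG G0; pose F x := (s * x + c)%R.
have dF x : is_derive x 1%R F s.
  apply: is_derive_eq; by rewrite addr0 /GRing.scale /= mulr1.
have F' : F^`()%classic = cst s.
  by apply/funext => x; rewrite derive1E derive_val.
rewrite (@increasing_ge0_integration_by_substitutionT _ F G) //.
- by apply: eq_integral => x _; rewrite F'.
- by move=> x y xy; rewrite /F ltrD2r ltr_pM2l.
- by rewrite F' => x; exact: cvg_cst.
- by rewrite F'; exact: is_cvg_cst.
- by rewrite F'; exact: is_cvg_cst.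
- apply/cvgrNyPle => A; exists ((A - c) / s)%R; split; first exact: num_real.
  by move=> x /ltW; rewrite ler_pdivlMr // lerBrDr mulrC.
- apply/cvgryPge => A; exists ((A - c) / s)%R; split; first exact: num_real.
  by move=> x /ltW; rewrite ler_pdivrMr // lerBlDr mulrC.
Qed.

(** Completing the square: [2t ((x - z)^2 + (y - z)^2) = t (x - y)^2 + 4t (z - (x + y)/2)^2]. What
    remains in [z] is a Gaussian integral of scale [s = 2 sqrt t]. *)
Lemma gaussian_mixture t : (0 < t)%R -> exists2 C, (0 < C)%R & forall x y,
  \int[leb]_z (expR (- (2 * t) * (x - z) ^+ 2) *
               expR (- (2 * t) * (y - z) ^+ 2))%:E =
  (C * expR (- t * (x - y) ^+ 2))%:E.
Proof.
move=> t0; pose s := (2 * Num.sqrt t)%R.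
have s0 : (0 < s)%R by rewrite mulr_gt0 // sqrtr_gt0.
have s2 : (s ^+ 2 = 4 * t)%R by rewrite exprMn sqr_sqrtr ?ltW //; ring.
exists (Num.sqrt pi / s)%R; first by rewrite divr_gt0 // sqrtr_gt0 pi_gt0.
move=> x y; pose c := (- s * ((x + y) / 2))%R.
have E z : (expR (- (2 * t) * (x - z) ^+ 2) * expR (- (2 * t) * (y - z) ^+ 2) =
    (expR (- t * (x - y) ^+ 2) / s) * (gauss_fun (s * z + c) * s))%R.
  have sz : ((s * z + c) ^+ 2 = s ^+ 2 * (z - (x + y) / 2) ^+ 2)%R by rewrite /c; ring.
  rewrite -expRD (_ : - (2 * t) * (x - z) ^+ 2 + - (2 * t) * (y - z) ^+ 2 =
    - t * (x - y) ^+ 2 + - (s * z + c) ^+ 2)%R; last by rewrite sz s2; field.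
  by rewrite expRD /gauss_fun; field; rewrite gt_eqF.
under eq_integral do rewrite E EFinM.
have cg : continuous (@gauss_fun R) by exact: continuous_gauss_fun.
have mG : measurable_fun setT (fun z => (gauss_fun (s * z + c) * s)%R).
  apply: measurable_funM => //.
  apply: (measurableT_comp (@measurable_gauss_fun R)).
  exact: measurable_funD.
rewrite ge0_integralZl //; first last.
- by rewrite lee_fin divr_ge0 ?expR_ge0 ?ltW.
- by move=> z _; rewrite lee_fin mulr_ge0 ?gauss_fun_ge0 ?ltW.
- exact/measurable_EFinP.
rewrite -integral_affine // ?integralT_gauss; last exact: gauss_fun_ge0.
by rewrite -EFinM; congr EFin; field; rewrite gt_eqF.
Qed.

(** The integrand of [\int_0^oo u^(a-1) e^(- u N) du = Gamma(a) N^(-a)] after [u = e^tau]. In the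
    logarithmic variable the domain is the whole line and rescaling [N] is a translation;
    [gamma_mass a] is Gamma(a). *)
Definition gamma_fun a N tau : R := (expR (a * tau) * expR (- (expR tau * N)))%R.

Definition gamma_mass a : \bar R := \int[leb]_tau (gamma_fun a 1 tau)%:E.

Lemma gamma_fun_ge0 a N tau : (0 <= gamma_fun a N tau)%R.
Proof. by rewrite mulr_ge0 ?expR_ge0. Qed.

Lemma continuous_gamma_fun a N : continuous (gamma_fun a N).
Proof.
have c1 : continuous (fun tau => expR (a * tau)).
  move=> x; apply: continuous_comp; last exact: continuous_expR.
  exact: mulrl_continuous.
have c2 : continuous (fun tau => expR (- (expR tau * N))).
  move=> x; apply: continuous_comp; last exact: continuous_expR.
  apply: continuousN; apply: (@continuous_comp _ _ _ expR ( *%R^~ N)).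
    exact: continuous_expR.
  exact: mulrr_continuous.
by move=> x; exact: (continuousM (c1 x) (c2 x)).
Qed.

Lemma measurable_gamma_fun a N : measurable_fun setT (gamma_fun a N).
Proof. by apply: continuous_measurable_fun; exact: continuous_gamma_fun. Qed.

Lemma measurable_EFin_gamma_fun a N :
  measurable_fun setT (fun tau : measurableTypeR R => (gamma_fun a N tau)%:E).
Proof. by apply/measurable_EFinP; exact: measurable_gamma_fun. Qed.

(* The substitution tau -> tau + ln N. *)
Lemma integral_gamma_fun a N : (0 < N)%R ->
  \int[leb]_tau (gamma_fun a N tau)%:E = (N `^ (- a))%:E * gamma_mass a.
Proof.
move=> N0; rewrite /gamma_mass (@integral_affine 1 (ln N) (gamma_fun a 1)) //; last 2 first.
- exact: continuous_gamma_fun.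
- exact: gamma_fun_ge0.
rewrite -ge0_integralZl //.
- apply: eq_integral => tau _; rewrite -EFinM; congr EFin.
  rewrite /gamma_fun !mul1r !mulr1 expRD lnK ?posrE // mulrDr expRD.
  by rewrite powRN /powR gt_eqF //; field; rewrite gt_eqF // expR_gt0.
- apply/measurable_EFinP; apply: measurable_funM => //.
  apply: (measurableT_comp (measurable_gamma_fun a 1)).
  exact: measurable_funD.
- by move=> x _; rewrite lee_fin mulr_ge0 ?gamma_fun_ge0.
- by rewrite lee_fin powR_ge0.
Qed.

Lemma gamma_mass_gt0 a : 0 < gamma_mass a.
Proof.
pose c := (expR (- `|a|) * expR (- expR 1))%R.
have c0 : (0 < c)%R by rewrite mulr_gt0 ?expR_gt0.
apply: (@lt_le_trans _ _ (\int[leb]_(x in `[0%R, 1%R]) (cst c%:E x))).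
  rewrite integral_cst //= lebesgue_measure_itv /= lte_fin ltr01 /=.
  by rewrite oppr0 adde0 mule1 lte_fin.
apply: (@le_trans _ _ (\int[leb]_(x in `[0%R, 1%R]) (gamma_fun a 1 x)%:E)).
  apply: ge0_le_integral => //=.
  - by move=> x _; rewrite lee_fin ltW.
  - by apply: measurable_funTS; exact: measurable_EFin_gamma_fun.
  move=> x; rewrite in_itv /= => /andP[x0 x1]; rewrite lee_fin.
  apply: ler_pM; rewrite ?expR_ge0 // ler_expR.
    have := ler_norm (- (a * x))%R; rewrite normrN normrM (ger0_norm x0).
    have := normr_ge0 a; nra.
  by rewrite mulr1 lerN2 ler_expR.
apply: ge0_subset_integral => //=.
  exact: measurable_EFin_gamma_fun.
by move=> x _; rewrite lee_fin gamma_fun_ge0.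
Qed.

Lemma integral_expR_normN b : (0 < b)%R ->
  \int[leb]_x (expR (- b * `|x|))%:E < +oo.
Proof.
move=> b0.
have cf : continuous (fun x : R => expR (- b * `|x|)).
  move=> x; apply: continuous_comp; last exact: continuous_expR.
  by apply: continuous_comp; [exact: norm_continuous|exact: mulrl_continuous].
rewrite (@ge0_symfun_integralT R (fun x => expR (- b * `|x|))) //; last by move=> x /=; rewrite normrN.
rewrite lte_mul_pinfty //.
rewrite -set_itvcy.
apply: (@le_lt_trans _ _ (\int[leb]_x (b^-1%:E * (exponential_pdf b x)%:E))).
  apply: (@le_trans _ _ (\int[leb]_(x in `[0%R, +oo[) (b^-1%:E * (exponential_pdf b x)%:E))).
    rewrite le_eqVlt; apply/orP; left; apply/eqP.
    apply: eq_integral => x; rewrite inE /= in_itv /= andbT => x0.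
    rewrite exponential_pdfE // -EFinM; congr EFin.
    by rewrite ger0_norm // mulrA mulVf ?mul1r // gt_eqF.
  apply: ge0_subset_integral => //=.
    by apply: measurable_funeM; apply/measurable_EFinP; exact: measurable_exponential_pdf.
  by move=> x _; rewrite mule_ge0 ?lee_fin ?invr_ge0 ?exponential_pdf_ge0 // ltW.
rewrite ge0_integralZl //; last 3 first.
- by apply/measurable_EFinP; exact: measurable_exponential_pdf.
- by move=> x _; rewrite lee_fin exponential_pdf_ge0 // ltW.
- by rewrite lee_fin invr_ge0 ltW.
by rewrite integral_exponential_pdf // mule1 ltry.
Qed.

(** Comparison with [C e^(- b |x|)], [b = min(a, 1)]: for [x < 0] the factor [e^(a x)] decays fast
    enough, and for [x >= 0] the double exponential beats every power of [e^x]. *)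
Lemma gamma_mass_lty a : (0 < a)%R -> gamma_mass a < +oo.
Proof.
move=> a0; pose b := Num.min a 1%R.
have b0 : (0 < b)%R by rewrite lt_min a0 /=.
have ba : (b <= a)%R by rewrite ge_min lexx.
have b1 : (b <= 1)%R by rewrite ge_min lexx orbT.
have [k ak] : exists k : nat, (a + 1 <= k%:R)%R.
  by exists (Num.truncn (a + 1)).+1; rewrite ltW // truncnS_gt.
have k0 : (0 < k%:R :> R)%R by rewrite (lt_le_trans _ ak) // addr_gt0.
pose C := (1 + k%:R ^+ k : R)%R.
have C1 : (1 <= C)%R by rewrite lerDl exprn_ge0 // ltW.
have C0 : (0 < C)%R by rewrite (lt_le_trans _ C1).
have mE : measurable_fun setT (fun x : R => (expR (- b * `|x|))%:E).
  apply/measurable_EFinP; apply: (measurableT_comp (@measurable_expR R)).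
  by apply: measurable_funM => //; exact: measurable_normr.
apply: (@le_lt_trans _ _ (\int[leb]_x (C%:E * (expR (- b * `|x|))%:E))).
  apply: ge0_le_integral => //=.
  - by move=> x _; rewrite lee_fin gamma_fun_ge0.
  - exact: measurable_EFin_gamma_fun.
  - exact: measurable_funeM.
  move=> x _; rewrite -EFinM lee_fin /gamma_fun mulr1.
  have [x0|x0] := leP 0%R x; last first.
    apply: (@le_trans _ _ (expR (a * x))).
      by rewrite ler_piMr ?expR_ge0 // -expR0 ler_expR oppr_le0 expR_ge0.
    rewrite -[leLHS]mul1r; apply: ler_pM; rewrite ?expR_ge0 //.
    by rewrite ler_expR ltr0_norm // mulrNN; nra.
  (* With [u = e^x] this is [u^k <= k^k e^u], the k-th power of [u <= k e^(u/k)]. *)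
  have H : (expR (k%:R * x) <= k%:R ^+ k * expR (expR x))%R.
    have -> : (expR x = k%:R * (expR x / k%:R))%R by field; rewrite gt_eqF.
    rewrite !expRM_natl -exprMn.
    apply: lerXn2r; rewrite ?nnegrE ?mulr_ge0 ?expR_ge0 // ?(ltW k0) //.
    rewrite mulrC -ler_pdivrMr //.
    by rewrite (le_trans _ (expR_ge1Dx _)) // lerDr.
  rewrite expRN ler_pdivrMr ?expR_gt0 // ger0_norm //.
  rewrite -(ler_pM2l (expR_gt0 (b * x))) -expRD.
  have -> : (expR (b * x) * (C * expR (- b * x) * expR (expR x)) = C * expR (expR x))%R.
    by rewrite mulNr expRN; field; rewrite gt_eqF // expR_gt0.
  apply: (@le_trans _ _ (expR (k%:R * x))); first by rewrite ler_expR; nra.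
  by rewrite (le_trans H) // ler_pM2r ?expR_gt0 // lerDr.
rewrite ge0_integralZl //; last by rewrite lee_fin ltW.
by rewrite lte_mul_pinfty // ?integral_expR_normN // lee_fin ltW.
Qed.

(** The integrand is at least 1 on the positive half-line. This case reproduces the value +oo of the
    kernel on the diagonal. *)
Lemma integral_gamma_fun0 a : (0 < a)%R ->
  \int[leb]_tau (gamma_fun a 0 tau)%:E = +oo.
Proof.
move=> a0; apply/eqP; rewrite -leye_eq.
apply: (@le_trans _ _ (\int[leb]_(x in `[0%R, +oo[) (cst 1 x))).
  by rewrite integral_cst //= lebesgue_measure_itv /= ltry mul1e addye.
apply: (@le_trans _ _ (\int[leb]_(x in `[0%R, +oo[) (gamma_fun a 0 x)%:E)).
  apply: ge0_le_integral => //=.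
    by apply: measurable_funTS; exact: measurable_EFin_gamma_fun.
  move=> x; rewrite in_itv /= andbT => x0; rewrite lee_fin /gamma_fun mulr0 oppr0.
  by rewrite expR0 mulr1 -expR0 ler_expR mulr_ge0 // ltW.
apply: ge0_subset_integral => //=.
  exact: measurable_EFin_gamma_fun.
by move=> x _; rewrite lee_fin gamma_fun_ge0.
Qed.

End gaussian_and_gamma_integrals.

(** * The Riesz kernel as a mixture of Gaussians *)

Section gaussian_representation.
Context (R : realType) (n : nat).
Local Notation T := (borelRn R n).
Local Notation leb := (@lebesgue_measure R).
Implicit Types (x y : 'rV[R]_n) (a t tau : R).

(** The squared Euclidean distance. It is polynomial in the coordinates, and the kernel becomes its
    power of exponent [- (n - alpha)/2]; the price is the factor 2 in [sqd_triangle]. *)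
Definition sqd x y : R := (\sum_(i < n) (x ord0 i - y ord0 i) ^+ 2)%R.

Lemma sqd_ge0 x y : (0 <= sqd x y)%R.
Proof. by apply: sumr_ge0 => i _; exact: sqr_ge0. Qed.

Lemma sqdC x y : sqd x y = sqd y x.
Proof. by apply: eq_bigr => i _; rewrite -sqrrN opprB. Qed.

Lemma sqd_eq0 x y : (sqd x y == 0%R) = (x == y).
Proof.
apply/eqP/eqP => [|->]; last by apply: big1 => i _; rewrite subrr expr0n.
move=> /eqP; rewrite psumr_eq0; last by move=> i _; exact: sqr_ge0.
move=> /allP H; apply/rowP => i; apply/eqP; rewrite -subr_eq0 -sqrf_eq0.
exact: (implyP (H i (mem_index_enum i))).
Qed.

Lemma sqdxx x : sqd x x = 0%R.
Proof. by apply/eqP; rewrite sqd_eq0. Qed.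

Lemma sqd_gt0 x y : (0 < sqd x y)%R = (x != y).
Proof. by rewrite lt_neqAle sqd_ge0 andbT eq_sym sqd_eq0. Qed.

Lemma riesz_kernelE alpha x y : x != y ->
  riesz_kernel alpha x y = (sqd x y `^ (- ((n%:R - alpha) / 2)))%:E.
Proof.
move=> xy; rewrite /riesz_kernel (negPf xy); congr EFin.
have -> : enorm (x - y) = (sqd x y `^ 2^-1)%R.
  rewrite powR12_sqrt ?sqd_ge0 //; congr Num.sqrt; apply: eq_bigr => i _.
  by rewrite !mxE.
by rewrite -powRrM; congr powR; field.
Qed.

Lemma riesz_kernelxx alpha x : riesz_kernel alpha x x = +oo.
Proof. by rewrite /riesz_kernel eqxx. Qed.

Lemma riesz_kernel_ge0 alpha x y : 0 <= riesz_kernel alpha x y.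
Proof. by rewrite /riesz_kernel; case: ifP => // _; rewrite lee_fin powR_ge0. Qed.

Lemma riesz_kernelC alpha x y : riesz_kernel alpha x y = riesz_kernel alpha y x.
Proof.
have [->//|xy] := eqVneq x y.
by rewrite !riesz_kernelE // 1?eq_sym // sqdC.
Qed.

(** The Gamma integral with [N = |x - y|^2]; on the diagonal both sides are +oo. *)
Lemma riesz_gaussian alpha x y : (alpha < n%:R)%R ->
  gamma_mass ((n%:R - alpha) / 2) * riesz_kernel alpha x y =
  \int[leb]_tau (gamma_fun ((n%:R - alpha) / 2) (sqd x y) tau)%:E.
Proof.
move=> an; have a0 : (0 < (n%:R - alpha) / 2)%R by rewrite divr_gt0 // subr_gt0.
have [->|xy] := eqVneq x y.
  by rewrite sqdxx integral_gamma_fun0 // riesz_kernelxx gt0_muley // gamma_mass_gt0.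
by rewrite integral_gamma_fun ?sqd_gt0 // riesz_kernelE // muleC.
Qed.

Lemma measurable_coord (i : 'I_n) : measurable_fun setT (fun x : T => x ord0 i).
Proof.
apply: (measurability _ (RGenOpens.measurableE R)).
move=> _ [_ [a [b ->] <-]]; rewrite setTI; apply: sub_sigma_algebra.
have /continuousP := @coord_continuous R 1 n ord0 i; apply.
exact: interval_open.
Qed.

Lemma measurable_sqd : measurable_fun setT (fun z : T * T => sqd z.1 z.2).
Proof.
apply: measurable_sum => i; apply: measurable_funX.
apply: measurable_funB.
  exact: (measurableT_comp (measurable_coord i) measurable_fst).
exact: (measurableT_comp (measurable_coord i) measurable_snd).
Qed.

Lemma measurable_sqd1 x : measurable_fun setT (fun y : T => sqd x y).
Proof. exact: (measurableT_comp measurable_sqd (measurable_pair1 (x : T))). Qed.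

Lemma measurable_gamma_sqd a :
  measurable_fun setT (fun w : measurableTypeR R * (T * T) =>
    (gamma_fun a (sqd w.2.1 w.2.2) w.1)%:E).
Proof.
apply/measurable_EFinP; apply: measurable_funM.
  apply: measurableT_comp; first exact: measurable_expR.
  by apply: measurable_funM.
apply: measurableT_comp; first exact: measurable_expR.
apply: measurableT_comp => //; apply: measurable_funM.
  by apply: measurableT_comp => //; exact: measurable_expR.
exact: (measurableT_comp measurable_sqd measurable_snd).
Qed.

(** Read off the Gaussian mixture by Tonelli, which treats the diagonal together with the rest. *)
Lemma measurable_riesz_kernel alpha : (alpha < n%:R)%R ->
  measurable_fun setT (fun z : T * T => riesz_kernel alpha z.1 z.2).
Proof.
move=> an; have a0 : (0 < (n%:R - alpha) / 2)%R by rewrite divr_gt0 // subr_gt0.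
have g0 := gamma_mass_gt0 ((n%:R - alpha) / 2).
have gy := gamma_mass_lty a0.
have gf : gamma_mass ((n%:R - alpha) / 2) \is a fin_num by rewrite gt0_fin_numE.
rewrite (_ : (fun z : T * T => _) = fun z => ((fine (gamma_mass ((n%:R - alpha) / 2)))^-1)%:E *
    \int[leb]_tau (gamma_fun ((n%:R - alpha) / 2) (sqd z.1 z.2) tau)%:E).
  apply: measurable_funeM.
  apply: (measurable_fun_fubini_tonelli_G _ (measurable_gamma_sqd ((n%:R - alpha) / 2))).
  by move=> w; rewrite lee_fin gamma_fun_ge0.
apply/funext => z; rewrite -riesz_gaussian // muleA -{2}(fineK gf) -EFinM.
by rewrite mulVf ?mul1e // gt_eqF // fine_gt0 // g0.
Qed.

(** Induction on the coordinates: by [gaussian_mixture] the Gaussian in one more coordinate is, up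
    to a constant, an integral over [w] of products [g w x * g w y], and each such product preserves
    positivity. *)
Lemma psd_gaussian t : (0 < t)%R ->
  psd (fun z : T * T => (expR (- t * sqd z.1 z.2))%:E).
Proof.
move=> t0; have [C C0 HC] := gaussian_mixture t0.
rewrite /sqd; elim: (index_enum _) => [|i s IH].
  rewrite (_ : (fun _ : T * T => _) = fun=> 1) //; first exact: psd_cst1.
  by apply/funext => z; rewrite big_nil mulr0 expR0.
pose K (z : T * T) := (expR (- t * \sum_(i <- s) (z.1 ord0 i - z.2 ord0 i) ^+ 2)%R)%:E.
pose g (w : measurableTypeR R) (x : T) := (expR (- (2 * t) * (x ord0 i - w) ^+ 2))%:E.
have mg : measurable_fun setT (fun w : measurableTypeR R * T => g w.1 w.2).
  apply/measurable_EFinP; apply: measurableT_comp; first exact: measurable_expR.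
  apply: measurable_funM => //; apply: measurable_funX; apply: measurable_funB => //.
  exact: (measurableT_comp (measurable_coord i) measurable_snd).
apply: (psd_scale C0).
rewrite (_ : (fun z : T * T => _) = fun z => \int[leb]_w (g w z.1 * g w z.2 * K z)); last first.
  apply/funext => z; rewrite ge0_integralZr //.
  - rewrite /g; under eq_integral do rewrite -EFinM.
    rewrite HC big_cons /K -!EFinM mulrDr expRD; congr EFin.
    by rewrite mulrA.
  - apply: emeasurable_funM.
      exact: (measurableT_comp mg (measurable_pair2 z.1)).
    exact: (measurableT_comp mg (measurable_pair2 z.2)).
  - by move=> w _; rewrite mule_ge0 ?lee_fin ?expR_ge0.
  - by rewrite lee_fin expR_ge0.
apply: (@psd_mixture _ _ _ _ _ leb (fun w => g w.1 w.2.1 * g w.1 w.2.2 * K w.2)).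
  case: IH => mK _ _.
  apply: emeasurable_funM; last exact: (measurableT_comp mK measurable_snd).
  apply: emeasurable_funM.
  - exact: (measurableT_comp mg (measurable_fun_pair measurable_fst
      (measurableT_comp measurable_fst measurable_snd))).
  - exact: (measurableT_comp mg (measurable_fun_pair measurable_fst
      (measurableT_comp measurable_snd measurable_snd))).
move=> w /=; apply: (psd_rank_one IH).
  exact: (measurableT_comp mg (measurable_pair1 w)).
by move=> x; rewrite lee_fin expR_ge0.
Qed.

End gaussian_representation.

(** * Finite measures and limits of integrals *)

Section finite_measures.
Context d (T : measurableType d) (R : realType).

(** A copy of [mu] that carries the proof of finiteness as an argument, so that a finite measure
    structure can be attached to it. *)
Definition finite_measure_of (mu : {measure set T -> \bar R})
  (_ : mu setT < +oo) : set T -> \bar R := mu.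

Section instance.
Variables (mu : {measure set T -> \bar R}) (mu_fin : mu setT < +oo).

HB.instance Definition _ := isMeasure.Build d T R (finite_measure_of mu_fin)
  (measure0 mu) (measure_ge0 mu) (@measure_semi_sigma_additive _ _ _ mu).

HB.instance Definition _ :=
  @Measure_isFinite.Build d T R (finite_measure_of mu_fin) (lty_fin_num_fun mu_fin).

End instance.

Lemma bounded_cvg_integral (mu : {finite_measure set T -> \bar R})
    (f_ : (T -> \bar R)^nat) (f : T -> \bar R) (C : R) :
  (forall n, measurable_fun setT (f_ n)) -> measurable_fun setT f ->
  (forall n x, 0 <= f_ n x <= C%:E) -> (forall x, f_ ^~ x @ \oo --> f x) ->
  \int[mu]_x f_ n x @[n --> \oo] --> \int[mu]_x f x.
Proof.
move=> mf_ mf fC ff.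
have fC' x n : setT x -> `|f_ n x| <= (EFin \o cst C) x.
  by move=> _ /=; have /andP[f0 fx] := fC n x; rewrite gee0_abs.
by have [] := @dominated_convergence _ _ _ mu setT measurableT f_ f (EFin \o cst C)
  mf_ mf (aeW _ (fun x _ => ff x)) (finite_measure_integrable_cst _ C measurableT)
  (aeW _ fC').
Qed.

(** The difference [g - f] is nonnegative with integral zero; the finite integral of [g] is what
    permits the subtraction. *)
Lemma ae_eq_le_integral (mu : {measure set T -> \bar R}) (f g : T -> R) :
  measurable_fun setT f -> measurable_fun setT g ->
  (forall x, 0 <= f x <= g x)%R ->
  \int[mu]_x (g x)%:E < +oo -> \int[mu]_x (g x)%:E <= \int[mu]_x (f x)%:E ->
  {ae mu, forall x, f x = g x}.
Proof.
move=> mf mg fg gy gf.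
have f0 x : (0 <= f x)%R by case/andP: (fg x).
have lefg x : (f x <= g x)%R by case/andP: (fg x).
have g0 x : (0 <= g x)%R by exact: le_trans (f0 x) (lefg x).
have ig : mu.-integrable setT (EFin \o g).
  apply/integrableP; split; first exact/measurable_EFinP.
  by under eq_integral do rewrite /= ger0_norm //.
have if_ : mu.-integrable setT (EFin \o f).
  apply: le_integrable ig => //; first exact/measurable_EFinP.
  by move=> x _ /=; rewrite lee_fin !ger0_norm.
have E : \int[mu]_x (f x)%:E = \int[mu]_x (g x)%:E.
  apply/eqP; rewrite eq_le gf andbT; apply: ge0_le_integral => //.
  - by move=> x _; rewrite lee_fin.
  - exact/measurable_EFinP.
  - exact/measurable_EFinP.
  - by move=> x _; rewrite lee_fin.
have mgf : measurable_fun setT (fun x => (g x - f x)%:E).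
  by apply/measurable_EFinP; exact: measurable_funB.
have := @integralB _ _ _ mu setT measurableT _ _ ig if_.
rewrite /= E subee; last by rewrite ge0_fin_numE // integral_ge0 // => x _; rewrite lee_fin.
have H := (ae_eq_integral_abs mu measurableT mgf).1.
move=> I0; have {}H : ae_eq mu setT (fun x => (g x - f x)%:E) (cst 0).
  apply: H; rewrite -[RHS]I0; apply: eq_integral => x _ /=.
  by rewrite -EFinB ger0_norm // subr_ge0.
apply: filterS H => x /(_ I) /= [] /eqP; rewrite subr_eq0 => /eqP -> //.
Qed.

End finite_measures.

(** * The Riesz energy as an integral of Gaussian energies *)

Section energy_principle.
Context (R : realType) (n : nat).
Local Notation T := (borelRn R n).
Local Notation leb := (@lebesgue_measure R).
Implicit Types (p q : {finite_measure set T -> \bar R}) (t tau a : R).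

Definition gauss_potential t q (x : T) : \bar R :=
  \int[q]_y (expR (- t * sqd x y))%:E.

Definition gauss_energy t p q : \bar R := \int[p]_x gauss_potential t q x.

(** On the diagonal, [mutual_energy alpha mu mu] and [energy alpha mu] are convertible. *)
Definition mutual_energy alpha (p q : borel_measure R n) : \bar R :=
  \int[p]_x potential alpha q x.

Lemma measurable_gauss t :
  measurable_fun setT (fun z : T * T => (expR (- t * sqd z.1 z.2))%:E).
Proof.
apply/measurable_EFinP; apply: measurableT_comp; first exact: measurable_expR.
by apply: measurable_funM => //; exact: measurable_sqd.
Qed.

Lemma gauss_potential_ge0 t q x : 0 <= gauss_potential t q x.
Proof. by apply: integral_ge0 => y _; rewrite lee_fin expR_ge0. Qed.

Lemma measurable_gauss_potential t q : measurable_fun setT (gauss_potential t q).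
Proof.
apply: (measurable_fun_fubini_tonelli_F _ (measurable_gauss t)).
by move=> z; rewrite lee_fin expR_ge0.
Qed.

Lemma gauss_potential_le t q x : (0 <= t)%R -> gauss_potential t q x <= q setT.
Proof.
move=> t0; rewrite -[leRHS]mul1e -integral_cst //; apply: ge0_le_integral => //.
- exact: (measurableT_comp (measurable_gauss t) (measurable_pair1 x)).
- by move=> y _; rewrite lee_fin -expR0 ler_expR mulNr oppr_le0 mulr_ge0 ?sqd_ge0.
Qed.

Lemma gauss_energy_ge0 t p q : 0 <= gauss_energy t p q.
Proof. by apply: integral_ge0 => x _; exact: gauss_potential_ge0. Qed.

Lemma gauss_energy_fin_num t p q : (0 <= t)%R -> gauss_energy t p q \is a fin_num.
Proof.
move=> t0; rewrite ge0_fin_numE ?gauss_energy_ge0 //.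
apply: (@le_lt_trans _ _ (q setT * p setT)).
  rewrite -integral_cst //; apply: ge0_le_integral => //.
  - by move=> x _; exact: gauss_potential_ge0.
  - exact: measurable_gauss_potential.
    - by move=> x _; exact: gauss_potential_le.
by rewrite lte_mul_pinfty // ?fin_num_measure // -ge0_fin_numE // fin_num_measure.
Qed.

Lemma gauss_energy_le t p q : (0 < t)%R ->
  2%:E * gauss_energy t p q <= gauss_energy t p p + gauss_energy t q q.
Proof.
move=> t0; have [_ _ /(_ p q (cst 1) (cst 1))] := @psd_gaussian R n t t0.
have E p' q' : weighted_pairing p' q' (cst 1) (cst 1)
    (fun z : T * T => (expR (- t * sqd z.1 z.2))%:E) = gauss_energy t p' q'.
  by apply: eq_integral => x _; apply: eq_integral => y _; rewrite /= !mul1e.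
by rewrite !E; apply.
Qed.

Lemma cvg_gauss_potential (t_ : R^nat) t q x : (forall k, 0 <= t_ k)%R ->
  (0 <= t)%R -> t_ @ \oo --> t ->
  gauss_potential (t_ k) q x @[k --> \oo] --> gauss_potential t q x.
Proof.
move=> t_0 t0 ct; apply: (@bounded_cvg_integral _ _ _ q _ _ 1%R).
- by move=> k; exact: (measurableT_comp (measurable_gauss (t_ k)) (measurable_pair1 x)).
- exact: (measurableT_comp (measurable_gauss t) (measurable_pair1 x)).
- move=> k y; rewrite !lee_fin expR_ge0 -expR0 ler_expR mulNr oppr_le0.
  by rewrite mulr_ge0 ?sqd_ge0.
move=> y; apply: cvg_EFin; first exact: nearW.
have c : continuous (fun s : R => expR (- s * sqd x y)).
  rewrite (_ : (fun s : R => _) = fun s : R => expR (s * - sqd x y)).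
    move=> s; apply: continuous_comp; last exact: continuous_expR.
    exact: mulrr_continuous.
  by apply/funext => s; rewrite mulrN mulNr.
exact: (cvg_comp _ _ ct (c t)).
Qed.

Lemma cvg_gauss_energy (t_ : R^nat) t p q : (forall k, 0 <= t_ k)%R ->
  (0 <= t)%R -> t_ @ \oo --> t ->
  gauss_energy (t_ k) p q @[k --> \oo] --> gauss_energy t p q.
Proof.
move=> t_0 t0 ct; apply: (@bounded_cvg_integral _ _ _ p _ _ (fine (q setT))).
- by move=> k; exact: measurable_gauss_potential.
- exact: measurable_gauss_potential.
- by move=> k x; rewrite gauss_potential_ge0 fineK ?fin_num_measure // gauss_potential_le.
by move=> x; exact: cvg_gauss_potential.
Qed.

Lemma potential_ge0 alpha (q : borel_measure R n) x : 0 <= potential alpha q x.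
Proof. by apply: integral_ge0 => y _; exact: riesz_kernel_ge0. Qed.

Lemma mutual_energy_ge0 alpha p q : 0 <= mutual_energy alpha p q.
Proof. by apply: integral_ge0 => x _; exact: potential_ge0. Qed.

Section representation.
Variable alpha : R.
Hypothesis alphan : (alpha < n%:R)%R.
Let a := ((n%:R - alpha) / 2)%R.

Lemma measurable_potential q : measurable_fun setT (potential alpha q : T -> \bar R).
Proof.
apply: (measurable_fun_fubini_tonelli_F _ (measurable_riesz_kernel alphan)).
by move=> z; exact: riesz_kernel_ge0.
Qed.

Lemma mutual_energyC p q : mutual_energy alpha p q = mutual_energy alpha q p.
Proof.
have := @fubini_tonelli _ _ _ _ _ p q _ (measurable_riesz_kernel alphan)
  (fun z => riesz_kernel_ge0 alpha z.1 z.2).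
rewrite /= => E; rewrite /mutual_energy /potential [LHS]E.
by apply: eq_integral => x _; apply: eq_integral => y _; rewrite riesz_kernelC.
Qed.

Let G (w : measurableTypeR R * (T * T)) := (gamma_fun a (sqd w.2.1 w.2.2) w.1)%:E.

Let G0 w : 0 <= G w. Proof. by rewrite lee_fin gamma_fun_ge0. Qed.

Let mG : measurable_fun setT G. Proof. exact: measurable_gamma_sqd. Qed.

Let Gi q (w : measurableTypeR R * T) := \int[q]_y G (w.1, (w.2, y)).

Let GiE q w : Gi q w = (expR (a * w.1))%:E * gauss_potential (expR w.1) q w.2.
Proof.
rewrite /gauss_potential -ge0_integralZl; last by rewrite lee_fin expR_ge0.
- by apply: eq_integral => y _; rewrite /G /gamma_fun -EFinM mulNr.
- exact: measurableT.
- exact: (measurableT_comp (measurable_gauss _) (measurable_pair1 w.2)).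
- by move=> y _; rewrite lee_fin expR_ge0.
Qed.

Let Gi0 q w : 0 <= Gi q w. Proof. by apply: integral_ge0 => y _; exact: G0. Qed.

Let mGi q : measurable_fun setT (Gi q).
Proof.
apply: (measurable_fun_fubini_tonelli_F
  (fun w : (measurableTypeR R * T) * T => G (w.1.1, (w.1.2, w.2)))).
  apply: (measurableT_comp mG).
  exact: (measurable_fun_pair (measurableT_comp measurable_fst measurable_fst)
    (measurable_fun_pair (measurableT_comp measurable_snd measurable_fst) measurable_snd)).
by move=> w; exact: G0.
Qed.

Let Gii p q tau : \int[p]_x Gi q (tau, x) =
  (expR (a * tau))%:E * gauss_energy (expR tau) p q.
Proof.
rewrite /gauss_energy -ge0_integralZl; last by rewrite lee_fin expR_ge0.
- by apply: eq_integral => x _; rewrite GiE.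
- exact: measurableT.
- exact: measurable_gauss_potential.
- by move=> x _; exact: gauss_potential_ge0.
Qed.

Lemma measurable_weighted_gauss_energy p q : measurable_fun setT
  (fun tau : measurableTypeR R => (expR (a * tau))%:E * gauss_energy (expR tau) p q).
Proof.
have := measurable_fun_fubini_tonelli_F _ (mGi q) (Gi0 q).
move=> /(_ p); apply: eq_measurable_fun => tau _; exact: Gii.
Qed.

(** Tonelli twice: the parameter [tau] is exchanged with [x], then with [y], and the double integral
    left inside is a Gaussian energy. *)
Lemma mutual_energy_gauss p q : gamma_mass a * mutual_energy alpha p q =
  \int[leb]_tau ((expR (a * tau))%:E * gauss_energy (expR tau) p q).
Proof.
have g0 := gamma_mass_gt0 a.
have F := @fubini_tonelli _ _ _ _ _ leb p _ (mGi q) (Gi0 q).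
transitivity (\int[leb]_tau \int[p]_x Gi q (tau, x)); last first.
  by apply: eq_integral => tau _; exact: Gii.
rewrite [RHS]F /mutual_energy -ge0_integralZl; last exact: ltW.
- apply: eq_integral => x _.
  have mGx : measurable_fun setT (fun w : measurableTypeR R * T => G (w.1, (x, w.2))).
    apply: (measurableT_comp mG).
    exact: (measurable_fun_pair measurable_fst
      (measurable_fun_pair (measurable_cst x) measurable_snd)).
  have F2 := @fubini_tonelli _ _ _ _ _ leb q _ mGx (fun=> G0 _).
  rewrite [RHS]F2 /potential -ge0_integralZl; last exact: ltW.
  + by apply: eq_integral => y _; rewrite riesz_gaussian.
  + exact: measurableT.
  + exact: (measurableT_comp (measurable_riesz_kernel alphan) (measurable_pair1 x)).
  + by move=> y _; exact: riesz_kernel_ge0.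
- exact: measurableT.
- exact: measurable_potential.
- by move=> x _; exact: potential_ge0.
Qed.

End representation.

End energy_principle.

(** * The energy inequality and its equality case *)

Section strictness.
Context (R : realType) (n : nat).
Local Notation T := (borelRn R n).
Local Notation leb := (@lebesgue_measure R).
Implicit Types (p q : {finite_measure set T -> \bar R}) (t tau : R).

Section energy_inequality.
Variable alpha : R.
Hypothesis alphan : (alpha < n%:R)%R.
Let a := ((n%:R - alpha) / 2)%R.

Let a0 : (0 < a)%R. Proof. by rewrite divr_gt0 // subr_gt0. Qed.

(** Real valued: Gaussian energies of finite measures are finite even when the Riesz energy is not,
    so the inequality can be studied at each [tau] with ordinary subtraction. *)
Let w p q tau := (expR (a * tau) * fine (gauss_energy (expR tau) p q))%R.

Let wE p q tau :
  (w p q tau)%:E = (expR (a * tau))%:E * gauss_energy (expR tau) p q.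
Proof. by rewrite /w EFinM fineK // gauss_energy_fin_num // expR_ge0. Qed.

Let w0 p q tau : (0 <= w p q tau)%R.
Proof. by rewrite mulr_ge0 ?expR_ge0 // fine_ge0 // gauss_energy_ge0. Qed.

Let mw p q : measurable_fun setT (w p q : measurableTypeR R -> R).
Proof.
apply/measurable_EFinP; rewrite (_ : EFin \o _ = fun tau : measurableTypeR R =>
  (expR (a * tau))%:E * gauss_energy (expR tau) p q).
  exact: measurable_weighted_gauss_energy.
by apply/funext => tau; rewrite /= wE.
Qed.

Let mwE p q : measurable_fun setT (fun tau : measurableTypeR R => (w p q tau)%:E).
Proof. by apply/measurable_EFinP; exact: mw. Qed.

Let w_energy p q :
  gamma_mass a * mutual_energy alpha p q = \int[leb]_tau (w p q tau)%:E.
Proof. by rewrite mutual_energy_gauss //; apply: eq_integral => tau _; rewrite wE. Qed.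

Let w_le p q tau : (2 * w p q tau <= w p p tau + w q q tau)%R.
Proof.
rewrite -lee_fin EFinM [leRHS]EFinD !wE muleCA -ge0_muleDr ?gauss_energy_ge0 //.
by rewrite lee_pmul2l ?lte_fin ?expR_gt0 // gauss_energy_le // expR_gt0.
Qed.

Let int2 p q : \int[leb]_tau (2 * w p q tau)%:E =
  gamma_mass a * (2%:E * mutual_energy alpha p q).
Proof.
rewrite muleCA w_energy -ge0_integralZl //.
by move=> tau _; rewrite lee_fin w0.
Qed.

Let intD p q : \int[leb]_tau (w p p tau + w q q tau)%:E =
  gamma_mass a * (mutual_energy alpha p p + mutual_energy alpha q q).
Proof.
rewrite ge0_muleDr ?mutual_energy_ge0 // !w_energy -ge0_integralD //.
- by move=> tau _; rewrite lee_fin w0.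
- by move=> tau _; rewrite lee_fin w0.
Qed.

Lemma mutual_energy_le p q : 2%:E * mutual_energy alpha p q <=
  mutual_energy alpha p p + mutual_energy alpha q q.
Proof.
have g0 := gamma_mass_gt0 a; have gy := gamma_mass_lty a0.
have gf : gamma_mass a \is a fin_num by rewrite gt0_fin_numE.
rewrite -(@lee_pmul2l _ (gamma_mass a)) // -int2 -intD.
apply: ge0_le_integral => //.
- by move=> tau _; rewrite lee_fin mulr_ge0.
- by apply/measurable_EFinP; apply: measurable_funM => //; exact: mw.
- by apply/measurable_EFinP; apply: measurable_funD; exact: mw.
- by move=> tau _; rewrite lee_fin w_le.
Qed.

(* The Gaussian energies agree for almost every parameter because the weighted
   difference integrates to zero, hence for every parameter by continuity. *)
Lemma gauss_energy_eq p q t : mutual_energy alpha p p < +oo ->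
  mutual_energy alpha q q < +oo ->
  mutual_energy alpha p p + mutual_energy alpha q q <=
    2%:E * mutual_energy alpha p q ->
  (0 < t)%R ->
  2%:E * gauss_energy t p q = gauss_energy t p p + gauss_energy t q q.
Proof.
move=> py qy pq t0.
have g0 := gamma_mass_gt0 a; have gy := gamma_mass_lty a0.
have gf : gamma_mass a \is a fin_num by rewrite gt0_fin_numE.
have H : {ae leb, forall tau, (2 * w p q tau = w p p tau + w q q tau)%R}.
  apply: ae_eq_le_integral.
  - by apply: measurable_funM => //; exact: mw.
  - by apply: measurable_funD; exact: mw.
  - by move=> tau; rewrite mulr_ge0 //= w_le.
  - by rewrite intD lte_mul_pinfty //; [exact: ltW|exact: lte_add_pinfty].
  - by rewrite int2 intD lee_pmul2l.
case: H => A [mA A0 HA].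
pose tau0 := ln t.
(* Every interval to the right of [ln t] has positive length, so it is not contained in the null set
   [A]. *)
have good k : exists tau, ~ A tau /\ (tau0 < tau < tau0 + k.+1%:R^-1)%R.
  apply: contrapT => /forallNP nG.
  have : leb `]tau0, (tau0 + k.+1%:R^-1)%R[%classic <= leb A.
    apply: le_measure; rewrite ?inE //.
    move=> tau /=; rewrite in_itv /= => tauk.
    by apply: contrapT => nA; apply: (nG tau).
  rewrite A0 lebesgue_measure_itv /= lte_fin ltrDl invr_gt0 ltr0n /=.
  by rewrite -EFinD lee_fin addrAC subrr add0r leNgt invr_gt0 ltr0n.
have [tau_ Htau] := choice good.
have ctau : tau_ @ \oo --> tau0.
  apply: (@squeeze_cvgr _ _ _ _ (fun=> tau0) (fun k => tau0 + k.+1%:R^-1)%R).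
  - by apply: nearW => k; have [_ /andP[/ltW -> /ltW ->]] := Htau k.
  - exact: cvg_cst.
  - rewrite -[X in _ --> X]addr0; apply: cvgD; first exact: cvg_cst.
    exact: cvg_harmonic.
pose t_ k := expR (tau_ k).
have ct : t_ @ \oo --> t.
  rewrite -[X in _ --> X]lnK ?posrE //.
  exact: (cvg_comp _ _ ctau (@continuous_expR R _)).
have t_0 k : (0 <= t_ k)%R by exact: expR_ge0.
have E k : fine (2%:E * gauss_energy (t_ k) p q) =
    fine (gauss_energy (t_ k) p p + gauss_energy (t_ k) q q).
  rewrite [LHS]fineM ?gauss_energy_fin_num // [RHS]fineD ?gauss_energy_fin_num //=.
  have e0 : expR (a * tau_ k) != 0%R by rewrite gt_eqF ?expR_gt0.
  apply: (mulfI e0); rewrite mulrCA [RHS]mulrDr.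
  by apply: contrapT => Hn; apply: (Htau k).1; apply: HA.
have J p' q' := @cvg_gauss_energy R n t_ t p' q' t_0 (ltW t0) ct.
have F p' q' : gauss_energy t p' q' \is a fin_num by rewrite gauss_energy_fin_num // ltW.
have L : fine (2%:E * gauss_energy (t_ k) p q) @[k --> \oo] -->
    (2 * fine (gauss_energy t p q))%R.
  rewrite (_ : (fun k => _) = fun k => (2 * fine (gauss_energy (t_ k) p q))%R).
    by apply: cvgMl_tmp; apply: fine_cvg; rewrite fineK //; exact: J.
  by apply/funext => k; rewrite [LHS]fineM ?gauss_energy_fin_num.
have L' : fine (2%:E * gauss_energy (t_ k) p q) @[k --> \oo] -->
    (fine (gauss_energy t p p) + fine (gauss_energy t q q))%R.
  rewrite (_ : (fun k => _) = fun k => (fine (gauss_energy (t_ k) p p) +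
      fine (gauss_energy (t_ k) q q))%R).
    by apply: cvgD; apply: fine_cvg; rewrite fineK //; exact: J.
  by apply/funext => k; rewrite E [LHS]fineD ?gauss_energy_fin_num.
have H2 : (2 * fine (gauss_energy t p q) =
    fine (gauss_energy t p p) + fine (gauss_energy t q q))%R.
  exact: (cvg_unique (@Rhausdorff R) L L').
by rewrite -(fineK (F p q)) -EFinM H2 [LHS]EFinD !fineK.
Qed.

End energy_inequality.

(* Positivity applied to p + s delta_x and q, as s tends to 0. *)
Lemma gauss_potential_le_of_energy_eq t p q x : (0 < t)%R ->
  2%:E * gauss_energy t p q = gauss_energy t p p + gauss_energy t q q ->
  gauss_potential t q x <= gauss_potential t p x.
Proof.
move=> t0 E.
have t0' := ltW t0.
have Pf q' y : gauss_potential t q' y \is a fin_num.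
  rewrite ge0_fin_numE ?gauss_potential_ge0 //.
  rewrite (le_lt_trans (gauss_potential_le _ _ t0')) //.
  by rewrite -ge0_fin_numE // fin_num_measure.
have Jf p' q' : gauss_energy t p' q' \is a fin_num by exact: gauss_energy_fin_num.
apply/lee_addgt0Pr => e e0.
(* Let a and b be the potentials of [p] and [q] at [x]. Given the equality [E], the inequality for
   [p + s delta_x] and [q] reduces to [2 s b <= 2 s a + s^2], where [s^2] is the energy of the atom,
   the Gaussian being 1 at distance 0. So [s = 2 e] yields [b <= a + e]. *)
pose s := (2 * e)%R; have s0 : (0 <= s)%R by rewrite mulr_ge0 // ltW.
pose m : {measure set T -> \bar R} := measure_add p (mscale (NngNum s0) (\d_ (x : T))).
have mfin : m setT < +oo.
  have -> : m setT = p setT + mscale (NngNum s0) (\d_ (x : T)) setT :=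
    measure_addE _ _ _.
  rewrite /mscale /= diracT mule1 lte_add_pinfty ?ltry //.
  by rewrite -ge0_fin_numE // fin_num_measure.
have intm (f : T -> \bar R) : measurable_fun setT f -> (forall y, 0 <= f y) ->
    \int[m]_y f y = \int[p]_y f y + s%:E * f x.
  move=> mf f0; rewrite /m ge0_integral_measure_add // ge0_integral_mscale //=.
  by rewrite integral_dirac // diracT mul1e.
pose r : {finite_measure set T -> \bar R} := finite_measure_of mfin.
have Pr y : gauss_potential t r y = gauss_potential t p y + s%:E * (expR (- t * sqd y x))%:E.
  rewrite -(intm (fun z : T => (expR (- t * sqd y z))%:E)) //.
  exact: (measurableT_comp (measurable_gauss t) (measurable_pair1 (y : T))).
have Jr q' : gauss_energy t r q' = gauss_energy t p q' + s%:E * gauss_potential t q' x.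
  rewrite -(intm (gauss_potential t q' : T -> \bar R)) //.
  - exact: measurable_gauss_potential.
  - by move=> y; exact: gauss_potential_ge0.
have Jpr : gauss_energy t p r = gauss_energy t p p + s%:E * gauss_potential t p x.
  rewrite /gauss_energy; under eq_integral do rewrite Pr.
  have mg := measurableT_comp (measurable_gauss t) (measurable_pair2 (x : T)).
  rewrite ge0_integralD; [|exact: measurableT|
    by move=> y _; exact: gauss_potential_ge0|exact: measurable_gauss_potential|
    by move=> y _; rewrite mule_ge0 ?lee_fin ?expR_ge0|exact: measurable_funeM].
  rewrite ge0_integralZl; [|exact: measurableT|exact: mg|
    by move=> y _; rewrite lee_fin expR_ge0|by rewrite lee_fin].
  by congr (_ + _ * _); apply: eq_integral => y _; rewrite sqdC.
have := gauss_energy_le r q t0.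
rewrite !Jr Jpr Pr sqdxx mulr0 expR0.
move: E (Pf p x) (Pf q x) (Jf p p) (Jf p q) (Jf q q).
case: (gauss_energy t p p) => // pp; case: (gauss_energy t p q) => // pq.
case: (gauss_energy t q q) => // qq; case: (gauss_potential t p x) => // a.
case: (gauss_potential t q x) => // b.
rewrite -!(EFinM, EFinD) => -[E] _ _ _ _ _; rewrite !lee_fin -/s /s.
nra.
Qed.

End strictness.

(** * Gaussian potentials determine a measure *)

Lemma bernoulli_inequality (R : realType) (u : R) N :
  (0 <= u <= 1 -> 1 - N%:R * u <= (1 - u) ^+ N)%R.
Proof.
move=> /andP[u0 u1]; elim: N => [|N IH]; first by rewrite mul0r subr0 expr0.
rewrite exprS; apply: (@le_trans _ _ ((1 - u) * (1 - N%:R * u))%R).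
  by rewrite -natr1; have : (0 <= N%:R :> R)%R by []; nra.
by apply: ler_wpM2l => //; rewrite subr_ge0.
Qed.

(* Thresholding a number z in [0, 1] at c = expR (- r): the sequence
   (1 - z ^ k) ^ N_k, with N_k of order k c ^ (- k), tends to 1 or 0 according
   to z < c or z >= c. *)
Lemma threshold_cvg (R : realType) (r : R) : (0 <= r)%R ->
  exists N : nat -> nat, forall s : R, (0 <= s)%R ->
    ((1 - expR (- k.+1%:R * s)) ^+ N k)%R @[k --> \oo] --> ((r < s)%R%:R : R).
Proof.
move=> r0; pose N k : nat := (Num.truncn (k.+1%:R * expR (k.+1%:R * r) : R)).+1.
have N1 k : (k.+1%:R * expR (k.+1%:R * r) <= (N k)%:R :> R)%R by rewrite ltW // truncnS_gt.
have N2 k : ((N k)%:R <= k.+1%:R * expR (k.+1%:R * r) + 1 :> R)%R.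
  by rewrite -[leLHS]natr1 lerD2r truncn_le mulr_ge0 ?expR_ge0.
exists N => s s0.
have u0 k : (0 <= expR (- k.+1%:R * s) :> R)%R by exact: expR_ge0.
have u1 k : (expR (- k.+1%:R * s) <= 1 :> R)%R.
  by rewrite -expR0 ler_expR mulNr oppr_le0 mulr_ge0.
have [rs|sr] := ltP r s.
  (* Write K for [k.+1]. Bernoulli bounds the defect from 1 by [N_k e^(- K s) <= K e^(- 2 K del) +
     e^(- K s)], and [K e^(- K del) <= 1/del] makes this at most [(1/del + 1) z^K]. *)
  pose del := ((s - r) / 2)%R; have del0 : (0 < del)%R by rewrite divr_gt0 // subr_gt0.
  pose z := expR (- del).
  have z1 : (`|z| < 1)%R by rewrite ger0_norm ?expR_ge0 // -expR0 ltr_expR oppr_lt0.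
  have delV0 : (0 < del^-1)%R by rewrite invr_gt0.
  apply: (@squeeze_cvgr _ _ _ _ (fun k => 1 - (del^-1 + 1) * z ^+ k.+1)%R (fun=> 1%R)).
  - apply: nearW => k; apply/andP; split; last first.
      by rewrite exprn_ile1 ?subr_ge0 // gerBl.
    apply: le_trans (bernoulli_inequality (N k) _); last by rewrite u0 u1.
    rewrite lerD2l lerN2.
    apply: (le_trans (ler_wpM2r (u0 k) (N2 k))).
    have zk : (z ^+ k.+1 = expR (- k.+1%:R * del))%R.
      by rewrite /z -expRM_natl mulrN mulNr.
    have Kz : (k.+1%:R * z ^+ k.+1 <= del^-1)%R.
      rewrite zk mulNr expRN ler_pdivrMr ?expR_gt0 // -ler_pdivrMl ?invr_gt0 // invrK.
      rewrite mulrC (le_trans _ (expR_ge1Dx _)) // lerDr //.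
    rewrite [leLHS]mulrDl mul1r [leRHS]mulrDl mul1r; apply: lerD; last first.
      rewrite zk ler_expR !mulNr lerN2 ler_wpM2l // /del; lra.
    rewrite -mulrA -expRD.
    have -> : (k.+1%:R * r + - k.+1%:R * s = - k.+1%:R * del + - k.+1%:R * del)%R.
      by rewrite /del; field.
    by rewrite expRD -zk mulrA ler_wpM2r // exprn_ge0 // expR_ge0.
  - rewrite -[X in _ --> X]subr0 -[X in (_ - X)%R](mulr0 (del^-1 + 1)%R).
    apply: cvgB; first exact: cvg_cst.
    by apply: cvgMl_tmp; rewrite (cvg_shiftS (fun k => z ^+ k)%R); exact: cvg_expr.
  - exact: cvg_cst.
(* Here [(1 - u)^N <= e^(- N u)], and [N_k e^(- K s) >= K e^(K (r - s)) >= K] for [K = k.+1]. The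
   case [s = r] falls on this side, which is why closed balls come out in the end. *)
apply: (@squeeze_cvgr _ _ _ _ (fun=> 0%R) (fun k => (expR (- 1)) ^+ k.+1)%R).
- apply: nearW => k; rewrite exprn_ge0 ?subr_ge0 //=.
  rewrite -expRM_natl.
  apply: (@le_trans _ _ (expR (- expR (- k.+1%:R * s)) ^+ N k)%R).
    by rewrite lerXn2r ?nnegrE ?subr_ge0 ?expR_ge0 // expR_ge1Dx.
  rewrite -expRM_natl ler_expR mulrN mulrN lerN2 mulr1.
  rewrite -ler_pdivrMr ?expR_gt0 // (le_trans _ (N1 k)) //.
  rewrite -expRN mulNr opprK ler_wpM2l // ler_expR ler_wpM2l //.
- exact: cvg_cst.
- rewrite (cvg_shiftS (fun k => expR (-1) ^+ k)%R); apply: cvg_expr.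
  by rewrite ger0_norm ?expR_ge0 // -expR0 ltr_expR oppr_lt0.
Qed.

Section gaussian_determination.
Context (R : realType) (n : nat).
Local Notation T := (borelRn R n).
Variables p q : {finite_measure set T -> \bar R}.
Implicit Types (h : T -> R) (t : R) (x y : 'rV[R]_n).

(** Completing the square: [s |x - w|^2 + t |y - w|^2 = (s + t) |z - w|^2 + s t/(s + t) |x - y|^2],
    with [z] the weighted mean of the two centres. *)
Lemma gaussian_mul (s t : R) x y : (0 < s)%R -> (0 < t)%R ->
  exists (c : R) (z : 'rV[R]_n), (0 <= c)%R /\ forall w,
    (expR (- s * sqd x w) * expR (- t * sqd y w) =
     c * expR (- (s + t) * sqd z w))%R.
Proof.
move=> s0 t0; have st0 : (s + t != 0)%R by rewrite gt_eqF // addr_gt0.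
exists (expR (- (s * t / (s + t)) * sqd x y)).
exists (\row_i ((s * x ord0 i + t * y ord0 i) / (s + t)))%R.
split; first exact: expR_ge0.
move=> w; rewrite -!expRD; congr expR; rewrite /sqd !mulr_sumr -!big_split /=.
by apply: eq_bigr => i _; rewrite mxE; field.
Qed.

(* The functions that p and q integrate alike against every Gaussian; the
   Gaussian factor is dropped at the end by letting its parameter tend to 0. *)
Definition integrated_alike h :=
  [/\ measurable_fun setT h, (forall y, 0 <= h y <= 1)%R &
  forall t x, (0 < t)%R ->
    \int[p]_y (h y * expR (- t * sqd x y))%:E =
    \int[q]_y (h y * expR (- t * sqd x y))%:E].

Lemma measurable_gauss1 t x : measurable_fun setT (fun y : T => expR (- t * sqd x y)).
Proof.
apply: measurableT_comp; first exact: measurable_expR.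
by apply: measurable_funM => //; exact: measurable_sqd1.
Qed.

Lemma gauss_le1 t x y : (0 <= t)%R -> (expR (- t * sqd x y) <= 1)%R.
Proof. by move=> t0; rewrite -expR0 ler_expR mulNr oppr_le0 mulr_ge0 ?sqd_ge0. Qed.

Lemma measurable_mul_gauss h t x : measurable_fun setT h ->
  measurable_fun setT (fun y : T => (h y * expR (- t * sqd x y))%:E).
Proof.
move=> mh; apply/measurable_EFinP; apply: measurable_funM => //.
exact: measurable_gauss1.
Qed.

Lemma integral_bounded_fin_num (m : {finite_measure set T -> \bar R}) h :
  measurable_fun setT h -> (forall y, 0 <= h y <= 1)%R ->
  \int[m]_y (h y)%:E \is a fin_num.
Proof.
move=> mh h01; rewrite ge0_fin_numE; last first.
  by apply: integral_ge0 => y _; rewrite lee_fin; case/andP: (h01 y).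
apply: (@le_lt_trans _ _ (m setT)); last by rewrite -ge0_fin_numE // fin_num_measure.
rewrite -[leRHS]mul1e -integral_cst //; apply: ge0_le_integral.
- exact: measurableT.
- by move=> y _; rewrite lee_fin; case/andP: (h01 y).
- exact/measurable_EFinP.
- exact: measurable_cst.
- by move=> y _; rewrite lee_fin; case/andP: (h01 y).
Qed.

Lemma integrated_alike_sub h h' : integrated_alike h -> integrated_alike h' ->
  (forall y, h' y <= h y)%R -> integrated_alike (fun y => h y - h' y)%R.
Proof.
move=> [mh h01 hE] [mh' h'01 h'E] le; split.
- exact: measurable_funB.
- move=> y; have /andP[_ h1] := h01 y; have /andP[h'0 _] := h'01 y.
  by rewrite subr_ge0 le /= (le_trans _ h1) // gerBl.
move=> t x t0.
have E (m : {finite_measure set T -> \bar R}) :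
    \int[m]_y ((h y - h' y) * expR (- t * sqd x y))%:E =
    \int[m]_y (h y * expR (- t * sqd x y))%:E -
    \int[m]_y (h' y * expR (- t * sqd x y))%:E.
  have ff : \int[m]_y (h' y * expR (- t * sqd x y))%:E \is a fin_num.
    apply: integral_bounded_fin_num.
      by apply: measurable_funM => //; exact: measurable_gauss1.
    move=> y; have /andP[h'0 h'1] := h'01 y.
    by rewrite mulr_ge0 ?expR_ge0 // mulr_ile1 ?expR_ge0 // gauss_le1 // ltW.
  rewrite -[LHS](addeK _ ff); congr (_ - _).
  rewrite -ge0_integralD.
  - by apply: eq_integral => y _; rewrite -EFinD -mulrDl subrK.
  - exact: measurableT.
  - by move=> y _; rewrite lee_fin mulr_ge0 ?expR_ge0 // subr_ge0.
  - by apply: measurable_mul_gauss; exact: measurable_funB.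
  - by move=> y _; rewrite lee_fin mulr_ge0 ?expR_ge0 //; case/andP: (h'01 y).
  - exact: measurable_mul_gauss.
by rewrite !E hE // h'E.
Qed.

(** A product of two Gaussians is a constant times a Gaussian, so the new factor merges with the
    test Gaussian. This is why [integrated_alike] tests against all Gaussians and not only against
    1. *)
Lemma integrated_alike_mul h s x : integrated_alike h -> (0 < s)%R ->
  integrated_alike (fun y => h y * expR (- s * sqd x y))%R.
Proof.
move=> [mh h01 hE] s0; split.
- by apply: measurable_funM => //; exact: measurable_gauss1.
- move=> y; have /andP[h0 h1] := h01 y.
  by rewrite mulr_ge0 ?expR_ge0 // mulr_ile1 ?expR_ge0 // gauss_le1 // ltW.
move=> t z t0; have [c [w [c0 cE]]] := gaussian_mul x z s0 t0.
have E (m : {finite_measure set T -> \bar R}) :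
    \int[m]_y (h y * expR (- s * sqd x y) * expR (- t * sqd z y))%:E =
    c%:E * \int[m]_y (h y * expR (- (s + t) * sqd w y))%:E.
  rewrite -ge0_integralZl; last by rewrite lee_fin.
  - by apply: eq_integral => y _; rewrite -mulrA cE mulrCA EFinM.
  - exact: measurableT.
  - exact: measurable_mul_gauss.
  - by move=> y _; rewrite lee_fin mulr_ge0 ?expR_ge0 //; case/andP: (h01 y).
by rewrite !E hE // addr_gt0.
Qed.

(** [(1 - g)^(N+1) = (1 - g)^N - (1 - g)^N g], a difference of two functions of the class. *)
Lemma integrated_alike_onem_exp h s x N : integrated_alike h -> (0 < s)%R ->
  integrated_alike (fun y => h y * (1 - expR (- s * sqd x y)) ^+ N)%R.
Proof.
move=> hh s0; elim: N => [|N IH].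
  by rewrite (_ : (fun y => _) = h) //; apply/funext => y; rewrite mulr1.
rewrite (_ : (fun y => _) = fun y =>
  (h y * (1 - expR (- s * sqd x y)) ^+ N -
   h y * (1 - expR (- s * sqd x y)) ^+ N * expR (- s * sqd x y))%R); last first.
  by apply/funext => y; rewrite exprSr mulrA mulrBr mulr1.
apply: integrated_alike_sub => //; first exact: integrated_alike_mul.
move=> y; rewrite ler_piMr //; last exact: gauss_le1 (ltW s0).
by have [_ /(_ y) /andP[]] := IH.
Qed.

Lemma integrated_alike_cvg (h_ : (T -> R)^nat) h :
  (forall k, integrated_alike (h_ k)) -> (forall y, h_ ^~ y @ \oo --> h y) ->
  integrated_alike h.
Proof.
move=> H c.
have mh : measurable_fun setT h.
  apply: (@measurable_fun_cvg _ _ _ _ h_) => //.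
  by move=> k; case: (H k).
have h01 y : (0 <= h y <= 1)%R.
  apply/andP; split.
    apply: (cvgr_to_ge (c y)); apply: nearW => k.
    by have [_ /(_ y) /andP[]] := H k.
  apply: (cvgr_to_le (c y)); apply: nearW => k.
  by have [_ /(_ y) /andP[]] := H k.
split => // t x t0.
have L (m : {finite_measure set T -> \bar R}) :
    \int[m]_y (h_ k y * expR (- t * sqd x y))%:E @[k --> \oo] -->
    \int[m]_y (h y * expR (- t * sqd x y))%:E.
  apply: (@bounded_cvg_integral _ _ _ m _ _ 1%R).
  - by move=> k; apply: measurable_mul_gauss; case: (H k).
  - exact: measurable_mul_gauss.
  - move=> k y; have [_ /(_ y) /andP[h0 h1] _] := H k; rewrite !lee_fin.
    by rewrite mulr_ge0 ?expR_ge0 // mulr_ile1 ?expR_ge0 // gauss_le1 // ltW.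
  by move=> y; apply: cvg_EFin; [exact: nearW|exact: cvgMr_tmp].
have L2 := L q.
rewrite (_ : (fun k => _) = fun k => \int[p]_y (h_ k y * expR (- t * sqd x y))%:E) in L2;
  last by apply/funext => k; have [_ _ ->] := H k.
exact: (cvg_unique (@ereal_hausdorff R) (L p) L2).
Qed.

(** [threshold_cvg] at level [r^2] produces the indicator of the exterior of the ball, and
    subtracting it leaves the closed ball. *)
Lemma integrated_alike_ball h x r : integrated_alike h ->
  integrated_alike (fun y => h y * (sqd x y <= r ^+ 2)%R%:R)%R.
Proof.
move=> hh; have [N HN] := threshold_cvg (sqr_ge0 r).
have ho : integrated_alike (fun y => h y * (r ^+ 2 < sqd x y)%R%:R)%R.
  apply: (@integrated_alike_cvg (fun k y =>
    h y * (1 - expR (- k.+1%:R * sqd x y)) ^+ N k)%R).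
    by move=> k; exact: integrated_alike_onem_exp.
  by move=> y; apply: cvgMl_tmp; apply: HN; exact: sqd_ge0.
rewrite (_ : (fun y => _) = fun y => (h y - h y * (r ^+ 2 < sqd x y)%R%:R)%R).
  apply: integrated_alike_sub => // y; rewrite ler_piMr ?lern1 ?leq_b1 //.
  by have [_ /(_ y) /andP[]] := hh.
by apply/funext => y; rewrite ltNge; case: (_ <= _)%R; rewrite /= ?mulr1 ?mulr0 ?subr0 ?subrr.
Qed.

Lemma integrated_alike_integral h : integrated_alike h ->
  \int[p]_y (h y)%:E = \int[q]_y (h y)%:E.
Proof.
move=> [mh h01 hE].
have L (m : {finite_measure set T -> \bar R}) :
    \int[m]_y (h y * expR (- k.+1%:R^-1 * sqd 0%R y))%:E @[k --> \oo] -->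
    \int[m]_y (h y)%:E.
  apply: (@bounded_cvg_integral _ _ _ m _ _ 1%R).
  - by move=> k; exact: measurable_mul_gauss.
  - exact/measurable_EFinP.
  - move=> k y; have /andP[h0 h1] := h01 y; rewrite !lee_fin.
    by rewrite mulr_ge0 ?expR_ge0 // mulr_ile1 ?expR_ge0 // gauss_le1.
  move=> y; apply: cvg_EFin; first exact: nearW.
  rewrite -[X in _ --> X]mulr1; apply: cvgMl_tmp.
  have c0 : (- k.+1%:R^-1 * sqd 0%R y)%R @[k --> \oo] --> (0%R : R).
    rewrite (_ : (0%R : R) = (- 0 * sqd 0%R y)%R); last by rewrite oppr0 mul0r.
    by apply: cvgMr_tmp; apply: cvgN; exact: cvg_harmonic.
  by rewrite -[X in _ --> X]expR0; exact: (cvg_comp _ _ c0 (@continuous_expR R _)).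
have L2 := L q.
rewrite (_ : (fun k => _) = fun k => \int[p]_y (h y * expR (- k.+1%:R^-1 * sqd 0%R y))%:E) in L2.
  exact: (cvg_unique (@ereal_hausdorff R) (L p) L2).
by apply/funext => k; rewrite hE.
Qed.

(** Finite intersections of closed balls. Indexing by lists makes them a pi-system at once:
    intersection is concatenation, and the empty list gives the whole space. *)
Definition balls (s : seq ('rV[R]_n * R)) : set T :=
  [set y | all (fun xr => (sqd xr.1 y <= xr.2 ^+ 2)%R) s].

Lemma measure_balls s :
  (forall t x, (0 < t)%R -> gauss_potential t p x = gauss_potential t q x) ->
  p (balls s) = q (balls s).
Proof.
move=> H; have : integrated_alike (fun y => (\1_(balls s) y : R)).
  elim: s => [|[x r] s IH].
    rewrite (_ : (fun y => _) = cst 1%R); last first.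
      by apply/funext => y; rewrite indicE mem_set.
    split => //; first by move=> y; rewrite ler01 lexx.
    move=> t x t0; have := H t x t0; rewrite /gauss_potential.
    have E (m : {finite_measure set T -> \bar R}) :
        \int[m]_y (cst 1 y * expR (- t * sqd x y))%:E = \int[m]_y (expR (- t * sqd x y))%:E.
      by apply: eq_integral => y _; rewrite /cst mul1r.
    by rewrite !E.
  have := integrated_alike_ball x r IH; congr integrated_alike.
  have bE s' y : (y \in balls s') = all (fun xr => (sqd xr.1 y <= xr.2 ^+ 2)%R) s'.
    by apply/idP/idP => [/set_mem|/mem_set].
  by apply/funext => y; rewrite !indicE -natrM mulnb !bE /= andbC.
move=> hs; have := integrated_alike_integral hs.
have mb : measurable (balls s).
  case: hs => mh _ _.
  rewrite (_ : balls s = (fun y => (\1_(balls s) y : R)) @^-1` [set 1%R]).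
    by rewrite -[X in measurable X]setTI; apply: mh.
  apply/seteqP; split => y /=; rewrite indicE.
    by move=> yb; rewrite mem_set.
  by case: (boolP (_ \in _)) => [/set_mem //|_ /eqP]; rewrite eq_sym oner_eq0.
by rewrite !integral_indic // !setIT.
Qed.

End gaussian_determination.

(** * Borel sets, rational balls and supports *)

Section borel_sets.
Context (R : realType) (n : nat).
Local Notation T := (borelRn R n).
Implicit Types (x y : 'rV[R]_n) (U F : set 'rV[R]_n).

Lemma measurable_open U : open U -> measurable (U : set T).
Proof. by move=> oU; exact: sub_sigma_algebra. Qed.

Lemma measurable_closed F : closed F -> measurable (F : set T).
Proof.
move=> cF; rewrite -[F]setCK; apply: measurableC.
by apply: measurable_open; exact: closed_openC.
Qed.

Lemma measurable_balls (s : seq ('rV[R]_n * R)) : measurable (balls s).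
Proof.
elim: s => [|[x r] s IH].
  by rewrite (_ : balls _ = setT) //; apply/seteqP; split.
rewrite (_ : balls _ = [set y | (sqd x y <= r ^+ 2)%R] `&` balls s).
  apply: measurableI => //.
  have := measurable_sqd1 x measurableT (measurable_itv `]-oo, (r ^+ 2)%R]).
  by rewrite setTI; congr (measurable _); apply/seteqP; split => y /=; rewrite in_itv.
by apply/seteqP; split => y /= => [/andP[]|[a b]] //; apply/andP.
Qed.

Lemma sqr_le_sqd x y i : ((x ord0 i - y ord0 i) ^+ 2 <= sqd x y)%R.
Proof.
rewrite /sqd (bigD1 i) //= lerDl; apply: sumr_ge0 => j _; exact: sqr_ge0.
Qed.

(** Closed balls with rational centre and radius [1/(j+1)], enumerated by their codes; a number that
    is no code gives the empty set. *)
Definition rational_ball (k : nat) : set 'rV[R]_n :=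
  if unpickle k is Some (c, j) then
    balls [:: (map_mx (ratr : rat -> R) (c : 'rV[rat]_n), (j : nat).+1%:R^-1)%R]
  else set0.

Lemma measurable_rational_ball k : measurable (rational_ball k : set T).
Proof.
by rewrite /rational_ball; case: unpickle => [[c j]|//]; exact: measurable_balls.
Qed.

Lemma open_ballP U x : open U -> U x ->
  exists2 e : R, (0 < e)%R & forall y, (forall i, `|x ord0 i - y ord0 i| < e)%R -> U y.
Proof.
move=> oU Ux; have /nbhs_ballP[e /= e0 He] : nbhs x U by exact: open_nbhs_nbhs.
exists e => // y Hy; apply: He; split => // i j; rewrite ord1; exact: Hy.
Qed.

Lemma rational_ball_basis U x : open U -> U x ->
  exists k, rational_ball k x /\ rational_ball k `<=` U.
Proof.
move=> oU Ux; have [e e0 He] := open_ballP oU Ux.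
have [j je] : exists j : nat, (j.+1%:R^-1 < e / 2 :> R)%R.
  have := near_infty_natSinv_lt (PosNum (divr_gt0 e0 (ltr0n R 2))).
  by move=> [j _ Hj]; exists j; exact: (Hj j (leqnn j)).
pose d : R := (j.+1%:R^-1)%R; have d0 : (0 < d)%R by rewrite invr_gt0.
(* If each coordinate of the centre is within [d'] of [x], the squared distance is at most
   [n d^2/(n+1)^2 <= d^2], so [x] lies in the ball. A point of the ball is then within
   [d' + d <= 2 d < e] of [x] in each coordinate. *)
pose d' := (d / n.+1%:R)%R; have d'0 : (0 < d')%R by rewrite divr_gt0.
have Q i : exists c : rat, (x ord0 i - d' < ratr c < x ord0 i + d')%R.
  have /rat_in_itvoo[c] : (x ord0 i - d' < x ord0 i + d')%R.
    by rewrite ltrBlDr -addrA ltrDl addr_gt0.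
  by rewrite in_itv => H; exists c.
have [c Hc] := choice Q.
pose c' : 'rV[rat]_n := \row_i c i.
exists (pickle (c', j)); rewrite /rational_ball pickleK; split.
  rewrite /balls /= andbT -/d.
  apply: (@le_trans _ _ (\sum_(i < n) d' ^+ 2)%R).
    apply: ler_sum => i _; rewrite !mxE -real_normK ?num_real //.
    rewrite ler_sqr ?nnegrE ?(ltW d'0) // ler_norml.
    have /andP[h1 h2] := Hc i; apply/andP; split; lra.
  rewrite sumr_const card_ord -mulr_natr /d' expr_div_n -mulrA ler_piMr ?sqr_ge0 //.
  rewrite mulrC ler_pdivrMr ?exprn_gt0 // mul1r -natrX ler_nat.
  by rewrite (leq_trans (leqnSn n)) // -[X in (X <= _)%N]expn1 leq_pexp2l.
move=> y /= /andP[+ _]; rewrite -/d => yd; apply: He => i.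
have := le_trans (sqr_le_sqd _ _ i) yd; rewrite !mxE => h.
have {h} : (`|ratr (c i) - y ord0 i| <= d)%R.
  by rewrite -ler_sqr ?nnegrE ?(ltW d0) // real_normK ?num_real.
rewrite ler_norml => /andP[h1 h2]; have /andP[h3 h4] := Hc i.
have : (d' <= d)%R by rewrite ler_pdivrMr // ler_peMr ?(ltW d0) // ler1n.
rewrite ltr_norml; move: je; rewrite -/d => je dd; apply/andP; split; lra.
Qed.

(** An open set is the union of the countably many rational balls that it contains. *)
Lemma measurable_ballsE : (@measurable _ T : set (set T)) =
  <<s [set balls s | s in setT] >>.
Proof.
apply/seteqP; split; last first.
  apply: smallest_sub; first exact: sigma_algebra_measurable.
  by move=> _ [s _ <-]; exact: measurable_balls.
apply: smallest_sub; first exact: smallest_sigma_algebra.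
move=> U oU; pose G := [set balls s | s in setT] : set (set T).
rewrite (_ : U = \bigcup_k (if `[< rational_ball k `<=` U >] then rational_ball k else set0)).
  apply: (@bigcupT_measurable _ (g_sigma_algebraType G)) => k.
  case: ifP => _; last exact: measurable0.
  rewrite /rational_ball; case: unpickle => [[c j]|]; last exact: measurable0.
  by apply: sub_sigma_algebra; exists [:: (map_mx ratr c, j.+1%:R^-1)%R].
apply/seteqP; split => [x Ux|x [k _]].
  have [k [kx kU]] := rational_ball_basis oU Ux.
  by exists k => //; rewrite asboolT.
by case: asboolP => // kU /kU.
Qed.

Lemma gauss_determines (p q : {finite_measure set T -> \bar R}) :
  (forall t x, (0 < t)%R -> gauss_potential t p x = gauss_potential t q x) ->
  measure_eq p q.
Proof.
move=> H; apply: (measure_unique [set balls s | s in setT] (fun=> setT)).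
- exact: measurable_ballsE.
- move=> _ _ [s _ <-] [s' _ <-]; exists (s ++ s') => //.
  by apply/seteqP; split => y; rewrite /balls /= all_cat;
    [by move=> /andP[]|by move=> [a b]; apply/andP].
- by move=> _; exists [::] => //; apply/seteqP; split.
- by rewrite bigcup_const.
- by move=> _ [s _ <-]; exact: measure_balls.
- by move=> _; rewrite -ge0_fin_numE // fin_num_measure.
Qed.

Lemma closed_support (mu : borel_measure R n) : closed (support mu).
Proof.
rewrite -[support mu]setCK; apply: open_closedC.
rewrite openE => x /= /existsNP[U /not_implyP[oU /not_implyP[Ux muU]]].
apply: (@filterS _ _ _ U); last exact: open_nbhs_nbhs.
by move=> y Uy /(_ U oU Uy).
Qed.

(** Lindelof argument: each point off the support has a null open neighbourhood, hence lies in one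
    of countably many null rational balls. *)
Lemma measureC_support (mu : borel_measure R n) : mu (~` support mu) = 0.
Proof.
have ms : measurable (~` support mu : set T).
  by apply: measurableC; apply: measurable_closed; exact: closed_support.
pose N k : set T := if mu (rational_ball k) == 0 then rational_ball k else set0.
have N0 : mu.-negligible (\bigcup_k N k).
  apply: negligible_bigcup => k; rewrite /N; case: ifP => [/eqP k0|_].
    by exists (rational_ball k); split => //; exact: measurable_rational_ball.
  exact: negligible_set0.
apply: measure_negligible => //; apply: negligibleS N0 => x /= /existsNP[U].
move=> /not_implyP[oU /not_implyP[Ux muU]].
have [k [kx kU]] := rational_ball_basis oU Ux.
exists k => //; rewrite /N ifT //.
rewrite -measure_le0 (@le_trans _ _ (mu U)) //; last by rewrite leNgt; apply/negP.
apply: le_measure => //; rewrite inE; first exact: measurable_rational_ball.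
exact: measurable_open.
Qed.

Lemma measure_support (mu : borel_measure R n) : mu (support mu) = mu setT.
Proof.
have ms : measurable (support mu : set T).
  by apply: measurable_closed; exact: closed_support.
rewrite -(setUv (support mu)) measureU //; last 2 first.
- exact: measurableC.
- exact: setICr.
by rewrite [X in _ + X]measureC_support adde0.
Qed.

End borel_sets.

(** * Subharmonicity of the kernel *)

Section power_inequalities.
Variable R : realType.
Implicit Types a e s : R.

(** The right side is [2 artanh e]; the difference of the two sides vanishes at 0 and has derivative
    [2 x^2/(1 - x^2)]. *)
Lemma ln_ratio_ge e : (0 <= e < 1 -> 2 * e <= ln (1 + e) - ln (1 - e))%R.
Proof.
move=> /andP[e0 e1]; pose f x : R := (ln (1 + x) - ln (1 - x) - 2 * x)%R.
pose df x : R := ((1 + x)^-1 + (1 - x)^-1 - 2)%R.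
have Df x : x \in `[0%R, e] -> is_derive x 1%R f (df x).
  rewrite in_itv /= => /andP[x0 xe].
  have p1 : (0 < 1 + x)%R by lra.
  have p2 : (0 < 1 - x)%R by lra.
  have d1 : is_derive x 1%R (@ln R \o (fun y => 1 + y))%R ((1 + x)^-1 * (0 + 1))%R.
    have h : is_derive x 1%R (fun y : R => 1 + y)%R (0 + 1)%R by exact: is_deriveD.
    exact: (@is_derive1_comp _ (@ln R) _ x _ _ (is_derive1_ln p1) h).
  have d2 : is_derive x 1%R (@ln R \o (fun y => 1 - y))%R ((1 - x)^-1 * (0 - 1))%R.
    have h : is_derive x 1%R (fun y : R => 1 - y)%R (0 - 1)%R by exact: is_deriveB.
    exact: (@is_derive1_comp _ (@ln R) _ x _ _ (is_derive1_ln p2) h).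
  rewrite (_ : f = (@ln R \o (fun y => 1 + y)) - (@ln R \o (fun y => 1 - y)) - (fun y => 2 * y))%R //.
  apply: is_derive_eq.
  by rewrite /df /GRing.scale /=; ring.
have cf : {within `[0%R, e], continuous f}.
  by apply: derivable_within_continuous => x /Df d.
have [c] := @MVT_segment R f df 0%R e e0
  (fun x xe => Df x (subset_itv_oo_cc xe)) cf.
rewrite in_itv /= => /andP[c0 ce] E.
suff : (0 <= df c * (e - 0))%R.
  have f0 : f 0%R = 0%R by rewrite /f addr0 subr0 mulr0 ln1 !subr0.
  by rewrite -E f0 subr0 /f subr_ge0.
rewrite mulr_ge0 ?subr0 // /df.
have p1 : (0 < 1 + c)%R by lra.
have p2 : (0 < 1 - c)%R by lra.
have -> : ((1 + c)^-1 + (1 - c)^-1 - 2 = 2 * c ^+ 2 / ((1 + c) * (1 - c)))%R.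
  by field; rewrite !gt_eqF.
by rewrite divr_ge0 ?mulr_ge0 ?sqr_ge0 // ltW.
Qed.

(** That is [s <= sinh s]; the derivative [e^x + e^(-x) - 2] of the difference is nonnegative by
    [e^x >= 1 + x]. *)
Lemma expR_sub_expRN_ge s : (0 <= s -> 2 * s <= expR s - expR (- s))%R.
Proof.
move=> s0; pose f x : R := (expR x - expR (- x) - 2 * x)%R.
pose df x : R := (expR x + expR (- x) - 2)%R.
have Df (x : R) : is_derive x 1%R f (df x).
  have d2 : is_derive x 1%R (@expR R \o -%R)%R (expR (- x) * - 1)%R.
    have h : is_derive x 1%R (-%R : R -> R) (- 1)%R by exact: is_deriveN.
    exact: (@is_derive1_comp _ (@expR R) _ x _ _ (is_derive_expR _) h).
  rewrite (_ : f = @expR R - (@expR R \o -%R) - (fun y => 2 * y))%R //.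
  apply: is_derive_eq.
  by rewrite /df /GRing.scale /=; ring.
have cf : {within `[0%R, s], continuous f}.
  by apply: derivable_within_continuous => x _; exact: ex_derive.
have [c _] := @MVT_segment R f df 0%R s s0 (fun x _ => Df x) cf.
have f0 : f 0%R = 0%R by rewrite /f oppr0 subrr mulr0 subr0.
rewrite f0 !subr0 => E.
rewrite /f in E.
rewrite -subr_ge0 E mulr_ge0 // /df.
by have := expR_ge1Dx c; have := expR_ge1Dx (- c)%R; lra.
Qed.

(* Both powers are written expR (M + D) and expR (M - D) with
   M = - a ln (1 - e ^ 2) / 2 and D = a (ln (1 + e) - ln (1 - e)) / 2. *)
Lemma powR_second_difference a e : (0 <= a)%R -> (`|e| < 1)%R ->
  (2 + a * (a + 1) * e ^+ 2 <= (1 + e) `^ (- a) + (1 - e) `^ (- a))%R.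
Proof.
move=> a0; wlog e0 : e / (0 <= e)%R.
  move=> H; have [e0|e0] := leP 0%R e; first exact: H.
  rewrite -normrN => e1; have := H (- e)%R; rewrite oppr_ge0 (ltW e0) => /(_ isT e1).
  by rewrite sqrrN opprK [X in (_ <= X)%R]addrC.
rewrite ger0_norm // => e1.
have p1 : (0 < 1 + e)%R by lra.
have p2 : (0 < 1 - e)%R by lra.
pose M := (- (a / 2) * ln (1 - e ^+ 2))%R.
pose D := ((a / 2) * (ln (1 + e) - ln (1 - e)))%R.
have e2 : (0 <= e ^+ 2 < 1)%R.
  by rewrite sqr_ge0 /=; have : (e * e < 1)%R by nra.
have lnE : ln (1 - e ^+ 2)%R = (ln (1 + e) + ln (1 - e))%R.
  by rewrite -lnM ?posrE //; congr ln; ring.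
have E1 : ((1 + e) `^ (- a) = expR M * expR (- D))%R.
  by rewrite /powR gt_eqF // -expRD; congr expR; rewrite /M /D lnE; field.
have E2 : ((1 - e) `^ (- a) = expR M * expR D)%R.
  by rewrite /powR gt_eqF // -expRD; congr expR; rewrite /M /D lnE; field.
have MG : (a / 2 * e ^+ 2 <= M)%R.
  rewrite /M mulNr -mulrN ler_wpM2l ?divr_ge0 // lerNr le_ln1Dx //.
  by case/andP: e2 => _ e2; lra.
have DG : (a * e <= D)%R.
  rewrite /D -[leLHS](_ : a / 2 * (2 * e) = _)%R; last by field.
  by rewrite ler_wpM2l ?divr_ge0 // ln_ratio_ge // e0.
(* With [u = e^(D/2)] and [v = 1/u], [e^D + e^(-D) - 2 = (u - v)^2], and
   [u - v = 2 sinh(D/2) >= D]. *)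
have DD : (2 + D ^+ 2 <= expR (- D) + expR D)%R.
  have D0 : (0 <= D)%R by rewrite (le_trans _ DG) // mulr_ge0.
  have h := expR_sub_expRN_ge (divr_ge0 D0 (ler0n R 2)).
  pose u := expR (D / 2); pose v := expR (- (D / 2)).
  have uv : (u * v = 1)%R by rewrite /u /v expRN divff // gt_eqF // expR_gt0.
  have -> : (expR D = u ^+ 2)%R by rewrite /u -expRM_natl; congr expR; field.
  have -> : (expR (- D) = v ^+ 2)%R by rewrite /v -expRM_natl; congr expR; field.
  have {}h : (D <= u - v)%R by move: h; rewrite -/u -/v; lra.
  nra.
have M1 := expR_ge1Dx M.
rewrite E1 E2 -mulrDr.
have ae0 : (0 <= a * e)%R by rewrite mulr_ge0.
have D2 : ((a * e) ^+ 2 <= D ^+ 2)%R by rewrite ler_sqr ?nnegrE // (le_trans ae0).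
have ae2 : (0 <= a * e ^+ 2)%R by rewrite mulr_ge0 // sqr_ge0.
(* Expanding, the terms in [e^2] are [a + a^2 = a (a + 1)], and the remaining term in [e^4] is
   nonnegative. *)
apply: (@le_trans _ _ ((1 + a / 2 * e ^+ 2) * (2 + (a * e) ^+ 2))%R).
  rewrite exprMn; have := sqr_ge0 a; nra.
apply: ler_pM.
- lra.
- by rewrite addr_ge0 ?sqr_ge0.
- by rewrite (le_trans _ M1) // lerD2l.
- by rewrite (le_trans _ DD) // lerD2l.
Qed.

Lemma powR_tangent a s : (0 <= a)%R -> (0 <= s)%R ->
  (1 - a * s <= (1 + s) `^ (- a))%R.
Proof.
move=> a0 s0; have p : (0 < 1 + s)%R by lra.
rewrite /powR gt_eqF //; apply: le_trans (expR_ge1Dx _).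
by rewrite lerD2l mulNr lerN2 ler_wpM2l // le_ln1Dx //; lra.
Qed.

End power_inequalities.

Section kernel_laplacian.
Context (R : realType) (n : nat).
Implicit Types (x y : 'rV[R]_n) (a h del : R).

Definition axis_shift (i : 'I_n) h x : 'rV[R]_n := (x + h *: delta_mx ord0 i)%R.

Lemma axis_shiftE i h x j : axis_shift i h x ord0 j = (x ord0 j + h * (j == i)%:R)%R.
Proof. by rewrite !mxE eqxx. Qed.

Lemma sqd_axis_shift i h x y :
  sqd (axis_shift i h x) y = (sqd x y + 2 * h * (x ord0 i - y ord0 i) + h ^+ 2)%R.
Proof.
rewrite /sqd (bigD1 i) //= [in RHS](bigD1 i) //= axis_shiftE eqxx mulr1.
rewrite (eq_bigr (fun j => (x ord0 j - y ord0 j) ^+ 2)%R); first by ring.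
by move=> j ji; rewrite axis_shiftE (negPf ji) mulr0 addr0.
Qed.

Lemma powRN_le a u v : (0 <= a)%R -> (0 < u)%R -> (u <= v)%R ->
  (v `^ (- a) <= u `^ (- a) :> R)%R.
Proof.
move=> a0 u0 uv; have v0 : (0 < v)%R by exact: lt_le_trans uv.
by rewrite !powRN lef_pV2 ?posrE ?powR_gt0 // ge0_ler_powR ?nnegrE // ltW.
Qed.

(* The hypothesis n <= 2 (a + 1), that is alpha <= 2 for a = (n - alpha) / 2, is
   what makes the second order terms of the expansion add up to something
   nonnegative. *)
Lemma powR_laplacian a del : (0 <= a)%R -> (n%:R <= 2 * (a + 1))%R -> (0 < del)%R ->
  exists2 C : R, (0 <= C)%R & forall x y h, (del <= sqd x y)%R -> (0 < h)%R ->
    (h ^+ 2 * (a + 2) <= del)%R ->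
    ((2 * n%:R) * sqd x y `^ (- a) <=
     \sum_(i < n) (sqd (axis_shift i h x) y `^ (- a) + sqd (axis_shift i (- h) x) y `^ (- a)) +
     C * h ^+ 4)%R.
Proof.
move=> a0 na del0; pose b := (a * (a + 1))%R.
have b0 : (0 <= b)%R by rewrite mulr_ge0 // addr_ge0.
(* The loss found in [K] below is [4 b (a + 2) s^2 N^(-a)] with [s = h^2/N]; [N >= del] turns it
   into a multiple of [h^4]. *)
exists (4 * b * (a + 2) * del `^ (- a) / del ^+ 2)%R.
  by rewrite divr_ge0 ?sqr_ge0 // mulr_ge0 ?powR_ge0 // !mulr_ge0 // addr_ge0.
move=> x y h Nd h0 hd; set N := sqd x y in Nd *.
have N0 : (0 < N)%R by exact: lt_le_trans Nd.
pose s := (h ^+ 2 / N)%R.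
have s0 : (0 < s)%R by rewrite divr_gt0 // exprn_gt0.
have as1 : (s * (a + 2) <= 1)%R.
  by rewrite /s mulrAC ler_pdivrMr // mul1r (le_trans hd).
have s1 : (0 < 1 + s)%R by lra.
pose z i := (x ord0 i - y ord0 i)%R.
(* Chosen so that the shifts by [h] and [- h] along axis [i] give squared distances
   [N (1 + s) (1 + e i)] and [N (1 + s) (1 - e i)]. *)
pose e i := (2 * h * z i / (N + h ^+ 2))%R.
have Nh0 : (0 < N + h ^+ 2)%R by rewrite addr_gt0 // exprn_gt0.
have NhE : (N + h ^+ 2 = N * (1 + s))%R by rewrite /s; field; rewrite gt_eqF.
have hN : (h ^+ 2 < N)%R.
  by move: as1; rewrite /s mulrAC ler_pdivrMr // mul1r => H; have := exprn_gt0 2 h0; nra.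
(* [(N + h^2)^2 - 4 h^2 z_i^2 = (N - h^2)^2 + 4 h^2 (N - z_i^2)], positive since [h^2 < N] and
   [z_i^2 <= N]. *)
have e1 i : (`|e i| < 1)%R.
  rewrite /e normrM normfV (gtr0_norm Nh0) ltr_pdivrMr // mul1r.
  rewrite -ltr_sqr ?nnegrE ?(ltW Nh0) // real_normK ?num_real //.
  have zN := sqr_le_sqd x y i; rewrite -/N -/(z i) in zN.
  have : (0 < (N - h ^+ 2) ^+ 2)%R by rewrite exprn_gt0 // subr_gt0.
  have : (0 <= h ^+ 2 * (N - z i ^+ 2))%R by rewrite mulr_ge0 ?sqr_ge0 // subr_ge0.
  by rewrite !expr2; nra.
have e1' i : (0 < 1 + e i)%R by have := e1 i; rewrite ltr_norml => /andP[]; lra.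
have e1'' i : (0 < 1 - e i)%R by have := e1 i; rewrite ltr_norml => /andP[]; lra.
have T1 i : (sqd (axis_shift i h x) y = N * (1 + s) * (1 + e i))%R.
  by rewrite sqd_axis_shift -/N -NhE /e -/(z i); field; rewrite gt_eqF.
have T2 i : (sqd (axis_shift i (- h) x) y = N * (1 + s) * (1 - e i))%R.
  by rewrite sqd_axis_shift -/N -NhE /e -/(z i); field; rewrite gt_eqF.
pose P := (N `^ (- a) * (1 + s) `^ (- a))%R.
have P0 : (0 <= P)%R by rewrite mulr_ge0 ?powR_ge0.
have T i : (P * (2 + b * e i ^+ 2) <=
    sqd (axis_shift i h x) y `^ (- a) + sqd (axis_shift i (- h) x) y `^ (- a))%R.
  have Ns : (0 <= N * (1 + s))%R by rewrite mulr_ge0 // ltW.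
  rewrite T1 T2 !(powRM _ Ns) ?(ltW (e1' i)) ?(ltW (e1'' i)) //.
  rewrite powRM ?(ltW N0) ?(ltW s1) // -/P -mulrDr ler_wpM2l //.
  exact: powR_second_difference.
have sume : (\sum_(i < n) e i ^+ 2 = 4 * s / (1 + s) ^+ 2)%R.
  transitivity (4 * h ^+ 2 / (N + h ^+ 2) ^+ 2 * N)%R.
    have NE : (N = \sum_(i < n) z i ^+ 2)%R by [].
    rewrite [X in (_ * X)%R]NE mulr_sumr; apply: eq_bigr => i _; rewrite /e.
    by field; rewrite gt_eqF.
  by rewrite NhE /s; field; rewrite -/s !gt_eqF.
have sumP : (P * (2 * n%:R + b * (4 * s / (1 + s) ^+ 2)) <=
    \sum_(i < n) (sqd (axis_shift i h x) y `^ (- a) + sqd (axis_shift i (- h) x) y `^ (- a)))%R.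
  apply: le_trans (ler_sum _ (fun i _ => T i)).
  by rewrite -mulr_sumr big_split /= sumr_const card_ord -mulr_sumr sume -[(2 *+ n)%R]mulr_natr.
have V : (1 - 2 * s <= ((1 + s) ^+ 2)^-1)%R.
  rewrite -[leRHS]div1r ler_pdivlMr ?exprn_gt0 //.
  by have := sqr_ge0 s; rewrite !expr2 => ?; nra.
have tan : (1 - a * s <= (1 + s) `^ (- a))%R by apply: powR_tangent => //; exact: ltW.
have as0 : (0 <= 1 - a * s)%R by lra.
have Na0 : (0 <= N `^ (- a))%R by exact: powR_ge0.
(* After bounding [(1 + s)^(-a)] and [(1 + s)^(-2)] by their tangents, the coefficient of [s] is
   [4 b - 2 n a = 2 a (2 (a + 1) - n) >= 0], that of [s^2] is [- 4 b (a + 2)], and that of [s^3] is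
   [8 a b >= 0]. *)
have K : (N `^ (- a) * (2 * n%:R - 4 * b * (a + 2) * s ^+ 2) <=
    P * (2 * n%:R + b * (4 * s / (1 + s) ^+ 2)))%R.
  rewrite /P -[leRHS]mulrA ler_wpM2l //.
  apply: (@le_trans _ _ ((1 - a * s) * (2 * n%:R + b * (4 * s * (1 - 2 * s))))%R).
    have h1 : (0 <= s * a * (2 * (a + 1) - n%:R))%R.
      by rewrite mulr_ge0 ?subr_ge0 // mulr_ge0 // ltW.
    have h2 : (0 <= b * a * s ^+ 3)%R by apply: mulr_ge0; [exact: mulr_ge0|rewrite exprn_ge0 // ltW].
    rewrite -subr_ge0.
    have -> : ((1 - a * s) * (2 * n%:R + b * (4 * s * (1 - 2 * s))) -
       (2 * n%:R - 4 * b * (a + 2) * s ^+ 2) =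
       2 * (s * a * (2 * (a + 1) - n%:R)) + 8 * (b * a * s ^+ 3))%R.
      by rewrite /b; ring.
    by rewrite addr_ge0 // mulr_ge0.
  apply: ler_pM => //.
    have q : (0 <= 1 - 2 * s)%R by have := mulr_ge0 (ltW s0) a0; lra.
    apply: addr_ge0; first exact: mulr_ge0.
    apply: mulr_ge0 => //; apply: mulr_ge0 => //.
    by apply: mulr_ge0 => //; exact: ltW.
  by rewrite lerD2l ler_wpM2l // ler_wpM2l // mulr_ge0 // ltW.
have KC : (N `^ (- a) * (4 * b * (a + 2) * s ^+ 2) <=
    4 * b * (a + 2) * del `^ (- a) / del ^+ 2 * h ^+ 4)%R.
  rewrite mulrCA -!mulrA; do 4 (apply: ler_wpM2l; first by rewrite ?addr_ge0).
  apply: ler_pM; rewrite ?sqr_ge0 //; first exact: powRN_le.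
  rewrite /s expr_div_n mulrC -exprM; apply: ler_wpM2r; first by rewrite exprn_ge0 // ltW.
  by rewrite lef_pV2 ?posrE ?exprn_gt0 // ler_sqr ?nnegrE // ltW.
rewrite -lerBlDr.
apply: le_trans sumP; apply: le_trans K.
rewrite mulrBr [(2 * n%:R * _)%R]mulrC; lra.
Qed.

End kernel_laplacian.

(** * Continuity of potentials *)

Section measure_difference.
Context d (T : measurableType d) (R : realType).

(** A measure has to be nonnegative on every set, while [nu <= mu] is assumed on measurable sets
    only; hence the value 0 on the others. *)
Definition measure_diff (mu nu : {measure set T -> \bar R})
    (_ : forall A, measurable A -> nu A <= mu A) (_ : mu setT < +oo) (A : set T) :
    \bar R :=
  if `[< measurable A >] then mu A - nu A else 0.

Section instance.
Variables (mu nu : {measure set T -> \bar R}).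
Variables (numu : forall A, measurable A -> nu A <= mu A) (mu_fin : mu setT < +oo).
Local Notation mdiff := (measure_diff numu mu_fin).

Let mu_fin_num A : measurable A -> mu A \is a fin_num.
Proof. by move=> mA; apply: (lty_fin_num_fun mu_fin). Qed.

Let nu_fin_num A : measurable A -> nu A \is a fin_num.
Proof.
by move=> mA; apply: (lty_fin_num_fun (le_lt_trans (numu measurableT) mu_fin)).
Qed.

Lemma measure_diffE A : measurable A -> mdiff A = mu A - nu A.
Proof. by move=> mA; rewrite /measure_diff asboolT. Qed.

Let mdiff0 : mdiff set0 = 0.
Proof. by rewrite measure_diffE // !measure0 sube0. Qed.

Let mdiff_ge0 A : 0 <= mdiff A.
Proof.
rewrite /measure_diff; case: asboolP => // mA.
by rewrite sube_ge0 ?numu // nu_fin_num.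
Qed.

Let mdiff_sigma_additive : semi_sigma_additive mdiff.
Proof.
move=> F mF tF mUF; rewrite measure_diffE //.
rewrite (_ : (fun n => _) = fun n => \sum_(0 <= i < n) mu (F i) - \sum_(0 <= i < n) nu (F i)).
  apply: cvgeB.
  - by rewrite fin_num_adde_defl // fin_numN nu_fin_num.
  - exact: (@measure_semi_sigma_additive _ _ _ mu).
  - exact: (@measure_semi_sigma_additive _ _ _ nu).
apply/funext => n; elim: n => [|n IH]; first by rewrite !big_nil sube0.
have fs : \sum_(0 <= i < n) nu (F i) \is a fin_num.
  by apply/sum_fin_numP => i _ _; exact: nu_fin_num.
by rewrite !big_nat_recr //= IH measure_diffE // fin_num_oppeD ?nu_fin_num // addeACA.
Qed.

HB.instance Definition _ := isMeasure.Build d T R mdiff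
  mdiff0 mdiff_ge0 mdiff_sigma_additive.

Lemma measure_diff_lty : mdiff setT < +oo.
Proof.
by rewrite -ge0_fin_numE // measure_diffE // fin_numB mu_fin_num // nu_fin_num.
Qed.

Lemma measure_diff_add A : measurable A -> nu A + mdiff A = mu A.
Proof. by move=> mA; rewrite measure_diffE // addeC subeK // nu_fin_num. Qed.

Lemma integral_measure_diff (f : T -> \bar R) : measurable_fun setT f ->
  (forall x, 0 <= f x) ->
  \int[nu]_x f x + \int[mdiff]_x f x = \int[mu]_x f x.
Proof.
move=> mf f0; rewrite -ge0_integral_measure_add //.
apply: eq_measure_integral => A mA _.
by rewrite -measure_diff_add //; exact: measure_addE.
Qed.

End instance.

Lemma integral_mrestr (mu : {measure set T -> \bar R}) D (mD : measurable D)
    (f : T -> \bar R) : measurable_fun setT f -> (forall x, 0 <= f x) ->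
  \int[mrestr mu mD]_x f x = \int[mu]_(x in D) f x.
Proof.
move=> mf f0; rewrite -(setUv D) ge0_integral_setU //; first last.
- exact/disj_setPCl.
- by apply: measurable_funTS.
- exact: measurableC.
rewrite [X in _ + X = _](_ : _ = 0) ?adde0.
  apply: eq_measure_integral => A mA AD.
  by change (mu (A `&` D) = mu A); rewrite setIidl.
apply: null_set_integral => //.
- exact: measurableC.
- exact: measurable_funTS.
- by change (mu (~` D `&` D) = 0); rewrite setICl measure0.
Qed.

End measure_difference.

(** * Semicontinuity of potentials, and continuity away from the mass *)

Section potential_continuity.
Context (R : realType) (n : nat).
Local Notation T := (borelRn R n).
Implicit Types (x y : 'rV[R]_n) (rho : R).

(** Balls of radius [1/(k+1)] form a neighbourhood basis. The lemma turns Fatou and dominated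
    convergence, which concern sequences, into statements about neighbourhoods. *)
Lemma near_of_seq (P : 'rV[R]_n -> Prop) x :
  (forall u : nat -> 'rV[R]_n, u @ \oo --> x -> exists k, P (u k)) ->
  \forall x' \near x, P x'.
Proof.
move=> H; apply: contrapT => nP.
have Q (k : nat) : exists x', ball x (k.+1%:R^-1 : R)%R x' /\ ~ P x'.
  apply: contrapT => /forallNP nQ; apply: nP.
  apply/nbhs_ballP; exists (k.+1%:R^-1)%R => /=; first by rewrite invr_gt0.
  by move=> x' bx'; apply: contrapT => nPx'; apply: (nQ x').
have [u Hu] := choice Q.
have ux : u @ \oo --> x.
  apply/cvg_ballP => e e0.
  have [j _ Hj] := near_infty_natSinv_lt (PosNum e0).
  exists j => // k jk; apply: le_ball (Hu k).1; exact/ltW/(Hj k jk).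
by have [k Pk] := H u ux; exact: (Hu k).2.
Qed.

Lemma continuous_sqd y : continuous (fun x => sqd x y).
Proof.
rewrite /sqd; elim: (index_enum _) => [|i s IH].
  rewrite (_ : (fun x => _) = cst 0%R); first exact: cst_continuous.
  by apply/funext => x; rewrite big_nil.
pose f x := ((x ord0 i - y ord0 i) ^+ 2)%R.
rewrite (_ : (fun x => _) = (f \+ (fun x => \sum_(j <- s) (x ord0 j - y ord0 j) ^+ 2))%R).
  move=> x; apply: continuousD; last exact: IH.
  apply: (@continuous_comp _ _ _ (fun x => x ord0 i - y ord0 i)%R (fun z => z ^+ 2)%R).
    apply: continuousB; last exact: cst_continuous.
    exact: coord_continuous.
  exact: exprn_continuous.
by apply/funext => x; rewrite big_cons.
Qed.

Lemma cvg_sqd (u : nat -> 'rV[R]_n) x y : u @ \oo --> x ->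
  sqd (u k) y @[k --> \oo] --> sqd x y.
Proof. by move=> ux; exact: (cvg_comp _ _ ux (@continuous_sqd y x)). Qed.

Lemma sqd_triangle x y z : (sqd x z <= 2 * (sqd x y + sqd y z))%R.
Proof.
rewrite /sqd -big_split mulr_sumr /=; apply: ler_sum => i _.
have := sqr_ge0 ((x ord0 i - y ord0 i) - (y ord0 i - z ord0 i))%R.
by rewrite !expr2; nra.
Qed.

Section kernel.
Variable alpha : R.
Hypothesis alphan : (alpha < n%:R)%R.
Let a := ((n%:R - alpha) / 2)%R.

Let a0 : (0 < a)%R. Proof. by rewrite divr_gt0 // subr_gt0. Qed.

Lemma riesz_kernel_le rho x y : (0 < rho)%R -> (rho <= sqd x y)%R ->
  riesz_kernel alpha x y <= (rho `^ (- a))%:E.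
Proof.
move=> r0 rxy; have xy : x != y by rewrite -sqd_gt0 (lt_le_trans r0).
by rewrite riesz_kernelE // lee_fin powRN_le // ltW.
Qed.

Lemma riesz_kernel_ge rho x y : (0 < rho)%R -> (sqd x y <= rho)%R ->
  (rho `^ (- a))%:E <= riesz_kernel alpha x y.
Proof.
move=> r0 rxy; have [->|xy] := eqVneq x y; first by rewrite riesz_kernelxx leey.
by rewrite riesz_kernelE // lee_fin powRN_le // ?sqd_gt0 // ltW.
Qed.

Lemma cvg_riesz_kernel (u : nat -> 'rV[R]_n) x y : u @ \oo --> x ->
  riesz_kernel alpha (u k) y @[k --> \oo] --> riesz_kernel alpha x y.
Proof.
move=> ux; have cu := cvg_sqd (y := y) ux.
have [xy|xy] := eqVneq x y.
  rewrite xy riesz_kernelxx; apply/cvgeyPge => A.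
  pose B := Num.max A 1%R; have B0 : (0 < B)%R by rewrite lt_max ltr01 orbT.
  (* The squared radius at which the kernel takes the value [B]. *)
  pose r := (B `^ (- a^-1))%R; have r0 : (0 < r)%R by rewrite powR_gt0.
  have rB : (r `^ (- a) = B)%R.
    by rewrite /r -powRrM mulrNN mulVf ?gt_eqF // powRr1 // ltW.
  have : \forall k \near \oo, (sqd (u k) y < r)%R.
    by apply: (cvgr_lt (sqd x y) cu); rewrite xy sqdxx.
  apply: filterS => k kr; apply: (@le_trans _ _ B%:E).
    by rewrite lee_fin le_max lexx.
  by rewrite -rB; apply: riesz_kernel_ge => //; exact: ltW.
have s0 : (0 < sqd x y)%R by rewrite sqd_gt0.
have nk : \forall k \near \oo, (0 < sqd (u k) y)%R by exact: (cvgr_gt (sqd x y) cu).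
rewrite riesz_kernelE //.
apply: cvg_trans (_ : (expR (- a * ln (sqd (u k) y)))%:E @[k --> \oo] --> _).
  apply: near_eq_cvg; apply: filterS nk => k; rewrite sqd_gt0 => uy.
  by rewrite riesz_kernelE // /powR gt_eqF // sqd_gt0.
apply: cvg_EFin; first exact: nearW.
rewrite /powR gt_eqF //.
apply: (cvg_comp (fun k => - a * ln (sqd (u k) y))%R expR); last exact: continuous_expR.
apply: cvgMl_tmp.
exact: (cvg_comp _ _ cu (continuous_ln s0)).
Qed.

Variable m : {finite_measure set T -> \bar R}.
Local Notation U := (potential alpha m).

(** Fatou, the kernel being nonnegative and continuous into [0, +oo], diagonal included. *)
Lemma potential_lsc x c : c < U x -> \forall x' \near x, c < U x'.
Proof.
move=> cU; apply: near_of_seq => u ux; apply: contrapT => /forallNP H.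
have {}H k : U (u k) <= c by rewrite leNgt; apply/negP; exact: H.
move: cU; rewrite ltNge => /negP; apply.
have mk k : measurable_fun setT (fun y : T => riesz_kernel alpha (u k) y).
  exact: (measurableT_comp (measurable_riesz_kernel alphan) (measurable_pair1 (u k : T))).
have F := fatou m measurableT mk (fun k y _ => riesz_kernel_ge0 alpha (u k) y).
apply: (@le_trans _ _ (\int[m]_y limn_einf (fun k => riesz_kernel alpha (u k) y))).
  rewrite le_eqVlt; apply/orP; left; apply/eqP; apply: eq_integral => y _.
  by rewrite (cvg_limn_einf_sup (cvg_riesz_kernel (y := y) ux)).1.
apply: (le_trans F); rewrite limn_einf_lim.
apply: lime_le; first exact: is_cvg_einfs.
apply: nearW => k; apply: le_trans (H k); apply: ereal_inf_lbound.
by exists k => //=.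
Qed.

Lemma cvg_of_seq (V : topologicalType) (f : 'rV[R]_n -> V) x (l : V) :
  (forall u : nat -> 'rV[R]_n, u @ \oo --> x -> f (u k) @[k --> \oo] --> l) ->
  f x' @[x' --> x] --> l.
Proof.
move=> H A Al; apply: near_of_seq => u ux.
have [k _ Hk] := H u ux A Al; exists k; exact: (Hk k (leqnn k)).
Qed.

(** Once the massless ball is cut out, the kernel is bounded uniformly for base points near [x], and
    bounded convergence applies. *)
Lemma potential_off_mass x rho : (0 < rho)%R ->
  m [set y | (sqd x y < rho)%R] = 0 ->
  U x \is a fin_num /\ U x' @[x' --> x] --> U x.
Proof.
move=> r0 m0; pose A : set T := [set y | (sqd x y < rho)%R].
have mA : measurable A.
  have := measurable_sqd1 x measurableT (measurable_itv `]-oo, rho[).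
  by rewrite setTI; congr (measurable _); apply/seteqP; split => y /=; rewrite in_itv.
have mk z : measurable_fun setT (fun y : T => riesz_kernel alpha z y).
  exact: (measurableT_comp (measurable_riesz_kernel alphan) (measurable_pair1 (z : T))).
pose f z y := riesz_kernel alpha z y * (\1_(~` A) y)%:E.
have mf z : measurable_fun setT (f z : T -> \bar R).
  apply: emeasurable_funM => //; apply/measurable_EFinP.
  by apply: measurable_indic; exact: measurableC.
have UE z : U z = \int[m]_y f z y.
  rewrite /potential -(setUv A) ge0_integral_setU //; first last.
  - exact/disj_setPCl.
  - by move=> y _; exact: riesz_kernel_ge0.
  - by rewrite setUv.
  - exact: measurableC.
  rewrite null_set_integral ?add0e //; last exact: measurable_funTS.
  rewrite setUv integral_mkcond; apply: eq_integral => y _.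
  by rewrite patchE /f indicE; case: ifP => _; rewrite ?mule1 ?mule0.
have f0 z y : 0 <= f z y by rewrite mule_ge0 ?riesz_kernel_ge0 // lee_fin.
(* If [|x - z|^2 <= rho/4] and [|x - y|^2 >= rho], then [sqd_triangle] leaves
   [|z - y|^2 >= rho/4]. *)
pose C := ((rho / 4) `^ (- a))%R.
have r4 : (0 < rho / 4)%R by rewrite divr_gt0.
have fle z y : (sqd x z <= rho / 4)%R -> f z y <= C%:E.
  move=> xz; rewrite /f indicE; case: (boolP (y \in ~` A)) => [/set_mem yA|_]; last first.
    by rewrite mule0 lee_fin powR_ge0.
  rewrite mule1; apply: riesz_kernel_le => //.
  have {}yA : (rho <= sqd x y)%R by rewrite leNgt; apply/negP.
  by have := sqd_triangle x z y; lra.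
have cu u : u @ \oo --> x -> U (u k) @[k --> \oo] --> U x.
  move=> ux.
  have [N _ HN] : \forall k \near \oo, (sqd (u k) x < rho / 4)%R.
    by apply: (cvgr_lt _ (cvg_sqd (y := x) ux)); rewrite sqdxx.
  rewrite -(cvg_shiftn N) UE; under eq_fun do rewrite UE.
  apply: (@bounded_cvg_integral _ _ _ m _ _ C).
  - by move=> k; exact: mf.
  - exact: mf.
  - move=> k y; rewrite f0 /= fle // sqdC ltW //; apply: HN => /=; exact: leq_addl.
  move=> y; rewrite /f; apply: cvgeMr; first by [].
  by rewrite (cvg_shiftn N (fun k => riesz_kernel alpha (u k) y)); exact: cvg_riesz_kernel.
split; last exact: cvg_of_seq.
rewrite ge0_fin_numE ?potential_ge0 // UE.
apply: (@le_lt_trans _ _ (C%:E * m setT)).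
  rewrite -integral_cst //; apply: ge0_le_integral => //.
  by move=> y _; apply: fle; rewrite sqdxx ltW.
by rewrite lte_mul_pinfty ?lee_fin ?powR_ge0 // -ge0_fin_numE // fin_num_measure.
Qed.

End kernel.

End potential_continuity.

Lemma cvge_near_lt (R : realType) (S : Type) (G : set_system S) {FG : Filter G}
    (f : S -> \bar R) (l c : \bar R) :
  f x @[x --> G] --> l -> l < c -> \forall x \near G, f x < c.
Proof.
move=> fl lc; apply: (fl [set u | u < c]).
by apply: open_nbhs_nbhs; split => //; exact: open_ereal_lt_ereal.
Qed.

Section distances_and_small_balls.
Context (R : realType) (n : nat).
Local Notation T := (borelRn R n).
Implicit Types (x y : 'rV[R]_n) (F : set 'rV[R]_n).

Lemma near_sqd x (del : R) : (0 < del)%R -> \forall x' \near x, (sqd x' x < del)%R.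
Proof.
move=> d0; have c : sqd x' x @[x' --> x] --> sqd x x by exact: continuous_sqd.
by apply: (cvgr_lt _ c); rewrite sqdxx.
Qed.

Lemma sqd_lt_coord x y (e : R) : (0 < e)%R -> (sqd x y < e ^+ 2)%R ->
  forall i, (`|x ord0 i - y ord0 i| < e)%R.
Proof.
move=> e0 xy i; rewrite -ltr_sqr ?nnegrE ?(ltW e0) // real_normK ?num_real //.
exact: le_lt_trans (sqr_le_sqd _ _ _) xy.
Qed.

Lemma near_sqdP x (P : 'rV[R]_n -> Prop) : (\forall x' \near x, P x') ->
  exists2 del : R, (0 < del)%R & forall x', (sqd x' x < del)%R -> P x'.
Proof.
move=> /nbhs_ballP[e /= e0 He]; exists (e ^+ 2)%R; first by rewrite exprn_gt0.
move=> x' xx'; apply: He; split => // i j; rewrite ord1.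
by apply: sqd_lt_coord => //; rewrite sqdC.
Qed.

Lemma closed_dist F x : closed F -> ~ F x ->
  exists2 rho : R, (0 < rho)%R & forall y, F y -> (rho <= sqd x y)%R.
Proof.
move=> cF nFx; have [e e0 He] := open_ballP (closed_openC cF) nFx.
exists (e ^+ 2)%R; first by rewrite exprn_gt0.
move=> y Fy; rewrite leNgt; apply/negP => xy.
by apply: (He y) => //; exact: sqd_lt_coord.
Qed.

(** Off [F] the infimum of the squared distances is positive, hence smaller than its double, which
    some point of [F] undercuts; no compactness is involved. *)
Lemma near_minimizer F x : closed F -> F !=set0 ->
  exists2 x', F x' & forall y, F y -> (sqd x x' <= 2 * sqd x y)%R.
Proof.
move=> cF [z Fz]; have [Fx|nFx] := pselect (F x).
  by exists x => // y _; rewrite sqdxx mulr_ge0 ?sqd_ge0.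
have [rho r0 Hr] := closed_dist cF nFx.
pose S := [set sqd x y | y in F].
have hS : has_inf S.
  by split; [exists (sqd x z), z|exists rho => _ [y Fy <-]; exact: Hr].
have I0 : (0 < inf S)%R.
  by apply: (lt_le_trans r0); apply: lb_le_inf; [case: hS|move=> _ [y Fy <-]; exact: Hr].
have [_ [x' Fx' <-] Hx'] := inf_adherent I0 hS.
exists x' => // y Fy; have yS : (inf S <= sqd x y)%R.
  by apply: inf_lbound; [case: hS|exists y].
lra.
Qed.

Section potentials.
Variable alpha : R.
Hypothesis alphan : (alpha < n%:R)%R.
Let a := ((n%:R - alpha) / 2)%R.

Let a0 : (0 < a)%R. Proof. by rewrite divr_gt0 // subr_gt0. Qed.

Lemma measurable_riesz_kernel1 x :
  measurable_fun setT (fun y : T => riesz_kernel alpha x y).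
Proof.
exact: (measurableT_comp (measurable_riesz_kernel alphan) (measurable_pair1 (x : T))).
Qed.

(** The 6 is that of an almost nearest point: [|x' - y|^2 <= 2 (|x - x'|^2 + |x - y|^2)] and
    [|x - x'|^2 <= 2 |x - y|^2]. The power [a] carries it to the kernel. *)
Lemma riesz_kernel_compare x x' y : (sqd x' y <= 6 * sqd x y)%R ->
  riesz_kernel alpha x y <= (6 `^ a)%:E * riesz_kernel alpha x' y.
Proof.
move=> xx'; have c0 : (0 < 6 `^ a :> R)%R by rewrite powR_gt0.
have [E|x'y] := eqVneq x' y.
  by rewrite E riesz_kernelxx gt0_muley ?lte_fin // leey.
have xy0 : (0 < sqd x y)%R by move: x'y; rewrite -sqd_gt0; lra.
rewrite riesz_kernelE // -?sqd_gt0 // riesz_kernelE // -EFinM lee_fin -/a.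
have -> : (sqd x y = 6^-1 * (6 * sqd x y))%R by field.
rewrite powRM ?mulr_ge0 ?sqd_ge0 // ?(ltW xy0) //.
have -> : (6^-1 `^ (- a) = 6 `^ a :> R)%R.
  by rewrite -powR_inv1 // -powRrM mulN1r opprK.
rewrite ler_pM2l //; apply: powRN_le => //; first exact: ltW.
by rewrite sqd_gt0.
Qed.

Definition open_ball x (r : R) : set T := [set y | (sqd x y < r)%R].

Lemma measurable_open_ball x r : measurable (open_ball x r).
Proof.
have := measurable_sqd1 x measurableT (measurable_itv `]-oo, r[).
by rewrite setTI; congr (measurable _); apply/seteqP; split => y /=; rewrite in_itv.
Qed.

Lemma potential_mrestr (m : {measure set T -> \bar R}) D (mD : measurable D) x :
  potential alpha (mrestr m mD) x = \int[m]_(y in D) riesz_kernel alpha x y.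
Proof.
apply: integral_mrestr; first exact: measurable_riesz_kernel1.
exact: riesz_kernel_ge0.
Qed.

Lemma potential_split (m : {measure set T -> \bar R}) D (mD : measurable D) x :
  potential alpha m x = potential alpha (mrestr m mD) x +
    potential alpha (mrestr m (measurableC mD)) x.
Proof.
rewrite !potential_mrestr /potential -{1}(setUv D) ge0_integral_setU //.
- exact: measurableC.
- by rewrite setUv; exact: measurable_riesz_kernel1.
- by move=> y _; exact: riesz_kernel_ge0.
- exact/disj_setPCl.
Qed.

(** A finite potential at [x] forces the point [x] to be null, so the kernel restricted to shrinking
    balls tends to 0 almost everywhere, dominated by the kernel itself. *)
Lemma potential_small_ball (m : {measure set T -> \bar R}) x (e : R) : (0 < e)%R ->
  potential alpha m x < +oo ->
  exists2 r : R, (0 < r)%R &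
    potential alpha (mrestr m (measurable_open_ball x r)) x <= e%:E.
Proof.
move=> e0 Uy.
have ik : m.-integrable setT (riesz_kernel alpha x : T -> \bar R).
  apply/integrableP; split; first exact: measurable_riesz_kernel1.
  by under eq_integral do rewrite gee0_abs ?riesz_kernel_ge0 //.
pose f (k : nat) (y : T) := riesz_kernel alpha x y * (\1_(open_ball x k.+1%:R^-1) y)%:E.
have mf k : measurable_fun setT (f k).
  apply: emeasurable_funM; first exact: measurable_riesz_kernel1.
  by apply/measurable_EFinP; apply: measurable_indic; exact: measurable_open_ball.
have fin_ae := integrable_ae measurableT ik.
have fk0 : {ae m, forall y, setT y -> f ^~ y @ \oo --> (cst 0 : T -> \bar R) y}.
  apply: filterS fin_ae => y /(_ I) yf _.
  have xy : (0 < sqd x y)%R.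
    by rewrite sqd_gt0; apply/eqP => xy; move: yf; rewrite xy riesz_kernelxx.
  have [j _ Hj] := near_infty_natSinv_lt (PosNum xy).
  apply: (@cvg_near_cst _ _ _ _ _); exists j => // k jk; rewrite /f indicE memNset ?mule0 //.
  by rewrite /open_ball /=; apply/negP; rewrite -leNgt; exact/ltW/(Hj k jk).
have fle : {ae m, forall y k, setT y -> `|f k y| <= riesz_kernel alpha x y}.
  apply: aeW => y k _; rewrite /f indicE; case: (y \in _).
    by rewrite mule1 gee0_abs ?riesz_kernel_ge0.
  by rewrite mule0 abse0 riesz_kernel_ge0.
have [_ _] := dominated_convergence measurableT mf (measurable_cst 0) fk0 ik fle.
rewrite integral0 => c.
have e0' : (0 : \bar R) < e%:E by rewrite lte_fin.
have [j _ Hj] : \forall k \near \oo, \int[m]_y f k y < e%:E.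
  exact: (cvge_near_lt c e0').
exists (j.+1%:R^-1)%R; first by rewrite invr_gt0.
rewrite potential_mrestr integral_mkcond ltW //.
rewrite (_ : integral _ _ _ = \int[m]_y f j y); first exact: (Hj j (leqnn j)).
apply: eq_integral => y _.
by rewrite patchE /f indicE; case: ifP => _; rewrite ?mule1 ?mule0.
Qed.

End potentials.

End distances_and_small_balls.

(** * From continuity on F to upper semicontinuity in space *)

Section continuity_principle.
Context (R : realType) (n : nat).
Local Notation T := (borelRn R n).
Variable alpha : R.
Hypothesis alphan : (alpha < n%:R)%R.
Local Notation a := ((n%:R - alpha) / 2)%R.
Implicit Types (m sigma : {measure set T -> \bar R}) (x : 'rV[R]_n).

Lemma potential_measure_diff m sigma
    (le : forall A : set T, measurable A -> m A <= sigma A)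
    (sfin : sigma setT < +oo) x :
  potential alpha m x + potential alpha (measure_diff le sfin) x =
  potential alpha sigma x.
Proof.
apply: integral_measure_diff; first exact: measurable_riesz_kernel1.
exact: riesz_kernel_ge0.
Qed.

Lemma potential_le m sigma x : (forall A : set T, measurable A -> m A <= sigma A) ->
  sigma setT < +oo -> potential alpha m x <= potential alpha sigma x.
Proof.
move=> le sfin; rewrite -(potential_measure_diff le sfin) leeDl //.
exact: potential_ge0.
Qed.

Lemma mrestr_le m D (mD : measurable D) A : measurable A -> mrestr m mD A <= m A.
Proof.
move=> mA; change (m (A `&` D) <= m A); apply: le_measure; rewrite ?inE //.
exact: measurableI.
Qed.

Section submeasure.
Variables (sigma : {measure set T -> \bar R}) (F : set 'rV[R]_n).
Hypotheses (sfin : sigma setT < +oo)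
  (pot_fin : forall x, F x -> potential alpha sigma x \is a fin_num)
  (pot_cont : {within F, continuous (potential alpha sigma)}).

Lemma potential_fin_num m x : (forall A : set T, measurable A -> m A <= sigma A) ->
  F x -> potential alpha m x \is a fin_num.
Proof.
move=> le Fx; rewrite ge0_fin_numE ?potential_ge0 //.
apply: (le_lt_trans (potential_le x le sfin)).
by rewrite -ge0_fin_numE ?potential_ge0 // pot_fin.
Qed.

(* The remainder sigma - m has a lower semicontinuous potential. *)
Lemma potential_usc_within m x0 (e : R) :
  (forall A : set T, measurable A -> m A <= sigma A) -> F x0 -> (0 < e)%R ->
  \forall x \near x0, F x -> potential alpha m x <= potential alpha m x0 + e%:E.
Proof.
move=> le Fx0 e0; have e20 : (0 < e / 2)%R by rewrite divr_gt0.
pose r := finite_measure_of (measure_diff_lty le sfin).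
have sE x : potential alpha m x + potential alpha r x = potential alpha sigma x.
  exact: (potential_measure_diff le sfin).
have rfin x : F x -> potential alpha r x \is a fin_num.
  apply: potential_fin_num => A mA; change (measure_diff le sfin A <= sigma A).
  by rewrite -(measure_diff_add le sfin mA) leeDr.
have h1 : \forall x \near x0, potential alpha r x0 - (e / 2)%:E < potential alpha r x.
  apply: (potential_lsc alphan); rewrite lteBlDr // lteDl ?lte_fin //; exact: rfin.
have h2 : \forall x \near x0, F x ->
    potential alpha sigma x < potential alpha sigma x0 + (e / 2)%:E.
  have c := @pot_cont x0.
  have lt0 : potential alpha sigma x0 < potential alpha sigma x0 + (e / 2)%:E.
    by rewrite lteDl ?lte_fin // pot_fin.
  have := cvge_near_lt c lt0; rewrite /prop_near1 /nbhs /= -nbhs_subspace_in // => H.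
  exact: (H (within_filter _ _)).
near=> x => Fx.
have : potential alpha sigma x < potential alpha sigma x0 + (e / 2)%:E.
  by apply: (near h2 x).
have : potential alpha r x0 - (e / 2)%:E < potential alpha r x by near: x.
rewrite -!sE; move: (rfin _ Fx) (rfin _ Fx0) (potential_fin_num le Fx)
  (potential_fin_num le Fx0).
case: (potential alpha r x) => // rx; case: (potential alpha r x0) => // rx0.
case: (potential alpha m x) => // mx; case: (potential alpha m x0) => // mx0 _ _ _ _.
rewrite -!EFinD !lte_fin lee_fin; lra.
Unshelve. all: by end_near. Qed.

(* Near x0 the mass close to x0 is dominated, up to the factor 6 ^ a, by its
   potential at an almost nearest point of F, and the rest is continuous. *)
Lemma potential_usc m x0 (e : R) : closed F -> m (~` F) = 0 ->
  (forall A : set T, measurable A -> m A <= sigma A) -> F x0 -> (0 < e)%R ->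
  \forall x \near x0, potential alpha m x <= potential alpha m x0 + e%:E.
Proof.
move=> cF mF le Fx0 e0.
pose c : R := (6 `^ a)%R; have c0 : (0 < c)%R by rewrite powR_gt0.
(* The near mass contributes at most [c (2 e')] and the far mass errs by at most [e'], together
   [e]. *)
pose e' : R := (e / (2 * c + 1))%R.
have c21 : (0 < 2 * c + 1)%R by rewrite addr_gt0 // mulr_gt0.
have e'0 : (0 < e')%R by rewrite divr_gt0.
have mfin : m setT < +oo by exact: le_lt_trans (le _ measurableT) sfin.
have Um0 := potential_fin_num le Fx0.
have Uy : potential alpha m x0 < +oo by rewrite -ge0_fin_numE ?potential_ge0.
have [r r0 Hr] := potential_small_ball alphan e'0 Uy.
have mB := measurable_open_ball x0 r.
pose mr := mrestr m mB; pose mc := mrestr m (measurableC mB).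
have mrle A : measurable A -> mr A <= sigma A.
  by move=> mA; apply: le_trans (le A mA); exact: mrestr_le.
have mcfin : mc setT < +oo by apply: le_lt_trans mfin; exact: mrestr_le.
have h1 : \forall x \near x0, F x -> potential alpha mr x <= (2 * e')%:E.
  apply: filterS (potential_usc_within mrle Fx0 e'0) => x H Fx.
  apply: (le_trans (H Fx)); rewrite (_ : (2 * e')%R = (e' + e')%R); last by ring.
  by rewrite EFinD leeD2r.
have [del d0 Hd] := near_sqdP h1.
have mc0 : mc (open_ball x0 r) = 0.
  by change (m (open_ball x0 r `&` ~` open_ball x0 r) = 0); rewrite setICr measure0.
have [mcf mcc] := @potential_off_mass R n alpha alphan (finite_measure_of mcfin) x0 r r0 mc0.
have h2 : \forall x \near x0, potential alpha mc x < potential alpha mc x0 + e'%:E.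
  by apply: (cvge_near_lt mcc); rewrite lteDl ?lte_fin.
(* As [x0] lies in [F], an almost nearest point [x'] to [x] satisfies
   [|x' - x0|^2 <= 6 |x - x0|^2 < del]. *)
have d60 : (0 < del / 6)%R by rewrite divr_gt0.
near=> x.
have xx0 : (sqd x x0 < del / 6)%R by near: x; exact: near_sqd.
have [x' Fx' Hx'] := @near_minimizer R n F x cF (ex_intro _ _ Fx0).
have Urx : potential alpha mr x <= c%:E * potential alpha mr x'.
  rewrite /potential -ge0_integralZl //; last 3 first.
  - exact: measurable_riesz_kernel1.
  - by move=> y _; exact: riesz_kernel_ge0.
  - by rewrite lee_fin ltW.
  apply: ae_ge0_le_integral => //.
  - by move=> y _; exact: riesz_kernel_ge0.
  - exact: measurable_riesz_kernel1.
  - by move=> y _; rewrite mule_ge0 ?riesz_kernel_ge0 // lee_fin ltW.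
  - by apply: measurable_funeM; exact: measurable_riesz_kernel1.
  exists (~` F); split.
  - by apply: measurableC; exact: measurable_closed.
  - apply/eqP; rewrite -measure_le0 -mF; apply: mrestr_le.
    by apply: measurableC; exact: measurable_closed.
  move=> y /= nH Fy; apply: nH => _; apply: (riesz_kernel_compare alphan).
  by have := sqd_triangle x' x y; rewrite (sqdC x' x); have := Hx' y Fy; lra.
have Urx' : potential alpha mr x' <= (2 * e')%:E.
  apply: (Hd _ _ Fx'); have := sqd_triangle x' x x0; rewrite (sqdC x' x).
  by have := Hx' _ Fx0; lra.
have Ucx : potential alpha mc x < potential alpha mc x0 + e'%:E by near: x.
have Ucx0 : potential alpha mc x0 <= potential alpha m x0.
  by rewrite [leRHS](potential_split alphan m mB) leeDr // potential_ge0.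
rewrite (potential_split alphan m mB).
apply: (@le_trans _ _ (c%:E * (2 * e')%:E + (potential alpha m x0 + e'%:E))).
  apply: leeD.
    by apply: (le_trans Urx); rewrite lee_pmul2l ?lte_fin.
  by apply: (le_trans (ltW Ucx)); rewrite leeD2r.
rewrite addeCA leeD2l // -EFinM -EFinD lee_fin.
rewrite (_ : c * (2 * e') + e' = e)%R // /e'.
by field; rewrite gt_eqF.
Unshelve. all: by end_near. Qed.

End submeasure.

End continuity_principle.

(** * The maximum principle *)

Section laplacian_of_potential.
Context (R : realType) (n : nat).
Local Notation T := (borelRn R n).
Variable alpha : R.
Hypotheses (alphan : (alpha < n%:R)%R) (alpha_le2 : (alpha <= 2)%R).
Local Notation a := ((n%:R - alpha) / 2)%R.
Variables (m : {finite_measure set T -> \bar R}) (K : set 'rV[R]_n).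
Hypotheses (cK : closed K) (mK : m (~` K) = 0).
Local Notation U := (potential alpha m).
Implicit Types (x : 'rV[R]_n).

Lemma potential_off_support x : ~ K x ->
  U x \is a fin_num /\ U x' @[x' --> x] --> U x.
Proof.
move=> nKx; have [rho r0 Hr] := closed_dist cK nKx.
apply: (potential_off_mass alphan r0); apply/eqP; rewrite -measure_le0 -mK.
apply: le_measure; rewrite ?inE.
- exact: measurable_open_ball.
- by apply: measurableC; exact: measurable_closed.
- by move=> y /= xy Ky; have := Hr y Ky; rewrite leNgt xy.
Qed.

Lemma ae_supported (P : T -> Prop) : (forall y, K y -> P y) -> {ae m, forall y, P y}.
Proof.
move=> HP; exists (~` K); split => //.
- by apply: measurableC; exact: measurable_closed.
- by move=> y /= nP Ky; apply: nP; exact: HP.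
Qed.

(** [powR_laplacian] integrated against [m]. Since [x] has positive distance to [K], its error is
    uniform in [y] and only gains the factor [m setT]. *)
Lemma potential_laplacian x : ~ K x -> exists C h0 : R, [/\ (0 <= C)%R, (0 < h0)%R &
  forall h, (0 < h <= h0)%R ->
    [/\ forall i, ~ K (axis_shift i h x), forall i, ~ K (axis_shift i (- h) x) &
    (2 * n%:R * fine (U x) <= \sum_(i < n) (fine (U (axis_shift i h x)) +
      fine (U (axis_shift i (- h) x))) + C * h ^+ 4)%R]].
Proof.
move=> nKx; have [rho r0 Hr] := closed_dist cK nKx.
have a0 : (0 < a)%R by rewrite divr_gt0 // subr_gt0.
have na : (n%:R <= 2 * (a + 1))%R.
  have -> : (2 * (a + 1) = n%:R - alpha + 2)%R by field.
  by rewrite -addrA lerDl addrC subr_ge0.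
have [C C0 HC] := powR_laplacian (ltW a0) na r0.
pose M := fine (m setT).
have M0 : (0 <= M)%R by rewrite fine_ge0.
(* As [h <= 1], this gives [h^2 (a + 3) <= rho]: hence [h^2 < rho], which keeps the shifted points
   off [K], and [h^2 (a + 2) <= rho], as [powR_laplacian] requires. *)
pose h0 := Num.min 1%R (rho / (a + 3))%R.
have a3 : (0 < a + 3)%R by rewrite addr_gt0.
exists (C * M)%R, h0; split; first exact: mulr_ge0.
  by rewrite lt_min ltr01 /= divr_gt0.
move=> h /andP[h_gt0]; rewrite le_min => /andP[h1 hr].
have h2h : (h ^+ 2 <= h)%R by rewrite expr2 ler_piMr // ltW.
have h2r : (h ^+ 2 * (a + 3) <= rho)%R.
  by rewrite -ler_pdivlMr // (le_trans h2h).
have h20 : (0 < h ^+ 2)%R by rewrite exprn_gt0.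
have h2rho : (h ^+ 2 < rho)%R by nra.
have nKs i s : (s ^+ 2 < rho)%R -> ~ K (axis_shift i s x).
  move=> sr Ks; have := Hr _ Ks; rewrite sqdC sqd_axis_shift sqdxx subrr mulr0 !add0r.
  by rewrite leNgt sr.
have nK1 i : ~ K (axis_shift i h x) by exact: nKs.
have nK2 i : ~ K (axis_shift i (- h) x) by apply: nKs; rewrite sqrrN.
split => //.
have fU z : ~ K z -> U z \is a fin_num by move=> /potential_off_support[].
have mk z : measurable_fun setT (fun y : T => riesz_kernel alpha z y).
  exact: measurable_riesz_kernel1.
have k0 z y : 0 <= riesz_kernel alpha z y by exact: riesz_kernel_ge0.
have ch0 : (0 <= C * h ^+ 4)%R by rewrite mulr_ge0 // exprn_ge0 // ltW.
have key : (2 * n%:R)%:E * U x <=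
    \sum_(i < n) (U (axis_shift i h x) + U (axis_shift i (- h) x)) + (C * h ^+ 4)%:E * m setT.
  rewrite /potential -integral_cst // -ge0_integralZl //.
  under eq_bigr do rewrite -ge0_integralD //.
  rewrite -ge0_integral_sum //; last 2 first.
  - by move=> i; exact: emeasurable_funD.
  - by move=> i y _; exact: adde_ge0.
  rewrite -ge0_integralD //; last 2 first.
  - by move=> y _; apply: sume_ge0 => i _; exact: adde_ge0.
  - by apply: emeasurable_sum => i; exact: emeasurable_funD.
  apply: ae_ge0_le_integral => //.
  - by move=> y _; rewrite mule_ge0 // lee_fin mulr_ge0.
  - exact: measurable_funeM.
  - by move=> y _; rewrite adde_ge0 ?lee_fin // sume_ge0 // => i _; exact: adde_ge0.
  - apply: emeasurable_funD; last exact: measurable_cst.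
    by apply: emeasurable_sum => i; exact: emeasurable_funD.
  apply: ae_supported => y Ky _.
  have ne z : ~ K z -> z != y by move=> nKz; apply/eqP => zy; apply: nKz; rewrite zy.
  rewrite riesz_kernelE ?ne //.
  under eq_bigr do rewrite !riesz_kernelE ?ne // -EFinD.
  rewrite sumEFin /= -EFinM -EFinD lee_fin; apply: HC => //; first exact: Hr.
  by nra.
have fin_numDE (u v : \bar R) : u \is a fin_num -> v \is a fin_num ->
    u + v = (fine u + fine v)%:E by case: u => // u; case: v.
have mE : m setT = M%:E by rewrite fineK // fin_num_measure.
rewrite mE -(fineK (fU _ nKx)) in key.
rewrite (eq_bigr (fun i => (fine (U (axis_shift i h x)) + fine (U (axis_shift i (- h) x)))%:E)) in key.
  rewrite sumEFin -!EFinM -EFinD lee_fin in key.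
  by rewrite (le_trans key) // lerD2l mulrAC.
by move=> i _; exact: fin_numDE (fU _ (nK1 i)) (fU _ (nK2 i)).
Qed.

End laplacian_of_potential.

Lemma continuous_max_cst (R : realType) (w : R) : continuous (fun r : R => Num.max r w).
Proof.
rewrite (_ : (fun r => _) = fun r => ((r + w + `|r - w|) / 2)%R); last first.
  by apply/funext => r; rewrite maxr_absE.
move=> r; apply: cvgMr_tmp; apply: cvgD; first exact: cvgD cvg_id (cvg_cst w).
by apply: cvg_norm; exact: cvgB cvg_id (cvg_cst w).
Qed.

Section compact_maximum_principle.
Context (R : realType) (n : nat).
Local Notation T := (borelRn R n).
Variable alpha : R.
Hypotheses (alphan : (alpha < n%:R)%R) (n_gt0 : (0 < n)%N) (alpha_le2 : (alpha <= 2)%R).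
Local Notation a := ((n%:R - alpha) / 2)%R.
Implicit Types (x : 'rV[R]_n) (K : set 'rV[R]_n).

Definition cube (B : R) : set 'rV[R]_n := [set x | forall i, x ord0 i \in `[(- B)%R, B]].

Lemma cubeP B x : cube B x <-> forall i, (`|x ord0 i| <= B)%R.
Proof. by split => H i; have := H i; rewrite in_itv /= ler_norml. Qed.

Lemma compact_cube B : compact (cube B).
Proof. by apply: (@rV_compact _ n (fun=> `[(- B)%R, B]%classic)) => i; exact: segment_compact. Qed.

Lemma closed_cube B : closed (cube B).
Proof. by apply: compact_closed; [exact: norm_hausdorff|exact: compact_cube]. Qed.

(* Were the potential larger than w somewhere, a small multiple of |x|^2 added
   to it would make it have a maximum off K, against the mean value
   inequality.  Truncating at w2 > w turns the potential into a continuous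
   function on the whole space. *)
Lemma maximum_principle_compact (m : {finite_measure set T -> \bar R}) K (B0 w : R) :
  closed K -> m (~` K) = 0 -> K `<=` cube B0 -> (0 <= w)%R ->
  (forall x, K x -> potential alpha m x <= w%:E) ->
  (forall x0 e, K x0 -> (0 < e)%R ->
    \forall x \near x0, potential alpha m x <= (w + e)%:E) ->
  forall x, potential alpha m x <= w%:E.
Proof.
have r1 (A b C D E W : R) : (A + b <= C + D -> E <= A -> D < E - W -> 0 <= b ->
    W < C)%R by lra.
have r2 (e X Y S ci uc s : R) :
    (X <= Y -> Y + e * (S + 2 * s * ci + s ^+ 2) <= uc + e * S ->
     X <= uc - e * (2 * s * ci + s ^+ 2))%R by nra.
have r3 (X Y e uc h ci : R) : (X <= uc - e * (2 * h * ci + h ^+ 2) ->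
    Y <= uc - e * (2 * - h * ci + (- h) ^+ 2) ->
    X + Y <= 2 * uc - 2 * e * h ^+ 2)%R by rewrite sqrrN; nra.
have r4 (X Y Z W : R) : (X <= Y + Z -> Y <= X - W -> W <= Z)%R by lra.
have r5 (C h v N e : R) : (2 * N * e <= C * v -> C * v <= C * h ->
    h * (C + 1) <= N * e -> 0 < h -> 0 < N * e -> False)%R by nra.
move=> cK mK KB w0 Uw usc x1; set U := potential alpha m.
have a0 : (0 < a)%R by rewrite divr_gt0 // subr_gt0.
rewrite leNgt; apply/negP => wx1.
have nKx1 : ~ K x1 by move=> /Uw; rewrite leNgt wx1.
have off := potential_off_support alphan cK mK.
have [u1f _] := off x1 nKx1.
pose u x := fine (U x).
have uE x : ~ K x -> U x = (u x)%:E by move=> /off[/fineK].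
have wu1 : (w < u x1)%R by rewrite -lte_fin -uE.
pose w2 := ((w + u x1) / 2)%R.
have ww2 : (w < w2)%R by rewrite /w2; lra.
have w2u1 : (w2 < u x1)%R by rewrite /w2; lra.
have w20 : (0 < w2)%R by exact: le_lt_trans ww2.
pose M := fine (m setT); have M0 : (0 <= M)%R by rewrite fine_ge0.
(* At squared distance at least [s] from [K] the potential is at most
   [s^(-a) M = w2 M/(M + 1) <= w2]. *)
pose s := ((w2 / (M + 1)) `^ (- a^-1))%R.
have M1 : (0 < M + 1)%R by rewrite ltr_wpDl.
have s0 : (0 < s)%R by rewrite powR_gt0 // divr_gt0.
have sE : (s `^ (- a) = w2 / (M + 1))%R.
  by rewrite /s -powRrM mulrNN mulVf ?gt_eqF // powRr1 // ltW // divr_gt0.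
(* A coordinate beyond [B1] puts [x] at distance at least [s + 1] from [K], and [(s + 1)^2 >= s]. *)
pose B1 := (Num.max B0 0 + s + 1)%R.
have B00 : (0 <= Num.max B0 0)%R by rewrite le_max lexx orbT.
have far x i : (B1 < `|x ord0 i|)%R -> U x <= w2%:E.
  move=> Bx; apply: (@le_trans _ _ ((w2 / (M + 1))%:E * m setT)).
    rewrite -integral_cst //; apply: ae_ge0_le_integral => //.
    - by move=> y _; exact: riesz_kernel_ge0.
    - exact: measurable_riesz_kernel1.
    - by move=> y _; rewrite lee_fin ltW // divr_gt0.
    apply: (ae_supported cK mK) => y Ky _; rewrite /= -sE.
    apply: (riesz_kernel_le alphan s0).
    have yB : (`|y ord0 i| <= Num.max B0 0)%R.
      by rewrite le_max ((cubeP _ _).1 (KB _ Ky)).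
    have sxy : (s + 1 <= `|x ord0 i - y ord0 i|)%R.
      by have := ler_dist_dist (x ord0 i) (y ord0 i); rewrite ler_norml => /andP[_]; rewrite /B1 in Bx; lra.
    apply: le_trans (sqr_le_sqd x y i); rewrite -[leRHS]real_normK ?num_real //.
    apply: (@le_trans _ _ ((s + 1) ^+ 2)%R); first by rewrite expr2; nra.
    by rewrite ler_sqr ?nnegrE // ?ltW // ltr_wpDl // ltW.
  have -> : m setT = M%:E by rewrite fineK // fin_num_measure.
  rewrite -EFinM lee_fin mulrAC ler_pdivrMr //; nra.
(* The extra 1 leaves room for shifting the maximum point by at most 1 inside the cube. *)
pose B := (B1 + 1)%R.
have B10 : (0 <= B1)%R by rewrite /B1; lra.
have far' x i : (w2 < u x)%R -> ~ K x -> (`|x ord0 i| <= B1)%R.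
  move=> wu nKx; rewrite leNgt; apply/negP => /far.
  by rewrite uE // lee_fin leNgt wu.
pose g x := Num.max (u x) w2.
have cg : continuous g.
  move=> x; have [Kx|nKx] := pselect (K x).
    (* The semicontinuity hypothesis with this gap makes [g] constant, equal to [w2], around each
       point of [K]. *)
    have e0 : (0 < w2 - w)%R by rewrite subr_gt0.
    have H : \forall x' \near x, g x' = w2.
      apply: filterS (usc x _ Kx e0) => x' H; apply/max_idPr.
      have : U x' <= w2%:E by move: H; rewrite addrC subrK.
      have U0 : 0 <= U x' by exact: potential_ge0.
      by rewrite /u; case: (U x') U0 => [r|//|//] _; rewrite lee_fin.
    have gx : g x = w2 by exact: nbhs_singleton H.
    rewrite /continuous_at gx; exact: (@cvg_near_cst _ _ w2 g (nbhs x) (nbhs_filter x) H).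
  have [Uf Uc] := off x nKx.
  have cu : u x' @[x' --> x] --> u x.
    have Uc2 : U x' @[x' --> x] --> (u x)%:E by rewrite -uE.
    exact: (fine_cvg Uc2).
  exact: (cvg_comp _ _ cu (@continuous_max_cst R w2 (u x))).
(* On the cube the quadratic term stays below [u x1 - w2], so it cannot bring the maximum point down
   to the truncated region. *)
pose eps := ((u x1 - w2) / (n%:R * B ^+ 2 + 1))%R.
have nB : (0 < n%:R * B ^+ 2 + 1)%R by rewrite ltr_wpDl // mulr_ge0 ?sqr_ge0.
have eps0 : (0 < eps)%R by rewrite divr_gt0 // subr_gt0.
pose phi x := (g x + eps * sqd x 0)%R.
have ce : continuous (fun x => eps * sqd x 0)%R.
  move=> x; apply: (@continuous_comp _ _ _ (fun x => sqd x 0%R) ( *%R eps)).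
    exact: continuous_sqd.
  exact: mulrl_continuous.
have cphi : continuous phi by move=> x; exact: (continuousD (cg x) (ce x)).
have x1B : cube B x1.
  apply/cubeP => i; apply: (@le_trans _ _ B1); first exact: far'.
  by rewrite lerDl.
have [c] := @EVT_max_rV R n phi (cube B) (ex_intro _ _ x1B) (@compact_cube B)
  (continuous_subspaceT cphi).
move=> /set_mem cB cmax.
have sqdB x : cube B x -> (sqd x 0 <= n%:R * B ^+ 2)%R.
  move=> /cubeP xB; rewrite mulr_natl -[X in (_ *+ X)%R](card_ord n) -sumr_const.
  apply: ler_sum => i _; rewrite mxE subr0 -real_normK ?num_real //.
  by rewrite ler_sqr ?nnegrE // addr_ge0.
have gc : (w2 < u c)%R.
  have h1 : (phi x1 <= phi c)%R by apply: cmax; exact/mem_set.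
  have h2 : (u x1 <= g x1)%R by rewrite /g le_max lexx.
  have h3 : (eps * sqd c 0 < u x1 - w2)%R.
    apply: (@le_lt_trans _ _ (eps * (n%:R * B ^+ 2))%R).
      by rewrite ler_wpM2l ?(ltW eps0) //; exact: sqdB.
    rewrite /eps mulrAC ltr_pdivrMr // ltr_pM2l ?subr_gt0 //.
    by rewrite ltrDl.
  have h4 : (0 <= eps * sqd x1 0)%R by rewrite mulr_ge0 ?sqd_ge0 // ltW.
  have : (w2 < g c)%R by exact: (r1 (g x1) _ (g c) _ (u x1) w2 h1 h2 h3 h4).
  by rewrite /g lt_max ltxx orbF.
have nKc : ~ K c.
  move=> Kc; have := Uw c Kc; have U0 : 0 <= U c by exact: potential_ge0.
  move: gc; rewrite /u -/U; case: (U c) U0 => [r|//|//] _ /= h.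
  by rewrite lee_fin leNgt (lt_trans ww2).
have [C [h0 [C0 h00 HC]]] := potential_laplacian alphan alpha_le2 cK mK nKc.
(* Maximality will give [2 n eps h^2 <= C h^4]; the bound [h (C + 1) <= n eps] with [h <= 1]
   contradicts it. *)
pose h := Num.min (Num.min 1%R h0) (n%:R * eps / (C + 1))%R.
have n0 : (0 < n%:R :> R)%R by rewrite ltr0n.
have C1 : (0 < C + 1)%R by rewrite ltr_wpDl.
have hp : (0 < h)%R by rewrite !lt_min ltr01 h00 /= divr_gt0 // mulr_gt0.
have hh1 : (h <= 1)%R by rewrite !ge_min lexx.
have hh0 : (h <= h0)%R by rewrite !ge_min lexx orbT.
have hC : (h * (C + 1) <= n%:R * eps)%R by rewrite -ler_pdivlMr // ge_min lexx orbT.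
have [nK1 nK2 L] : [/\ forall i, ~ K (axis_shift i h c), forall i, ~ K (axis_shift i (- h) c) &
    (2 * n%:R * u c <= \sum_(i < n) (u (axis_shift i h c) +
      u (axis_shift i (- h) c)) + C * h ^+ 4)%R].
  by apply: HC; rewrite hp hh0.
have cB1 i : (`|c ord0 i| <= B1)%R by exact: far'.
have sB i s' : (`|s'| <= 1)%R -> cube B (axis_shift i s' c).
  move=> s'1; apply/cubeP => j; rewrite axis_shiftE (le_trans (ler_normD _ _)) //.
  rewrite /B lerD // normrM; case: (j == i); first by rewrite normr1 mulr1.
  by rewrite normr0 mulr0.
have ph i s' : (`|s'| <= 1)%R ->
    (u (axis_shift i s' c) <= u c - eps * (2 * s' * c ord0 i + s' ^+ 2))%R.
  move=> /(sB i)/mem_set/cmax; rewrite /phi sqd_axis_shift mxE subr0.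
  have -> : (g c = u c)%R by apply/max_idPl; exact: ltW.
  have : (u (axis_shift i s' c) <= g (axis_shift i s' c))%R by rewrite /g le_max lexx.
  exact: r2.
have sumle : (\sum_(i < n) (u (axis_shift i h c) + u (axis_shift i (- h) c)) <=
    2 * n%:R * u c - 2 * n%:R * eps * h ^+ 2)%R.
  apply: (@le_trans _ _ (\sum_(i < n) (2 * u c - 2 * eps * h ^+ 2))%R).
    apply: ler_sum => i _.
    have p1 : (`|h| <= 1)%R by rewrite gtr0_norm.
    have p2 : (`|- h| <= 1)%R by rewrite normrN gtr0_norm.
    exact: r3 (ph i h p1) (ph i (- h)%R p2).
  by rewrite sumr_const card_ord -mulr_natl le_eqVlt; apply/orP; left; apply/eqP; ring.
have h2 : (0 < h ^+ 2)%R by rewrite exprn_gt0.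
have : (2 * n%:R * eps * h ^+ 2 <= C * h ^+ 4)%R by exact: r4 L sumle.
have -> : (C * h ^+ 4 = C * h ^+ 2 * h ^+ 2)%R by ring.
rewrite ler_pM2r // => F1.
have h2h : (h ^+ 2 <= h)%R by rewrite expr2 ler_piMr // ltW.
have ne0 : (0 < n%:R * eps)%R by rewrite mulr_gt0.
have CC : (C * h ^+ 2 <= C * h)%R by rewrite ler_wpM2l.
exact: r5 F1 CC hC hp ne0.
Qed.

End compact_maximum_principle.

Section maximum_principle.
Context (R : realType) (n : nat).
Local Notation T := (borelRn R n).
Variable alpha : R.
Hypotheses (alphan : (alpha < n%:R)%R) (n_gt0 : (0 < n)%N) (alpha_le2 : (alpha <= 2)%R).

(** The restriction of [m] to a cube has a smaller potential, so it obeys the bound on the compact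
    part of the support; Fatou lets the cubes grow. *)
Lemma maximum_principle (sigma m : {measure set T -> \bar R}) (F : set 'rV[R]_n) (w : R) :
  closed F -> sigma setT < +oo ->
  (forall x, F x -> potential alpha sigma x \is a fin_num) ->
  {within F, continuous (potential alpha sigma)} ->
  (forall A : set T, measurable A -> m A <= sigma A) ->
  support m `<=` F -> (0 <= w)%R ->
  (forall x, support m x -> potential alpha m x <= w%:E) ->
  forall x, potential alpha m x <= w%:E.
Proof.
move=> cF sfin pot_fin pot_cont le SF w0 Sw x.
have mfin : m setT < +oo by exact: le_lt_trans (le _ measurableT) sfin.
have cS : closed (support m) := @closed_support R n m.
have mS : m (~` support m) = 0 := @measureC_support R n m.
have mC k : measurable (cube k%:R : set T).
  by apply: measurable_closed; exact: closed_cube.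
pose mk k := mrestr m (mC k).
have mkm k (A : set T) : measurable A -> mk k A <= m A by exact: mrestr_le.
have mks k (A : set T) : measurable A -> mk k A <= sigma A.
  by move=> mA; exact: le_trans (mkm k A mA) (le A mA).
have mkfin k : mk k setT < +oo by exact: le_lt_trans (mkm k _ measurableT) mfin.
have mkF k : mk k (~` F) = 0.
  apply/eqP; rewrite -measure_le0 -mS.
  have mF : measurable (~` F : set T) by apply: measurableC; exact: measurable_closed.
  apply: le_trans (mkm k _ mF) _; apply: le_measure; rewrite ?inE //.
    by apply: measurableC; exact: measurable_closed.
  exact: subsetC.
have Uk k : potential alpha (mk k) x <= w%:E.
  pose K := support m `&` cube k%:R.
  have Ukw y : K y -> potential alpha (mk k) y <= w%:E.
    by move=> [Sy _]; apply: le_trans (Sw y Sy); exact: (potential_le alphan y (mkm k) mfin).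
  apply: (@maximum_principle_compact R n alpha alphan n_gt0 alpha_le2
    (finite_measure_of (mkfin k)) K k%:R w) => //.
  - by apply: closedI => //; exact: closed_cube.
  - apply/eqP; rewrite -measure_le0 -mS.
    change (m (~` K `&` cube k%:R) <= m (~` support m)).
    apply: le_measure; rewrite ?inE.
    + apply: measurableI => //; apply: measurableC; apply: measurable_closed.
      by apply: closedI => //; exact: closed_cube.
    + by apply: measurableC; exact: measurable_closed.
    + by move=> y [nK yk] Sy; apply: nK.
  - by move=> y [].
  move=> x0 e Kx0 e0; have Fx0 : F x0 by apply: SF; case: Kx0.
  have := potential_usc alphan sfin pot_fin pot_cont cF (mkF k) (mks k) Fx0 e0.
  apply: filterS => y; move=> H; apply: (le_trans H).
  by rewrite EFinD leeD2r // Ukw.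
pose f k (y : T) := riesz_kernel alpha x y * (\1_(cube k%:R : set T) y)%:E.
have mf k : measurable_fun setT (f k).
  apply: emeasurable_funM; first exact: measurable_riesz_kernel1.
  by apply/measurable_EFinP; apply: measurable_indic.
have f0 k y : setT y -> 0 <= f k y.
  by move=> _; rewrite mule_ge0 ?riesz_kernel_ge0 // lee_fin.
have fE k : \int[m]_y f k y = potential alpha (mk k) x.
  rewrite (potential_mrestr alphan) [RHS]integral_mkcond; apply: eq_integral => y _.
  by rewrite patchE /f indicE; case: ifP => _; rewrite ?mule1 ?mule0.
have fl y : f k y @[k --> \oo] --> riesz_kernel alpha x y.
  apply: cvg_near_cst; pose N := (\sum_(i < n) (Num.truncn `|y ord0 i|).+1)%N.
  exists N => // k /= Nk; rewrite /f indicE mem_set ?mule1 //.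
  apply/cubeP => i; apply: ltW; apply: (lt_le_trans (truncnS_gt _)); rewrite ler_nat.
  by apply: leq_trans Nk; rewrite /N (bigD1 i) //= leq_addr.
have Fa := fatou m measurableT mf f0.
apply: (@le_trans _ _ (\int[m]_y limn_einf (fun k => f k y))).
  rewrite le_eqVlt; apply/orP; left; apply/eqP; apply: eq_integral => y _.
  by rewrite (cvg_limn_einf_sup (fl y)).1.
apply: (le_trans Fa); rewrite limn_einf_lim.
apply: lime_le; first exact: is_cvg_einfs.
apply: nearW => k; apply: le_trans (Uk k); rewrite -fE; apply: ereal_inf_lbound.
by exists k => //=.
Qed.

End maximum_principle.

(** * The constrained minimizer *)

Section mutual_energy_combinations.
Context (R : realType) (n : nat).
Local Notation T := (borelRn R n).
Variable alpha : R.
Hypothesis alphan : (alpha < n%:R)%R.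
Local Notation M := (mutual_energy alpha).
Implicit Types (p q x y : {measure set T -> \bar R}) (c e : {nonneg R}).

Lemma measurable_potential_fin q : q setT < +oo ->
  measurable_fun setT (potential alpha q : T -> \bar R).
Proof. by move=> qfin; exact: (measurable_potential alphan (finite_measure_of qfin)). Qed.

Lemma mutual_energy_sym p q : p setT < +oo -> q setT < +oo -> M p q = M q p.
Proof.
move=> pfin qfin.
exact: (mutual_energyC alphan (finite_measure_of pfin) (finite_measure_of qfin)).
Qed.

(** Meant for the competitors [p + (1 - e) x + e y] of the minimizer [p + x]: a variation with
    nonnegative coefficients. *)
Definition combine p c x e y : {measure set T -> \bar R} :=
  measure_add p (measure_add (mscale c x) (mscale e y)).

Lemma combineE p c x e y A :
  combine p c x e y A = p A + (c%:num%:E * x A + e%:num%:E * y A).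
Proof.
transitivity (p A + measure_add (mscale c x) (mscale e y) A).
  exact: measure_addE.
by congr (_ + _); exact: measure_addE.
Qed.

Lemma integral_combine p c x e y (f : T -> \bar R) : measurable_fun setT f ->
  (forall z, 0 <= f z) ->
  \int[combine p c x e y]_z f z =
  \int[p]_z f z + (c%:num%:E * \int[x]_z f z + e%:num%:E * \int[y]_z f z).
Proof.
move=> mf f0; rewrite /combine ge0_integral_measure_add //.
by rewrite ge0_integral_measure_add // !ge0_integral_mscale.
Qed.

Lemma potential_combine p c x e y z :
  potential alpha (combine p c x e y) z = potential alpha p z +
    (c%:num%:E * potential alpha x z + e%:num%:E * potential alpha y z).
Proof.
apply: integral_combine; first exact: measurable_riesz_kernel1.
exact: riesz_kernel_ge0.
Qed.

Lemma mutual_energy_combine_l p c x e y q : q setT < +oo ->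
  M (combine p c x e y) q = M p q + (c%:num%:E * M x q + e%:num%:E * M y q).
Proof.
move=> qfin; apply: integral_combine; first exact: measurable_potential_fin.
exact: potential_ge0.
Qed.

Lemma mutual_energy_combine_r p c x e y q : p setT < +oo -> x setT < +oo ->
  y setT < +oo ->
  M q (combine p c x e y) = M q p + (c%:num%:E * M q x + e%:num%:E * M q y).
Proof.
move=> pfin xfin yfin; rewrite {1}/mutual_energy.
under eq_integral do rewrite potential_combine.
have mp := measurable_potential_fin pfin.
have mx := measurable_potential_fin xfin.
have my := measurable_potential_fin yfin.
have P0 r z : 0 <= potential alpha r z by exact: potential_ge0.
have c0 (d : {nonneg R}) r z : 0 <= d%:num%:E * potential alpha r z.
  by rewrite mule_ge0 // lee_fin.
have E1 d r : measurable_fun setT (potential alpha r : T -> \bar R) ->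
    \int[q]_z (d%:num%:E * potential alpha r z) = (d : {nonneg R})%:num%:E * M q r.
  by move=> mr; apply: ge0_integralZl; rewrite ?lee_fin //.
have E2 : \int[q]_z (c%:num%:E * potential alpha x z + e%:num%:E * potential alpha y z) =
    c%:num%:E * M q x + e%:num%:E * M q y.
  rewrite -!E1 //; apply: ge0_integralD => //; exact: measurable_funeM.
rewrite -E2; apply: ge0_integralD => //; first by move=> z _; exact: adde_ge0.
by apply: emeasurable_funD; exact: measurable_funeM.
Qed.

End mutual_energy_combinations.

(** If [D < 0], an [e] with [e |Q| <= - D] gives the value at most [e D < 0]. *)
Lemma linear_term_ge0 (R : realFieldType) (D Q : R) :
  (forall e, 0 < e <= 1 -> 0 <= 2 * e * D + e ^+ 2 * Q)%R -> (0 <= D)%R.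
Proof.
move=> H; rewrite leNgt; apply/negP => D0.
have Q1 : (0 < `|Q| + 1)%R by rewrite ltr_wpDl.
pose e := Num.min 1%R (- D / (`|Q| + 1))%R.
have e0 : (0 < e)%R by rewrite lt_min ltr01 /= divr_gt0 // oppr_gt0.
have e1 : (e <= 1)%R by rewrite ge_min lexx.
have eD : (e * (`|Q| + 1) <= - D)%R by rewrite -ler_pdivlMr // ge_min lexx orbT.
have := H e; rewrite e0 e1 => /(_ isT); have QQ := ler_norm Q.
have : (e * Q <= - D)%R by nra.
rewrite expr2; nra.
Qed.

Section constrained_minimizer.
Context (R : realType) (n : nat).
Local Notation T := (borelRn R n).
Variables (alpha : R) (F : set 'rV[R]_n) (sigma : borel_measure R n).
Local Notation M := (mutual_energy alpha).
Hypotheses (alphan : (alpha < n%:R)%R) (closedF : closed F)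
  (sigma_on : radon_on F sigma) (sigma_fin : sigma setT < +oo)
  (pot_bnd : exists B : R, forall x, F x -> potential alpha sigma x <= B%:E).
Implicit Types p q : borel_measure R n.

Let mF : measurable (F : set T). Proof. exact: measurable_closed. Qed.

Let mFC : measurable (~` F : set T). Proof. exact: measurableC. Qed.

Lemma radon_on_null p : radon_on F p -> p (~` F) = 0.
Proof.
move=> [_ SF]; apply/eqP; rewrite -measure_le0 -(measureC_support p).
apply: le_measure; rewrite ?inE //; last exact: subsetC.
by apply: measurableC; apply: measurable_closed; exact: closed_support.
Qed.

Lemma null_measureF p : p (~` F) = 0 -> p F = p setT.
Proof.
move=> pF; rewrite -(setUv F) measureU //; last exact: setICr.
by rewrite [X in _ + X](pF : _ = 0) adde0.
Qed.

Lemma measure_le_null p : measure_le p sigma -> p (~` F) = 0.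
Proof.
by move=> le; apply/eqP; rewrite -measure_le0 -(radon_on_null sigma_on); exact: le.
Qed.

Lemma measure_le_lty p : measure_le p sigma -> p setT < +oo.
Proof. by move=> le; exact: le_lt_trans (le _ measurableT) sigma_fin. Qed.

Lemma finite_radon p : p setT < +oo -> radon p.
Proof.
move=> pfin K cK; apply: le_lt_trans pfin; apply: le_measure; rewrite ?inE //.
by apply: measurable_closed; apply: compact_closed => //; exact: norm_hausdorff.
Qed.

Lemma support_measure_le p : measure_le p sigma -> support p `<=` F.
Proof.
move=> le x px; apply: sigma_on.2 => U oU Ux; apply: lt_le_trans (px U oU Ux) _.
by apply: le; exact: measurable_open.
Qed.

Lemma measure_le_radon_on p : measure_le p sigma -> radon_on F p.
Proof.
by move=> le; split; [apply: finite_radon; exact: measure_le_lty|exact: support_measure_le].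
Qed.

(** [U^q <= U^sigma] is bounded on [F], which carries [p]. Energies of measures below [sigma] can
    thus be expanded as real numbers. *)
Lemma mutual_energy_fin_num p q : p setT < +oo -> p (~` F) = 0 ->
  measure_le q sigma -> M p q \is a fin_num.
Proof.
move=> pfin pF le; have [B HB] := pot_bnd.
have pE : \int[p]_x (Num.max B 0)%:E = (Num.max B 0)%:E * p setT.
  by rewrite -integral_cst.
rewrite ge0_fin_numE; last by apply: integral_ge0 => x _; exact: potential_ge0.
apply: (@le_lt_trans _ _ ((Num.max B 0)%:E * p setT)); last first.
  by rewrite lte_mul_pinfty // lee_fin le_max lexx orbT.
rewrite -pE; apply: ae_ge0_le_integral => //.
- by move=> x _; exact: potential_ge0.
- by apply: measurable_potential_fin => //; exact: measure_le_lty.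
- by move=> x _; rewrite lee_fin le_max lexx orbT.
apply: (@ae_supported R n (finite_measure_of pfin) F closedF pF) => x Fx _.
apply: (le_trans (potential_le alphan x le sigma_fin)).
by apply: (le_trans (HB x Fx)); rewrite lee_fin le_max lexx.
Qed.

Variable lambda : borel_measure R n.
Hypotheses (lambda_in : constrained_class alpha sigma F lambda)
  (lambda_min : energy alpha lambda =
     ereal_inf [set energy alpha mu | mu in constrained_class alpha sigma F]).

Let lambda_le : measure_le lambda sigma. Proof. by case: lambda_in. Qed.

Let lambda_fin : lambda setT < +oo. Proof. exact: measure_le_lty. Qed.

Let lambda_F : lambda F = 1. Proof. by case: lambda_in. Qed.

(** The room left by the constraint: mass of [slack] may be added to [lambda], and theta is [q]
    times it. *)
Definition slack : borel_measure R n := measure_diff lambda_le sigma_fin.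

Lemma slack_le : measure_le slack sigma.
Proof.
move=> A mA; rewrite -(measure_diff_add lambda_le sigma_fin mA).
by rewrite leeDr.
Qed.

(* The first order condition along lambda - e x + e y, which stays in the
   constrained class for 0 < e <= 1. *)
Lemma minimizer_variation (x y : borel_measure R n) :
  measure_le x lambda -> measure_le y slack -> x setT = y setT ->
  M x lambda <= M y lambda.
Proof.
move=> xl yt xy.
have x_le : measure_le x sigma by move=> A mA; exact: le_trans (xl A mA) (lambda_le mA).
have y_le : measure_le y sigma by move=> A mA; exact: le_trans (yt A mA) (slack_le mA).
have xfin := measure_le_lty x_le; have yfin := measure_le_lty y_le.
pose p : borel_measure R n := measure_diff xl lambda_fin.
have p_add A : measurable A -> x A + p A = lambda A by exact: measure_diff_add.
have p_le : measure_le p sigma.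
  by move=> A mA; apply: le_trans (lambda_le mA); rewrite -p_add // leeDr.
have pfin := measure_le_lty p_le.
have fin r s : measure_le r sigma -> measure_le s sigma -> exists v : R, M r s = v%:E.
  move=> rl sl; exists (fine (M r s)); rewrite fineK //.
  by apply: mutual_energy_fin_num => //; [exact: measure_le_lty|exact: measure_le_null].
have lamE q : q setT < +oo -> M lambda q = M x q + M p q.
  move=> qfin; rewrite -[LHS](integral_measure_diff xl lambda_fin) //.
    exact: measurable_potential_fin.
  exact: potential_ge0.
have [pp ppE] := fin p p p_le p_le; have [px pxE] := fin p x p_le x_le.
have [py pyE] := fin p y p_le y_le; have [xx xxE] := fin x x x_le x_le.
have [XY xyE] := fin x y x_le y_le; have [yy yyE] := fin y y y_le y_le.
have xpE : M x p = px%:E by rewrite mutual_energy_sym.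
have ypE : M y p = py%:E by rewrite mutual_energy_sym.
have yxE : M y x = XY%:E by rewrite mutual_energy_sym.
have xlE : M x lambda = (xx + px)%:E by rewrite mutual_energy_sym // lamE // xxE pxE.
have ylE : M y lambda = (XY + py)%:E by rewrite mutual_energy_sym // lamE // xyE pyE.
have plE : M p lambda = (px + pp)%:E by rewrite mutual_energy_sym // lamE // xpE ppE.
have llE : M lambda lambda = (xx + px + (px + pp))%:E by rewrite lamE // xlE plE.
rewrite xlE ylE lee_fin -subr_ge0.
(* For mu = lambda + e (y - x), the energy grows by [2 e (M y lambda - M x lambda) + e^2 Q], where Q
   is formally the energy of [y - x]. *)
apply: (@linear_term_ge0 _ _ (xx - 2 * XY + yy)%R) => e /andP[e0 e1].
have c0 : (0 <= 1 - e)%R by rewrite subr_ge0.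
pose mu : borel_measure R n := combine p (NngNum c0) x (NngNum (ltW e0)) y.
have muE A : mu A = p A + ((1 - e)%:E * x A + e%:E * y A) by exact: combineE.
have mu_le : measure_le mu sigma.
  move=> A mA; rewrite muE -(measure_diff_add lambda_le sigma_fin mA) -p_add //.
  rewrite [x A + _]addeC -addeA; apply: leeD2l; apply: leeD.
    by rewrite -[leRHS]mul1e lee_wpmul2r // lee_fin gerBl ltW.
  apply: (@le_trans _ _ (y A)); last exact: yt.
  by rewrite -[leRHS]mul1e lee_wpmul2r // lee_fin.
have mufin := measure_le_lty mu_le.
have muF : mu F = 1.
  have xyF : x F = y F by rewrite !null_measureF //; exact: measure_le_null.
  have xFf : x F \is a fin_num.
    by rewrite ge0_fin_numE // (null_measureF (measure_le_null x_le)).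
  rewrite muE -xyF -lambda_F -p_add // addeC; congr (_ + _).
  by rewrite -(fineK xFf) -!EFinM -EFinD; congr EFin; ring.
have muM : M mu mu = (pp + ((1 - e) * px + e * py) + ((1 - e) * (px + ((1 - e) * xx + e * XY))
    + e * (py + ((1 - e) * XY + e * yy))))%:E.
  rewrite mutual_energy_combine_l // !mutual_energy_combine_r //=.
  by rewrite ppE pxE pyE xpE xxE xyE ypE yxE yyE -!EFinM.
have : energy alpha lambda <= energy alpha mu.
  rewrite lambda_min; apply: ereal_inf_lbound; exists mu => //; split => //.
  - exact: measure_le_radon_on.
  - by rewrite (muM : energy alpha mu = _) ltry.
rewrite (muM : energy alpha mu = _) (llE : energy alpha lambda = _) lee_fin.
lra.
Qed.

(** Equal masses [w] are taken from [lambda] on [A] and from [slack] on [B] by scaling restrictions;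
    then [c1 w <= M x lambda <= M y lambda <= c2 w]. *)
Lemma minimizer_exchange (A B : set T) (c1 c2 : R) :
  measurable A -> measurable B -> 0 < lambda A -> 0 < slack B -> (0 <= c1)%R ->
  (forall z, A z -> c1%:E <= potential alpha lambda z) ->
  (forall z, B z -> potential alpha lambda z <= c2%:E) -> (c1 <= c2)%R.
Proof.
move=> mA mB lA tB c10 HA HB.
have slack_fin := measure_le_lty slack_le.
have lAf : lambda A \is a fin_num by exact: (lty_fin_num_fun lambda_fin).
have tBf : slack B \is a fin_num by exact: (lty_fin_num_fun slack_fin).
pose u := fine (lambda A); pose v := fine (slack B).
have uE : lambda A = u%:E by rewrite fineK.
have vE : slack B = v%:E by rewrite fineK.
have u0 : (0 < u)%R by rewrite -lte_fin -uE.
have v0 : (0 < v)%R by rewrite -lte_fin -vE.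
pose w := Num.min u v; have w0 : (0 < w)%R by rewrite lt_min u0.
have s0 : (0 <= w / u)%R by rewrite divr_ge0 ?(ltW w0) ?(ltW u0).
have t0 : (0 <= w / v)%R by rewrite divr_ge0 ?(ltW w0) ?(ltW v0).
have s1 : (w / u <= 1)%R by rewrite ler_pdivrMr // mul1r ge_min lexx.
have t1 : (w / v <= 1)%R by rewrite ler_pdivrMr // mul1r ge_min lexx orbT.
pose x : borel_measure R n := mscale (NngNum s0) (mrestr lambda mA).
pose y : borel_measure R n := mscale (NngNum t0) (mrestr slack mB).
have scale_le (r : {nonneg R}) (m : borel_measure R n) D (mD : measurable D) :
    (r%:num <= 1)%R -> measure_le (mscale r (mrestr m mD)) m.
  move=> r1 E mE; apply: le_trans (mrestr_le m mD mE).
  change (r%:num%:E * mrestr m mD E <= mrestr m mD E).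
  by rewrite -[leRHS]mul1e lee_wpmul2r.
have xT : x setT = w%:E.
  change ((w / u)%:E * lambda (setT `&` A) = w%:E).
  by rewrite setTI uE -EFinM; congr EFin; field; rewrite gt_eqF.
have yT : y setT = w%:E.
  change ((w / v)%:E * slack (setT `&` B) = w%:E).
  by rewrite setTI vE -EFinM; congr EFin; field; rewrite gt_eqF.
have ML : M x lambda <= M y lambda.
  by apply: minimizer_variation; [exact: scale_le|exact: scale_le|rewrite xT yT].
have mU := measurable_potential_fin alphan lambda_fin.
have U0 z : 0 <= potential alpha lambda z by exact: potential_ge0.
have scaleE (r : {nonneg R}) (m : borel_measure R n) D (mD : measurable D) :
    M (mscale r (mrestr m mD)) lambda =
    r%:num%:E * \int[m]_(z in D) potential alpha lambda z.
  rewrite /mutual_energy ge0_integral_mscale //; congr (_ * _).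
  exact: integral_mrestr.
have xL : (c1 * w)%:E <= M x lambda.
  rewrite scaleE /= (_ : (c1 * w)%R = (w / u * (c1 * u))%R); last first.
    by field; rewrite gt_eqF.
  rewrite EFinM lee_wpmul2l // EFinM -uE -integral_cst //.
  by apply: ge0_le_integral => //; exact: measurable_funTS.
have yL : M y lambda <= (c2 * w)%:E.
  rewrite scaleE /= (_ : (c2 * w)%R = (w / v * (c2 * v))%R); last first.
    by field; rewrite gt_eqF.
  rewrite [leRHS]EFinM lee_wpmul2l // EFinM -vE -integral_cst //.
  by apply: ge0_le_integral => //; exact: measurable_funTS.
by have := le_trans xL (le_trans ML yL); rewrite lee_fin ler_pM2r.
Qed.

Hypotheses (pot_fin : forall x, F x -> potential alpha sigma x \is a fin_num)
  (pot_cont : {within F, continuous (potential alpha sigma)}).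

(** Otherwise two levels [c2 < c1] fit between the values: near [x] the potential exceeds [c1] by
    lower semicontinuity, near [y] it is below [c2] along [F], and both sets are charged, against
    [minimizer_exchange]. *)
Lemma potential_support_le x y : support lambda x -> support slack y ->
  potential alpha lambda x <= potential alpha lambda y.
Proof.
move=> Sx Sy.
have Fx : F x by exact: support_measure_le lambda_le _ Sx.
have Fy : F y by exact: support_measure_le slack_le _ Sy.
have Ux := potential_fin_num alphan sigma_fin pot_fin lambda_le Fx.
have Uy := potential_fin_num alphan sigma_fin pot_fin lambda_le Fy.
have U0 : 0 <= potential alpha lambda y by exact: potential_ge0.
pose a := fine (potential alpha lambda x); pose b := fine (potential alpha lambda y).
have aE : potential alpha lambda x = a%:E := esym (fineK Ux).
have bE : potential alpha lambda y = b%:E := esym (fineK Uy).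
have b0 : (0 <= b)%R by rewrite -lee_fin -bE.
rewrite leNgt; apply/negP; rewrite aE bE lte_fin => ab.
have mU := measurable_potential_fin alphan lambda_fin.
have third (r s : R) : (r < s)%R -> exists c1 c2 : R, [/\ (r < c2)%R, (c2 < c1)%R & (c1 < s)%R].
  by move=> rs; exists ((2 * s + r) / 3)%R, ((s + 2 * r) / 3)%R; split; lra.
have half (r s : R) : (r < s -> r + (s - r) / 2 < s)%R by lra.
have [c1 [c2 [bc2 c21 c1a]]] := third b a ab.
pose A : set T := [set z | c1%:E < potential alpha lambda z].
pose B : set T := [set z | potential alpha lambda z < c2%:E].
have mA : measurable A by rewrite -[A]setTI; exact: emeasurable_fun_o_infty.
have mB : measurable B by rewrite -[B]setTI; exact: emeasurable_fun_infty_o.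
have nearA : \forall z \near x, c1%:E < potential alpha lambda z.
  apply: (@potential_lsc R n alpha alphan (finite_measure_of lambda_fin)).
  by change (c1%:E < potential alpha lambda x); rewrite aE lte_fin.
have e0 : (0 < (c2 - b) / 2)%R by rewrite divr_gt0 // subr_gt0.
have e1 : (b + (c2 - b) / 2 < c2)%R by exact: half.
have nearB : \forall z \near y, F z -> potential alpha lambda z < c2%:E.
  have := potential_usc_within alphan sigma_fin pot_fin pot_cont lambda_le Fy e0.
  apply: filterS => z H Fz; apply: le_lt_trans (H Fz) _.
  by rewrite bE -EFinD lte_fin.
have lA : 0 < lambda A.
  move: nearA; rewrite /prop_near1 nbhsE; case => O [oO Ox] OA; apply: lt_le_trans (Sx O oO Ox) _.
  by apply: le_measure; rewrite ?inE //; exact: measurable_open.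
have tB : 0 < slack B.
  move: nearB; rewrite /prop_near1 nbhsE; case => O [oO Oy] OB; apply: lt_le_trans (Sy O oO Oy) _.
  have mO : measurable (O : set T) by exact: measurable_open.
  have tF := measure_le_null slack_le.
  (* The bound near [y] is known on [F] only, but [slack] does not charge the complement of [F]. *)
  apply: (@le_trans _ _ (slack (B `|` ~` F))).
    apply: le_measure; rewrite ?inE //; first exact: measurableU.
    by move=> z Oz; have [Fz|nFz] := pselect (F z); [left; exact: OB|right].
  apply: (le_trans (measureU2 _ mB mFC)).
  by rewrite [X in _ + X](tF : _ = 0) adde0.
have : (c1 <= c2)%R.
  apply: (minimizer_exchange mA mB lA tB) => [|z /ltW //|z /ltW //].
  by rewrite (le_trans b0) // ltW // (lt_trans bc2).
by rewrite leNgt c21.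
Qed.

End constrained_minimizer.

(** * The weighted problem *)

Section weighted_problem.
Context (R : realType) (n : nat).
Local Notation T := (borelRn R n).
Variables (alpha : R) (F : set 'rV[R]_n) (sigma : borel_measure R n) (q : R).
Local Notation M := (mutual_energy alpha).
Hypotheses (alphan : (alpha < n%:R)%R) (closedF : closed F)
  (sigma_on : radon_on F sigma) (sigma_fin : sigma setT < +oo) (q_ge0 : (0 <= q)%R)
  (pot_bnd : exists B : R, forall x, F x -> potential alpha sigma x <= B%:E)
  (pot_fin : forall x, potential alpha sigma x \is a fin_num).
Implicit Types (p mu nu : borel_measure R n) (eta : R).

Let f (x : 'rV[R]_n) : \bar R := (- q)%:E * potential alpha sigma x.

(** The comparison of Gaussian potentials goes one way; exchanging the two measures gives the
    other. *)
Lemma measure_eq_of_mutual_energy p mu : p setT < +oo -> mu setT < +oo ->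
  M p p < +oo -> M mu mu < +oo -> M p p + M mu mu <= 2%:E * M p mu ->
  measure_eq p mu.
Proof.
move=> pfin mufin py muy H.
have H' : M mu mu + M p p <= 2%:E * M mu p.
  by rewrite addeC (mutual_energy_sym alphan mufin pfin).
pose p' := finite_measure_of pfin; pose mu' := finite_measure_of mufin.
apply: (@gauss_determines R n p' mu') => t x t0; apply/eqP; rewrite eq_le.
apply/andP; split; apply: gauss_potential_le_of_energy_eq => //.
  exact: (gauss_energy_eq alphan (p := mu') (q := p')).
exact: (gauss_energy_eq alphan (p := p') (q := mu')).
Qed.

Lemma mutual_energy_lty p mu : p setT < +oo -> mu setT < +oo ->
  M p p < +oo -> M mu mu < +oo -> M p mu < +oo.
Proof.
move=> pfin mufin py muy.
have := mutual_energy_le alphan (finite_measure_of pfin) (finite_measure_of mufin).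
move=> /le_lt_trans/(_ (lte_add_pinfty py muy)).
change (2%:E * M p mu < +oo -> M p mu < +oo).
by case: (M p mu) => [r _|//|//]; [exact: ltry|rewrite gt0_muley].
Qed.

Lemma integrable_sigma_potential mu : mu setT < +oo -> mu (~` F) = 0 ->
  mu.-integrable setT (potential alpha sigma : T -> \bar R).
Proof.
move=> mufin muF; apply/integrableP; split; first exact: measurable_potential_fin.
under eq_integral do rewrite gee0_abs ?potential_ge0 //.
have := mutual_energy_fin_num alphan closedF sigma_fin pot_bnd mufin muF
  (fun A _ => lexx (sigma A)).
by rewrite fin_numElt => /andP[].
Qed.

Lemma integrable_field mu : mu setT < +oo -> mu (~` F) = 0 ->
  mu.-integrable setT (f : T -> \bar R).
Proof. by move=> mufin muF; apply: integrableZl => //; exact: integrable_sigma_potential. Qed.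

Lemma integral_field mu : mu setT < +oo -> mu (~` F) = 0 ->
  \int[mu]_x f x = (- q)%:E * M mu sigma.
Proof. by move=> mufin muF; apply: integralZl => //; exact: integrable_sigma_potential. Qed.

Lemma integral_potential_add_cst mu nu eta : mu setT = 1 -> nu setT < +oo ->
  (0 <= eta)%R ->
  \int[mu]_x (potential alpha nu x + eta%:E) = M mu nu + eta%:E.
Proof.
move=> mu1 nufin eta0; rewrite -[X in _ = _ + X]mule1 -mu1 -integral_cst //.
apply: ge0_integralD => //; first by move=> x _; exact: potential_ge0.
exact: measurable_potential_fin.
Qed.

Lemma integral_scaled_potential mu :
  \int[mu]_x (q%:E * potential alpha sigma x) = q%:E * M mu sigma.
Proof.
apply: ge0_integralZl => //; first exact: measurable_potential_fin.
by move=> x _; exact: potential_ge0.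
Qed.

(** Moving the finite negative field across leaves nonnegative functions on both sides, ready for
    integration in [0, +oo]. *)
Lemma weighted_potential_ge mu eta x :
  ((- eta)%:E <= weighted_potential alpha f mu x) =
  (q%:E * potential alpha sigma x <= potential alpha mu x + eta%:E).
Proof.
rewrite /weighted_potential /f; case: (potential alpha sigma x) (pot_fin x) => // s _.
have := potential_ge0 alpha mu x; case: (potential alpha mu x) => [u|_|] //.
  by move=> _; rewrite -!EFinM -!EFinD !lee_fin; apply/idP/idP; lra.
by rewrite -!EFinM /= !leey.
Qed.

Lemma weighted_potential_eq mu eta x :
  weighted_potential alpha f mu x = (- eta)%:E ->
  q%:E * potential alpha sigma x = potential alpha mu x + eta%:E.
Proof.
rewrite /weighted_potential /f; case: (potential alpha sigma x) (pot_fin x) => // s _.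
have := potential_ge0 alpha mu x; case: (potential alpha mu x) => [u|_|] //.
by move=> _; rewrite -!EFinM -!EFinD => -[H]; congr EFin; lra.
Qed.

Lemma equilibrium_ge mu nu eta : mu setT = 1 -> nu setT < +oo -> (0 <= eta)%R ->
  (forall x, (- eta)%:E <= weighted_potential alpha f nu x) ->
  q%:E * M mu sigma <= M mu nu + eta%:E.
Proof.
move=> mu1 nufin eta0 H.
rewrite -integral_scaled_potential -integral_potential_add_cst //.
apply: ge0_le_integral => //.
- by move=> x _; rewrite mule_ge0 ?potential_ge0.
- by apply: measurable_funeM; exact: measurable_potential_fin.
- by apply: emeasurable_funD; [exact: measurable_potential_fin|exact: measurable_cst].
- by move=> x _; rewrite -weighted_potential_ge.
Qed.

(** Integration against [nu] itself: the equality on S([nu]) holds [nu]-almost everywhere. *)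
Lemma equilibrium_eq nu eta : nu setT = 1 -> (0 <= eta)%R ->
  equilibrium_relations alpha f nu eta ->
  q%:E * M nu sigma = M nu nu + eta%:E.
Proof.
move=> nu1 eta0 [H1 H2]; have nufin : nu setT < +oo by rewrite nu1 ltry.
apply/eqP; rewrite eq_le; apply/andP; split; first exact: equilibrium_ge.
rewrite -integral_scaled_potential -integral_potential_add_cst //.
apply: ae_ge0_le_integral => //.
- by move=> x _; rewrite adde_ge0 ?potential_ge0.
- by apply: emeasurable_funD; [exact: measurable_potential_fin|exact: measurable_cst].
- by move=> x _; rewrite mule_ge0 ?potential_ge0.
- by apply: measurable_funeM; exact: measurable_potential_fin.
apply: (@ae_supported R n (finite_measure_of nufin) (support nu)).
- exact: closed_support.
- exact: measureC_support.
by move=> x Sx _; rewrite (weighted_potential_eq (H1 x Sx)).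
Qed.

(** By [equilibrium_eq] the left side is [- M nu nu - 2 eta]; the right side is at least
    [M mu mu - 2 M mu nu - 2 eta] by [equilibrium_ge], and [mutual_energy_le] compares the two. *)
Lemma equilibrium_minimizes mu nu eta : mu setT = 1 -> nu setT = 1 ->
  mu (~` F) = 0 -> nu (~` F) = 0 -> M mu mu < +oo -> M nu nu < +oo -> (0 <= eta)%R ->
  equilibrium_relations alpha f nu eta ->
  weighted_energy alpha f nu <= weighted_energy alpha f mu.
Proof.
move=> mu1 nu1 muF nuF muy nuy eta0 H.
have mufin : mu setT < +oo by rewrite mu1 ltry.
have nufin : nu setT < +oo by rewrite nu1 ltry.
have E1 := equilibrium_eq nu1 eta0 H.
have E2 := equilibrium_ge mu1 nufin eta0 H.2.
have E3 := mutual_energy_le alphan (finite_measure_of mufin) (finite_measure_of nufin).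
rewrite /weighted_energy !integral_field //.
have S (r : borel_measure R n) : r setT < +oo -> r (~` F) = 0 -> M r sigma \is a fin_num.
  move=> rfin rF; exact: (mutual_energy_fin_num alphan closedF sigma_fin pot_bnd rfin rF
    (fun A _ => lexx (sigma A))).
have Mf (r s : borel_measure R n) : M r s < +oo -> M r s \is a fin_num.
  by rewrite ge0_fin_numE // /mutual_energy integral_ge0 // => x _; exact: potential_ge0.
change (M nu nu + 2%:E * ((- q)%:E * M nu sigma) <=
  M mu mu + 2%:E * ((- q)%:E * M mu sigma)).
have {}E3 : 2%:E * M mu nu <= M mu mu + M nu nu := E3.
move: E1 E2 E3 (S _ mufin muF) (S _ nufin nuF) (Mf _ _ muy) (Mf _ _ nuy)
  (Mf _ _ (mutual_energy_lty mufin nufin muy nuy)).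
case: (M nu nu) => // b; case: (M mu mu) => // a; case: (M mu nu) => // c.
case: (M nu sigma) => // t; case: (M mu sigma) => // s.
rewrite -!EFinM -!EFinD => -[E1]; rewrite !lee_fin => E2 E3 _ _ _ _ _.
have -> : (a + 2 * (- q * s) = a - 2 * (q * s))%R by ring.
have -> : (b + 2 * (- q * t) = b - 2 * (q * t))%R by ring.
lra.
Qed.

(** Testing each measure with the other's relations gives [M mu mu + eta <= M mu nu + eta'] and
    [M nu nu + eta' <= M mu nu + eta]. In the sum the constants cancel, leaving the equality case of
    the energy inequality. *)
Lemma equilibrium_unique mu nu eta eta' : mu setT = 1 -> nu setT = 1 ->
  M mu mu < +oo -> M nu nu < +oo ->
  (0 <= eta)%R -> (0 <= eta')%R ->
  equilibrium_relations alpha f mu eta -> equilibrium_relations alpha f nu eta' ->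
  measure_eq mu nu.
Proof.
move=> mu1 nu1 muy nuy eta0 eta'0 H H'.
have mufin : mu setT < +oo by rewrite mu1 ltry.
have nufin : nu setT < +oo by rewrite nu1 ltry.
apply: measure_eq_of_mutual_energy => //.
have E1 := equilibrium_eq mu1 eta0 H.
have E1' := equilibrium_eq nu1 eta'0 H'.
have E2 := equilibrium_ge mu1 nufin eta'0 H'.2.
have E2' := equilibrium_ge nu1 mufin eta0 H.2.
rewrite (mutual_energy_sym alphan nufin mufin) E1' in E2'.
rewrite E1 in E2.
have Mf (r s : borel_measure R n) : M r s < +oo -> M r s \is a fin_num.
  by rewrite ge0_fin_numE // /mutual_energy integral_ge0 // => x _; exact: potential_ge0.
move: {E1 E1'} E2 E2' (Mf _ _ muy) (Mf _ _ nuy)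
  (Mf _ _ (mutual_energy_lty mufin nufin muy nuy)).
case: (M nu nu) => // b; case: (M mu mu) => // a; case: (M mu nu) => // c.
by rewrite -!EFinM -!EFinD !lee_fin => E2 E3 _ _ _; lra.
Qed.

End weighted_problem.

(** The kernel vanishes nowhere, so a zero potential would make the whole space null. *)
Lemma potential_gt0 (R : realType) (n : nat) (alpha : R) (m : borel_measure R n) x :
  (alpha < n%:R)%R -> 0 < m setT -> 0 < potential alpha m x.
Proof.
move=> alphan m0; rewrite lt_neqAle potential_ge0 andbT eq_sym; apply/eqP => U0.
have mk := measurable_riesz_kernel1 alphan x.
have := (ae_eq_integral_abs m measurableT mk).1.
under eq_integral do rewrite gee0_abs ?riesz_kernel_ge0 //.
move=> /(_ U0) [A [mA A0 HA]].
have AT : [set: borelRn R n] `<=` A.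
  move=> y _; apply: HA => /= /(_ I) /=.
  have [->|xy] := eqVneq x y; first by rewrite riesz_kernelxx.
  rewrite riesz_kernelE // => -[] /eqP.
  by rewrite gt_eqF // powR_gt0 // sqd_gt0.
have {}AT : A = setT by apply/seteqP; split.
by move: m0; rewrite lt_neqAle => /andP[/eqP + _]; apply; rewrite -AT; exact: esym A0.
Qed.

Theorem theorem10p1 (R : realType) (n : nat) (alpha : R) (F : set 'rV[R]_n)
    (sigma lambda : borel_measure R n)
    (n_ge3 : (3 <= n)%N)
    (alpha_gt0 : (0 < alpha)%R) (alpha_le2 : (alpha <= 2)%R)
    (closedF : closed F)
    (capF : 0 < capacity alpha F)
    (sigma_on : radon_on F sigma)
    (sigma_gt1 : 1 < sigma F) (sigma_fin : sigma F < +oo)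
    (pot_fin : forall x, F x -> potential alpha sigma x \is a fin_num)
    (pot_cont : {within F, continuous (potential alpha sigma)})
    (pot_bnd : exists M : R, forall x, F x -> potential alpha sigma x <= M%:E)
    (lambda_in : constrained_class alpha sigma F lambda)
    (lambda_min : energy alpha lambda =
       ereal_inf [set energy alpha mu | mu in constrained_class alpha sigma F]) :
  let q : R := ((fine (sigma F) - 1)^-1)%R in
  let f : 'rV[R]_n -> \bar R := fun x => (- q)%:E * potential alpha sigma x in
  exists theta : borel_measure R n,
    [/\ (forall A : set (borelRn R n), measurable A ->
           theta A = q%:E * (sigma A - lambda A)),
        weighted_class alpha f F theta,
        weighted_energy alpha f theta =
          ereal_inf [set weighted_energy alpha f mu |
                      mu in weighted_class alpha f F],
        (exists eta : R, (0 < eta)%R /\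
           equilibrium_relations alpha f theta eta) &
        (forall nu : borel_measure R n, weighted_class alpha f F nu ->
           (exists eta : R, (0 < eta)%R /\
              equilibrium_relations alpha f nu eta) ->
           measure_eq nu theta)].
Proof.
move=> q f.
have alphan : (alpha < n%:R)%R.
  by apply: le_lt_trans alpha_le2 _; rewrite ltr_nat.
have n_gt0 : (0 < n)%N by exact: ltn_trans n_ge3.
have sF := radon_on_null closedF sigma_on.
have sT : sigma setT = sigma F by rewrite (null_measureF closedF sF).
have sfin : sigma setT < +oo by rewrite sT.
pose s := fine (sigma F).
have sE : sigma F = s%:E by rewrite fineK // ge0_fin_numE.
have s1 : (1 < s)%R by rewrite -lte_fin -sE.
have q0 : (0 < q)%R by rewrite invr_gt0 subr_gt0.
have [lambda_on lambda_le lambda_F _] := lambda_in.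
have lambda1 : lambda setT = 1.
  by rewrite -lambda_F (null_measureF closedF) // (measure_le_null closedF sigma_on).
pose tau : borel_measure R n := slack sfin lambda_in.
have tau_le : measure_le tau sigma by exact: slack_le.
have tauF : tau (~` F) = 0 by exact: measure_le_null tau_le.
have tauE A : measurable A -> tau A = sigma A - lambda A by exact: measure_diffE.
(* [q] is the inverse of this mass, so that theta has mass one. *)
have tauT : tau setT = (s - 1)%:E by rewrite tauE // sT sE lambda1.
have tau_fin : tau setT < +oo by rewrite tauT ltry.
pose theta : borel_measure R n := mscale (NngNum (ltW q0)) tau.
have thetaE A : theta A = q%:E * tau A by [].
have theta1 : theta setT = 1.
  by rewrite thetaE tauT -EFinM mulVf // gt_eqF // subr_gt0.
have theta_fin : theta setT < +oo by rewrite theta1 ltry.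
have thetaF : theta (~` F) = 0 by rewrite thetaE tauF mule0.
have thetaS x : support theta x -> support tau x.
  move=> Sx V oV Vx; have := Sx V oV Vx; rewrite thetaE.
  by rewrite pmule_rgt0 ?lte_fin.
have theta_on : radon_on F theta.
  split; first exact: finite_radon.
  by move=> x /thetaS; exact: (support_measure_le sigma_on tau_le).
(* Off [F] finiteness comes from the positive distance to the closed set [F], which carries
   [sigma]. *)
have U_sigma x : potential alpha sigma x \is a fin_num.
  have [Fx|nFx] := pselect (F x); first exact: pot_fin.
  exact: (potential_off_support alphan (m := finite_measure_of sfin) closedF sF nFx).1.
have U_theta x : potential alpha theta x = q%:E * potential alpha tau x.
  apply: ge0_integral_mscale => //; first exact: measurable_riesz_kernel1.
  by move=> y _; exact: riesz_kernel_ge0.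
have U_split x : potential alpha lambda x + potential alpha tau x =
    potential alpha sigma x by exact: potential_measure_diff.
have cancel (u v : \bar R) : u \is a fin_num -> v \is a fin_num ->
    q%:E * v + (- q)%:E * (u + v) = (- q)%:E * u.
  move=> /fineK <- /fineK <-; rewrite -[in LHS]EFinD -!EFinM.
  by congr EFin; ring.
have W_theta x : weighted_potential alpha f theta x =
    (- q)%:E * potential alpha lambda x.
  rewrite /weighted_potential /f U_theta -U_split.
  by move: (U_sigma x); rewrite -U_split fin_numD => /andP[]; exact: cancel.
have U_fin x : potential alpha lambda x \is a fin_num.
  by move: (U_sigma x); rewrite -U_split fin_numD => /andP[].
have max_tau y : support tau y -> forall x,
    potential alpha lambda x <= potential alpha lambda y.
  move=> Sy x; rewrite -(fineK (U_fin y)).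
  apply: (maximum_principle alphan n_gt0 alpha_le2 closedF sfin pot_fin pot_cont lambda_le).
  - exact: (support_measure_le sigma_on lambda_le).
  - by rewrite fine_ge0 // potential_ge0.
  move=> z Sz; rewrite (fineK (U_fin y)).
  exact: (potential_support_le alphan closedF sigma_on pot_bnd lambda_min pot_fin pot_cont).
have [y0 Sy0] : support tau !=set0.
  apply/set0P/eqP => S0; have := measure_support tau.
  by rewrite S0 measure0 tauT => -[] /eqP; rewrite eq_sym gt_eqF // subr_gt0.
pose w := fine (potential alpha lambda y0).
have wE : potential alpha lambda y0 = w%:E := esym (fineK (U_fin y0)).
(* This is where eta > 0 comes from: [lambda] has mass one and the kernel is positive. *)
have w0 : (0 < w)%R.
  by rewrite -lte_fin -wE; apply: potential_gt0 => //; rewrite lambda1.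
have relations : equilibrium_relations alpha f theta (q * w).
  split => [x /thetaS Sx|x]; rewrite W_theta.
    have -> : potential alpha lambda x = w%:E.
      apply: etrans wE; apply: le_anti; apply/andP.
      by split; [exact: max_tau y0 Sy0 x|exact: max_tau x Sx y0].
    by rewrite -EFinM mulNr.
  have := max_tau y0 Sy0 x; rewrite wE; have := U_fin x.
  case: (potential alpha lambda x) => // u _; rewrite -EFinM !lee_fin mulNr lerN2 => uw.
  by rewrite ler_pM2l.
have eta0 : (0 < q * w)%R by rewrite mulr_gt0.
have theta_energy : energy alpha theta < +oo.
  have tt := mutual_energy_fin_num alphan closedF sfin pot_bnd tau_fin tauF tau_le.
  have -> : energy alpha theta = q%:E * (q%:E * mutual_energy alpha tau tau).
    have mU := measurable_potential_fin alphan tau_fin.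
    rewrite /energy; under eq_integral do rewrite U_theta.
    transitivity (q%:E * \int[tau]_x (q%:E * potential alpha tau x)).
      apply: ge0_integral_mscale => //; first exact: measurable_funeM.
      by move=> x _; rewrite mule_ge0 ?potential_ge0 // lee_fin ltW.
    congr (_ * _); apply: ge0_integralZl => //; last by rewrite lee_fin ltW.
    by move=> x _; exact: potential_ge0.
  by case: (mutual_energy alpha tau tau) tt => // r _; rewrite -!EFinM ltry.
have integrable_f (mu : borel_measure R n) : mu setT < +oo -> mu (~` F) = 0 ->
    mu.-integrable setT (f : borelRn R n -> \bar R).
  by move=> mufin muF; exact: (integrable_field q alphan closedF sfin pot_bnd mufin muF).
have theta_in : weighted_class alpha f F theta.
  split => //; first by rewrite (null_measureF closedF).
  exact: integrable_f.
have class_null (mu : borel_measure R n) : weighted_class alpha f F mu -> mu (~` F) = 0 /\ mu setT = 1.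
  move=> [mu_on mu1 _ _]; have muF := radon_on_null closedF mu_on.
  by split=> //; rewrite -(null_measureF closedF muF).
exists theta; split => //.
- by move=> A mA; rewrite thetaE tauE.
- apply/eqP; rewrite eq_le; apply/andP; split; last first.
    by apply: ereal_inf_lbound; exists theta.
  apply: le_ereal_inf_tmp => _ [mu mu_in <-]; have [muF mu1] := class_null mu mu_in.
  have [_ _ mu_energy _] := mu_in.
  exact: (equilibrium_minimizes alphan closedF sfin (ltW q0) pot_bnd U_sigma
    mu1 theta1 muF thetaF mu_energy theta_energy (ltW eta0) relations).
- by exists (q * w)%R.
move=> nu nu_in [eta [eta_gt0 nu_relations]]; have [nuF nu1] := class_null nu nu_in.
have [_ _ nu_energy _] := nu_in.
exact: (equilibrium_unique alphan sfin (ltW q0) U_sigma nu1 theta1 nu_energy theta_energy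
  (ltW eta_gt0) (ltW eta0) nu_relations relations).
Qed.
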